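(* Let $(M^n,g)$ be a smooth Riemannian manifold, let $1\le s\le n-1$, and let $u_0,\dots,u_{s-1}$ be $C^3$ functions on $M$ satisfying $du_0\wedge\cdots\wedge du_{s-1}\neq0$. Let $Z_0,\dots,Z_s$ be nonvanishing smooth vector fields with $$Z_m\,|Z_{m+1}|^{-1}=\nabla_{\Sigma_m}u_m,\qquad 0\le m\le s-1,$$ and assume $\operatorname{div}_{\Sigma_m}Z_m=0$ for all $0\le m\le s-1$. Then $$\begin{aligned}\Delta\log|Z_0|-\Delta_{\Sigma_s}\log|Z_s| =&\sum_{m=0}^{s-1}\bigl(|A_{\Sigma_{m+1}}|^2-H_{\Sigma_{m+1}}^2\bigr)+\mathcal C_s(\nu_1,\dots,\nu_s)\\ &+\sum_{m=1}^{s-1}\sum_{p=m+1}^{s}\sum_{q=p+1}^{n}\Bigl(A_{\Sigma_m}(e_p,e_p)A_{\Sigma_m}(e_q,e_q)-A_{\Sigma_m}(e_p,e_q)^2\Bigr)\\ &+\sum_{m=0}^{s-1}\Bigl(|Z_m|^{-1}\nabla^{\Sigma_m}_{\nu_{m+1}}\bigl(\operatorname{div}_{\Sigma_m}Z_m\bigr)-\bigl\langle\nabla_{\Sigma_{m+1}}\log|\nabla_{\Sigma_m}u_m|,\nabla_{\Sigma_{m+1}}\log|Z_{m+1}|\bigr\rangle\Bigr).\end{aligned}$$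
   Context: For $0\le m\le s$, $\Sigma_m$ denotes the joint level sets of the map $(u_0,\dots,u_{m-1})$, with $\Sigma_0=M$; through each point passes exactly one such level set, locally an $(n-m)$-dimensional submanifold, with induced metric $g_{\Sigma_m}$ and Levi-Civita connection $\nabla^{\Sigma_m}$. $\nabla_{\Sigma_m}f$ and $\Delta_{\Sigma_m}f$ denote the gradient and Laplacian, at each point on the level set $\Sigma_m$ through it, of the restriction of $f$, and $\operatorname{div}_{\Sigma_m}$ the divergence on $\Sigma_m$ of a vector field tangent to the level sets $\Sigma_m$; $\Delta$ is the Laplacian of $(M,g)$. Thus $\nabla_{\Sigma_m}u_m$ is the orthogonal projection of $\nabla u_m$ onto the orthogonal complement of $\nabla u_0,\dots,\nabla u_{m-1}$, and $\nu_{m+1}=\nabla_{\Sigma_m}u_m/|\nabla_{\Sigma_m}u_m|$ is the unit normal of $\Sigma_{m+1}\subset\Sigma_m$. $A_{\Sigma_{m+1}}(X,Y)=\langle\nabla^{\Sigma_m}_X\nu_{m+1},Y\rangle$ and $H_{\Sigma_{m+1}}=\operatorname{tr}A_{\Sigma_{m+1}}$ are the second fundamental form and mean curvature of $\Sigma_{m+1}$ in $\Sigma_m$ with respect to $\nu_{m+1}$. $\nabla^{\Sigma_m}_{\nu_{m+1}}f$ is the derivative of the function $f$ in direction $\nu_{m+1}$. $(e_1,\dots,e_n)$ is a (pointwise) orthonormal frame with $e_j=\nu_j$ for $1\le j\le s$ and $e_{s+1},\dots,e_n$ tangent to $\Sigma_s$. The $s$-intermediate curvature is $$\mathcal C_s(e_1,\dots,e_s)=\sum_{p=1}^{s}\sum_{q=p+1}^{n}\operatorname{Rm}(e_p,e_q,e_p,e_q),$$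 with the sign convention that $\operatorname{Rm}(e_p,e_q,e_p,e_q)$ is the sectional curvature of $(M,g)$ of the plane spanned by $e_p,e_q$. The field $Z_s$ enters only through its length $|Z_s|>0$. *)

(* Defs.v *)
From HB Require Import structures.
From mathcomp Require Export all_boot all_order all_algebra.
From mathcomp Require Export all_classical all_reals all_analysis.
Set Implicit Arguments.
Unset Strict Implicit.
Unset Printing Implicit Defensive.
Import Order.TTheory GRing.Theory Num.Theory.
Export numFieldNormedType.Exports.
Local Open Scope classical_set_scope.
Local Open Scope ring_scope.

(* Tangent vectors are row vectors of components, so a Jacobian has the input
   coordinate as row index and acts by right multiplication. *)

Section EuclideanCalculus.
Variable R : realType.

Definition pd (k : nat) (i : 'I_k) (f : 'rV[R]_k -> R) (x : 'rV[R]_k) : R :=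
  'D_(delta_mx 0 i) f x.

Fixpoint Ck (r k : nat) (O : set 'rV[R]_k) (f : 'rV[R]_k -> R) : Prop :=
  match r with
  | 0 => forall x, O x -> {for x, continuous f}
  | r'.+1 => (forall x, O x -> differentiable f x) /\
             forall i : 'I_k, Ck r' O (pd i f)
  end.

Definition smooth (k : nat) (O : set 'rV[R]_k) (f : 'rV[R]_k -> R) : Prop :=
  forall r, Ck r O f.

Definition jac (k l : nat) (F : 'rV[R]_k -> 'rV[R]_l) (x : 'rV[R]_k) :
  'M[R]_(k, l) := \matrix_(i, j) pd i (fun y => F y 0 j) x.

End EuclideanCalculus.

(* Riemannian calculus in one coordinate system: [h y] is the Gram matrix of
   the coordinate frame at the point with coordinates [y]. *)
Section CoordinateRiemannianCalculus.
Variables (R : realType) (k : nat) (h : 'rV[R]_k -> 'M[R]_k).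
Implicit Types (f : 'rV[R]_k -> R) (Y : 'rV[R]_k -> 'rV[R]_k) (x : 'rV[R]_k).

(* Christoffel symbol Gamma^l_{ij} of the Levi-Civita connection *)
Definition christoffel (l i j : 'I_k) x : R :=
  2^-1 * \sum_b invmx (h x) l b *
    (pd i (fun y => h y j b) x + pd j (fun y => h y i b) x
     - pd b (fun y => h y i j) x).

Definition cgrad f x : 'rV[R]_k :=
  \row_i \sum_j invmx (h x) i j * pd j f x.

Definition ccov (X : 'rV[R]_k) Y x : 'rV[R]_k :=
  \row_l \sum_i X 0 i *
    (pd i (fun y => Y y 0 l) x + \sum_j christoffel l i j x * Y x 0 j).

Definition cdiv Y x : R := \sum_i ccov (delta_mx 0 i) Y x 0 i.

Definition claplacian f x : R := cdiv (cgrad f) x.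

(* component on d_l of R(d_i, d_j) d_q, where
   R(X, Y) W = nabla_X nabla_Y W - nabla_Y nabla_X W - nabla_[X, Y] W *)
Definition ccurv (l i j q : 'I_k) x : R :=
  pd i (christoffel l j q) x - pd j (christoffel l i q) x
  + \sum_b (christoffel l i b x * christoffel b j q x
            - christoffel l j b x * christoffel b i q x).

(* Rm(X, Y, V, W) = <R(X, Y) W, V>, so that Rm(X, Y, X, Y) is the sectional
   curvature of the plane spanned by orthonormal X, Y *)
Definition cRm (X Y V W : 'rV[R]_k) x : R :=
  \sum_i \sum_j \sum_q \sum_l \sum_b
    X 0 i * Y 0 j * W 0 q * ccurv l i j q x * h x l b * V 0 b.

End CoordinateRiemannianCalculus.

(* Smooth manifolds of dimension n without boundary. [cinv a] is the inverse of
   the chart [coord a]; [chart_at] selects a chart around each point. *)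
Record manifold (R : realType) (n : nat) := Manifold {
  point :> topologicalType;
  chart_ix : Type;
  cdom : chart_ix -> set point;
  coord : chart_ix -> point -> 'rV[R]_n;
  cinv : chart_ix -> 'rV[R]_n -> point;
  chart_at : point -> chart_ix;
  cimg := fun a => coord a @` cdom a;
  manifold_hausdorff : hausdorff_space point;
  manifold_second_countable : @second_countable point;
  chart_atP : forall x, cdom (chart_at x) x;
  cdom_open : forall a, open (cdom a);
  cimg_open : forall a, open (cimg a);
  coordK : forall a x, cdom a x -> cinv a (coord a x) = x;
  coord_continuous : forall a x, cdom a x -> {for x, continuous (coord a)};
  cinv_continuous : forall a y, cimg a y -> {for y, continuous (cinv a)};
  transition_smooth : forall a b (j : 'I_n),
    smooth (coord a @` (cdom a `&` cdom b))
           (fun y => coord b (cinv a y) 0 j)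
}.

Section Manifold.
Variables (R : realType) (n : nat) (M : manifold R n).

Definition transition_jac (a b : chart_ix M) (x : M) : 'M[R]_n :=
  jac (fun y => coord b (cinv a y)) (coord a x).

Definition Ck_fun (r : nat) (f : M -> R) : Prop :=
  forall a : chart_ix M, Ck r (cimg a) (fun y => f (cinv a y)).

(* [gram a x] is the Gram matrix at x of the coordinate frame of the chart a. *)
Record riemannian_metric := RiemannianMetric {
  gram : chart_ix M -> M -> 'M[R]_n;
  gram_sym : forall a x, cdom a x -> (gram a x)^T = gram a x;
  gram_posdef : forall a x, cdom a x ->
    forall v : 'rV[R]_n, v != 0 -> 0 < (v *m gram a x *m v^T) 0 0;
  gram_smooth : forall a (i j : 'I_n),
    smooth (cimg a) (fun y => gram a (cinv a y) i j);
  gram_transition : forall a b x, cdom a x -> cdom b x ->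
    gram a x =
      transition_jac a b x *m gram b x *m (transition_jac a b x)^T
}.

(* [X a x] is the row of components of the vector at x in the chart a; only the
   values with [cdom a x] are meaningful. *)
Definition vfield := chart_ix M -> M -> 'rV[R]_n.

Definition smooth_vfield (X : vfield) : Prop :=
  (forall a b x, cdom a x -> cdom b x -> X b x = X a x *m transition_jac a b x)
  /\ (forall a (j : 'I_n), smooth (cimg a) (fun y => X a (cinv a y) 0 j)).

(* (du_0 /\ ... /\ du_{s-1})(v_0, ..., v_{s-1}) at x, the components of the v_j
   being taken in the chart [chart_at x] *)
Definition wedge_du (s : nat) (u : nat -> M -> R) (x : M)
    (v : 'I_s -> 'rV[R]_n) : R :=
  \det (\matrix_(i < s, j < s)
    'D_(v j) (fun y => u i (cinv (chart_at x) y)) (coord (chart_at x) x)).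

(* joint level set of (u_0, ..., u_{m-1}) through x *)
Definition level_set (u : nat -> M -> R) (m : nat) (x : M) : set M :=
  [set y | forall i, (i < m)%N -> u i y = u i x].

(* data of a local parametrization near the point [pmap ppt] *)
Record param (k : nat) := Param {
  pdom : set 'rV[R]_k;
  pmap : 'rV[R]_k -> M;
  ppt : 'rV[R]_k
}.

Definition pjac (k : nat) (P : param k) (a : chart_ix M) (v : 'rV[R]_k) :
  'M[R]_(k, n) := jac (fun w => coord a (pmap P w)) v.

(* P is a C^3 local parametrization around x of the embedded submanifold S: a
   C^3 immersion and a homeomorphism of an open set onto an open part of S. *)
Definition local_param (S : set M) (x : M) (k : nat) (P : param k) : Prop :=
  [/\ open (pdom P) /\ (pdom P (ppt P) /\ pmap P (ppt P) = x),
      forall v w, pdom P v -> pdom P w -> pmap P v = pmap P w -> v = w,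
      (forall v, pdom P v -> {for v, continuous (pmap P)}) /\
      (forall V, open V -> V `<=` pdom P ->
        exists2 W : set M, open W & pmap P @` V = W `&` S),
      forall a (j : 'I_n),
        Ck 3 (pdom P `&` pmap P @^-1` cdom a)
             (fun v => coord a (pmap P v) 0 j)
    & forall a v, pdom P v -> cdom a (pmap P v) -> row_free (pjac P a v)].

(* for each m and x, data of a local parametrization around x of the
   (n - m)-dimensional level set Sigma_m through x *)
Definition level_params := forall m : nat, M -> param (n - m).

Definition level_paramsP (s : nat) (u : nat -> M -> R) (L : level_params) :=
  forall m x, (m <= s)%N -> local_param (level_set u m x) x (L m x).

End Manifold.

Section Geometry.
Variables (R : realType) (n : nat) (M : manifold R n) (g : riemannian_metric M).

Definition inner (a : chart_ix M) (x : M) (v w : 'rV[R]_n) : R :=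
  (v *m gram g a x *m w^T) 0 0.

Definition norm_at (a : chart_ix M) (x : M) (v : 'rV[R]_n) : R :=
  Num.sqrt (inner a x v v).

(* pointwise length of a vector field, as a function on M *)
Definition len (X : vfield M) (x : M) : R :=
  norm_at (chart_at x) x (X (chart_at x) x).

Definition metric_coord (a : chart_ix M) (y : 'rV[R]_n) : 'M[R]_n :=
  gram g a (cinv a y).

Definition laplacian (f : M -> R) (x : M) : R :=
  let a := chart_at x in
  claplacian (metric_coord a) (fun y => f (cinv a y)) (coord a x).

Definition Rm (x : M) (X Y V W : 'rV[R]_n) : R :=
  let a := chart_at x in cRm (metric_coord a) X Y V W (coord a x).

(* The s-intermediate curvature of the frame e_1, ..., e_n at x *)
Definition intermediate_curv (s : nat) (x : M) (e : nat -> 'rV[R]_n) : R :=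
  \sum_(1 <= p < s.+1) \sum_(p.+1 <= q < n.+1) Rm x (e p) (e q) (e p) (e q).

Section Leaf.
Variables (k : nat) (P : param M k) (a : chart_ix M).

(* Gram matrix of the induced metric; where both are defined, it does not
   depend on the chart a used around [pmap P v]. *)
Definition induced (v : 'rV[R]_k) : 'M[R]_k :=
  pjac P a v *m gram g a (pmap P v) *m (pjac P a v)^T.

(* The w with dP_v(w) = X, for X tangent to the image of P at [pmap P v]. *)
Definition pull_vec (v : 'rV[R]_k) (X : 'rV[R]_n) : 'rV[R]_k :=
  X *m pinvmx (pjac P a v).

Definition pull_field (X : vfield M) (v : 'rV[R]_k) : 'rV[R]_k :=
  pull_vec v (X a (pmap P v)).

End Leaf.

Variables (u : nat -> M -> R) (L : level_params M).

(* In the following, vectors at x are given by their components in the chart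
   [chart_at x], or in the chart a when a is an argument. *)

(* nabla_{Sigma_m} f, as a vector field on M *)
Definition grad_leaf (m : nat) (f : M -> R) : vfield M := fun a x =>
  let P := L m x in
  cgrad (induced P a) (fun v => f (pmap P v)) (ppt P) *m pjac P a (ppt P).

Definition laplacian_leaf (m : nat) (f : M -> R) (x : M) : R :=
  let P := L m x in
  claplacian (induced P (chart_at x)) (fun v => f (pmap P v)) (ppt P).

(* div_{Sigma_m} Y, for Y tangent to the level sets Sigma_m *)
Definition div_leaf (m : nat) (Y : vfield M) (x : M) : R :=
  let P := L m x in let a := chart_at x in
  cdiv (induced P a) (pull_field P a Y) (ppt P).

(* nabla^{Sigma_m}_X Y at x, for X and Y tangent to the level sets Sigma_m *)
Definition cov_leaf (m : nat) (X : 'rV[R]_n) (Y : vfield M) (x : M) :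
    'rV[R]_n :=
  let P := L m x in let a := chart_at x in
  ccov (induced P a) (pull_vec P a (ppt P) X) (pull_field P a Y) (ppt P)
    *m pjac P a (ppt P).

(* nabla^{Sigma_m}_X f at x: derivative of f in the direction X *)
Definition deriv_leaf (m : nat) (X : 'rV[R]_n) (f : M -> R) (x : M) : R :=
  let P := L m x in
  'D_(pull_vec P (chart_at x) (ppt P) X) (fun v => f (pmap P v)) (ppt P).

(* nu_j, for j >= 1: the unit normal of Sigma_j in Sigma_{j-1} *)
Definition nu (j : nat) : vfield M := fun a x =>
  let X := grad_leaf j.-1 (u j.-1) in (norm_at a x (X a x))^-1 *: X a x.

(* A_{Sigma_j}(X, Y) at x, for j >= 1 *)
Definition sff (j : nat) (x : M) (X Y : 'rV[R]_n) : R :=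
  inner (chart_at x) x (cov_leaf j.-1 X (nu j) x) Y.

(* Gram matrix of Sigma_j and matrix of A_{Sigma_j} at x, in the coordinate
   frame of the parametrization [L j x] of Sigma_j *)
Definition gram_leaf (j : nat) (x : M) : 'M[R]_(n - j) :=
  induced (L j x) (chart_at x) (ppt (L j x)).

Definition sff_mx (j : nat) (x : M) : 'M[R]_(n - j) :=
  let J := pjac (L j x) (chart_at x) (ppt (L j x)) in
  \matrix_(i, l) sff j x (row i J) (row l J).

(* H_{Sigma_j} = h^{il} A_{il} and |A_{Sigma_j}|^2 = h^{ip} h^{lq} A_{il} A_{pq}
   with h the induced metric of Sigma_j *)
Definition mean_curv (j : nat) (x : M) : R :=
  \tr (invmx (gram_leaf j x) *m sff_mx j x).

Definition sff_norm2 (j : nat) (x : M) : R :=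
  let hi := invmx (gram_leaf j x) in
  \tr (hi *m sff_mx j x *m hi *m (sff_mx j x)^T).

(* e_1, ..., e_n is an orthonormal basis of T_x M with e_j = nu_j for
   1 <= j <= s and e_{s+1}, ..., e_n tangent to Sigma_s. *)
Definition adapted_frame (s : nat) (x : M) (e : nat -> 'rV[R]_n) : Prop :=
  let a := chart_at x in
  [/\ forall p q, (1 <= p <= n)%N -> (1 <= q <= n)%N ->
        inner a x (e p) (e q) = (p == q)%:R,
      forall j, (1 <= j <= s)%N -> e j = nu j a x
    & forall q, (s < q <= n)%N -> (e q <= pjac (L s x) a (ppt (L s x)))%MS].

End Geometry.

(* Main.v *)
Require Import Defs.
From mathcomp Require Import ring lra.
Set Implicit Arguments.
Unset Strict Implicit.
Unset Printing Implicit Defensive.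
Import Order.TTheory GRing.Theory Num.Theory.
Local Open Scope classical_set_scope.
Local Open Scope ring_scope.

(** Put f_m = log |Z_m| and nu_{m+1} = Z_m / |Z_m|. The unit normals nu_j inherit
    the smoothness of the fields Z_m, so around the given point there is a smooth
    orthonormal frame E_1, ..., E_n with E_j = nu_j for j <= s, and with the
    prescribed values at the point ([frame_extend]). All quantities of the
    theorem are then expressed by derivatives of the f_m along the frame and by
    the connection coefficients <nabla_{E_i} E_j, E_k> of the ambient metric.

    For one hypersurface Sigma_{m+1} of Sigma_m, with normal N = nu_{m+1}, second
    fundamental form A, mean curvature H and phi = |nabla_{Sigma_m} u_m|, which
    is |Z_m| / |Z_{m+1}|, the argument is classical:
    - the gradient of f_m is controlled by two facts: N f_m = - H because Z_m is
      divergence free on Sigma_m ([frame_deriv_logZlen]), and the acceleration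
      nabla_N N in Sigma_m is the gradient of log phi = f_m - f_{m+1} on
      Sigma_{m+1} ([lapse]);
    - the Laplacian of f_m on Sigma_m is the one on Sigma_{m+1} plus the second
      derivative along N, which is - N H, up to terms of first order
      ([frame_laplacian_split]);
    - by the Riccati equation - N H is |A|^2 plus the Ricci curvature of Sigma_m
      in the direction N, up to the divergence and the square of nabla_N N, and
      the Gauss equation expresses this Ricci curvature by sectional curvatures
      of M and the second fundamental forms of Sigma_1, ..., Sigma_m
      ([sectional_adapted]).
    Together they give the difference of the Laplacians of f_m on Sigma_m and of
    f_{m+1} on Sigma_{m+1} ([slicing_step]), and the sum over m telescopes
    ([flag_identity]). The term with the derivative of div_{Sigma_m} Z_m is zero.

    It remains to compare the intrinsic calculus of the leaves, given by
    parametrizations, with the ambient frame. The induced Levi-Civita connection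
    is the tangential part of the ambient one ([ccov_pullback]), and divergences
    are traces over orthonormal bases ([cdiv_pullback]). The tangent space of
    Sigma_m is the orthogonal complement of Z_0, ..., Z_{m-1}, at every point of
    a parametrized leaf ([pjac_orthogonal]): the gradient of u_m on Sigma_m is
    proportional to Z_m, and dimensions match. *)

(** * Partial derivatives and the chain rule *)

Section NearDifferentiable.
Variable R : realType.

Lemma near_differentiable (V W : normedModType R) (f g : V -> W) x :
  (\forall y \near x, f y = g y) -> differentiable f x -> differentiable g x.
Proof.
move=> fg df; have fgx : f x = g x by exact: nbhs_singleton fg.
have -> : g = f + (g - f) by rewrite addrC subrK.
apply: differentiableD => //.
have H0 : (g - f) \o shift x = cst ((g - f) x) + \0 +o_ 0 id.
  apply/eqaddoE; rewrite funeqE => y /=; rewrite !fctE fgx subrr addr0 add0r.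
  rewrite littleoE // => _/posnumP[e] /=.
  have : \forall z \near 0, f (z + x) = g (z + x).
    by have := fg; rewrite (near_shift 0 x) /= subr0.
  move=> fg'; near=> z; rewrite /= (near fg' z)//.
  by rewrite subrr normr0 mulr_ge0.
apply/diff_locallyP; rewrite (diff_unique _ H0); last exact: cst_continuous.
by split; [exact: cst_continuous | exact: H0].
Unshelve. all: by end_near. Qed.

End NearDifferentiable.

Section PartialDerivatives.
Variables (R : realType) (k : nat).
Implicit Types (f g : 'rV[R]_k -> R) (x v : 'rV[R]_k) (i j : 'I_k).

Lemma pdE i f x : differentiable f x -> pd i f x = 'd f x (delta_mx 0 i).
Proof. by move=> df; rewrite /pd deriveE. Qed.

Lemma derive_pd f x v : differentiable f x ->
  'D_v f x = \sum_i v 0 i * pd i f x.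
Proof.
move=> df; rewrite deriveE// {1}(row_sum_delta v) linear_sum.
by apply: eq_bigr => i _; rewrite linearZ /= pdE.
Qed.

Lemma pd_near i f g x : (\forall y \near x, f y = g y) -> pd i f x = pd i g x.
Proof. exact: near_eq_derive. Qed.

Lemma pdD i f g x : differentiable f x -> differentiable g x ->
  pd i (fun y => f y + g y) x = pd i f x + pd i g x.
Proof. by move=> df dg; apply: deriveD; exact: diff_derivable. Qed.

Lemma pdN i f x : differentiable f x -> pd i (fun y => - f y) x = - pd i f x.
Proof. by move=> df; apply: deriveN; exact: diff_derivable. Qed.

Lemma pdM i f g x : differentiable f x -> differentiable g x ->
  pd i (fun y => f y * g y) x = pd i f x * g x + f x * pd i g x.
Proof.
move=> df dg; rewrite addrC [_ * g x]mulrC.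
by apply: deriveM; exact: diff_derivable.
Qed.

Lemma pd_cst i (c : R) x : pd i (fun=> c) x = 0.
Proof. exact: derive_cst. Qed.

Lemma pd_sum (I : Type) (r : seq I) (P : pred I) i (F : I -> 'rV[R]_k -> R) x :
  (forall a, differentiable (F a) x) ->
  pd i (fun y => \sum_(a <- r | P a) F a y) x = \sum_(a <- r | P a) pd i (F a) x
  /\ differentiable (fun y => \sum_(a <- r | P a) F a y) x.
Proof.
move=> dF; elim: r => [|a r [IH1 IH2]].
  have -> : (fun y => \sum_(a <- [::] | P a) F a y) = (fun=> 0).
    by apply/funext => y; rewrite big_nil.
  by rewrite big_nil pd_cst.
have -> : (fun y => \sum_(b <- a :: r | P b) F b y) =
    (fun y => (if P a then F a y else 0) + \sum_(b <- r | P b) F b y).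
  by apply/funext => y; rewrite big_cons; case: (P a); rewrite ?add0r.
have da : differentiable (fun y => if P a then F a y else 0) x.
  by case: (P a); [exact: dF | exact: differentiable_cst].
split; last exact: differentiableD.
by rewrite pdD// IH1 big_cons; case: (P a) => //; rewrite pd_cst add0r.
Qed.

Lemma diff_comp1 f x (phi : R -> R) d i :
  differentiable f x -> is_derive (f x) 1 phi d ->
  differentiable (fun y => phi (f y)) x /\
  pd i (fun y => phi (f y)) x = pd i f x * d.
Proof.
move=> df dphi; have dphi' : differentiable phi (f x).
  by apply/derivable1_diffP; exact: ex_derive.
have dc : differentiable (phi \o f) x by exact: differentiable_comp.
split=> //; rewrite !pdE//= -[X in 'd X _]/(phi \o f) diff_comp//=.
by rewrite diff1E// derive1E derive_val.
Qed.

End PartialDerivatives.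

Section ChainRule.
Variables (R : realType) (k n : nat).
Implicit Types (F : 'rV[R]_k -> 'rV[R]_n) (f : 'rV[R]_n -> R) (x : 'rV[R]_k).

Lemma differentiable_row F x :
  (forall j, differentiable (fun y => F y 0 j) x) -> differentiable F x.
Proof.
move=> dF; have -> : F = \sum_(j < n) (fun y => F y 0 j *: (delta_mx 0 j : 'rV[R]_n)).
  by apply/funext => y; rewrite fct_sumE -row_sum_delta.
by apply: differentiable_sum => j; exact: differentiableZl.
Qed.

Lemma chain_rule F f x i :
  (forall j, differentiable (fun y => F y 0 j) x) -> differentiable f (F x) ->
  differentiable (fun y => f (F y)) x /\
  pd i (fun y => f (F y)) x = \sum_j pd i (fun y => F y 0 j) x * pd j f (F x).
Proof.
move=> dF df; have dF' := differentiable_row dF.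
have dc : differentiable (f \o F) x by exact: differentiable_comp.
split=> //; rewrite pdE//= -[X in 'd X _]/(f \o F) diff_comp//= -deriveE//.
rewrite derive_pd//; apply: eq_bigr => j _; congr (_ * _).
by rewrite -deriveE// derive_mx ?mxE//; exact: diff_derivable.
Qed.

End ChainRule.

(** * Functions of class C^k and the symmetry of second derivatives *)

Section ClassCk.
Variables (R : realType) (k : nat) (O : set 'rV[R]_k).
Hypothesis hO : open O.
Implicit Types (f g : 'rV[R]_k -> R) (x : 'rV[R]_k).

Lemma open_near (P : 'rV[R]_k -> Prop) x :
  (forall y, O y -> P y) -> O x -> \forall y \near x, P y.
Proof. by move=> OP Ox; apply: filterS OP _; exact: open_nbhs_nbhs. Qed.

Lemma near_continuous f g x : (\forall y \near x, f y = g y) ->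
  {for x, continuous f} -> {for x, continuous g}.
Proof.
move=> fg cf; have fgx : f x = g x by exact: nbhs_singleton fg.
rewrite /prop_for /continuous_at -fgx; apply: cvg_trans cf.
exact: (@near_eq_cvg _ _ (nbhs x) _ f g fg).
Qed.

Lemma Ck_ext r f g : (forall x, O x -> f x = g x) -> Ck r O f -> Ck r O g.
Proof.
elim: r f g => [|r IH] f g fg.
  by move=> cf x Ox; apply: near_continuous (open_near fg Ox) (cf x Ox).
move=> [df cf]; split=> [x Ox|i].
  by apply: near_differentiable (df x Ox); exact: open_near Ox.
apply: IH (cf i) => x Ox; apply: pd_near; exact: open_near Ox.
Qed.

Lemma CkW r f : Ck r.+1 O f -> Ck r O f.
Proof.
elim: r f => [|r IH] f [df cf]; last by split=> // i; exact: IH.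
by move=> x Ox; exact: differentiable_continuous (df x Ox).
Qed.

Lemma Ck_cst r (c : R) : Ck r O (fun=> c).
Proof.
elim: r c => [|r IH] c; first by move=> x _; exact: cst_continuous.
split=> [x _|i]; first exact: differentiable_cst.
by rewrite (_ : pd i _ = fun=> 0)//; apply/funext => x; exact: pd_cst.
Qed.

Lemma CkD r f g : Ck r O f -> Ck r O g -> Ck r O (fun y => f y + g y).
Proof.
elim: r f g => [|r IH] f g.
  by move=> cf cg x Ox; exact: (continuousD (cf x Ox) (cg x Ox)).
move=> [df cf] [dg cg]; split=> [x Ox|i].
  by apply: differentiableD; [exact: df | exact: dg].
apply: Ck_ext (IH _ _ (cf i) (cg i)) => x Ox.
by rewrite pdD//; [exact: df | exact: dg].
Qed.

Lemma CkM r f g : Ck r O f -> Ck r O g -> Ck r O (fun y => f y * g y).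
Proof.
elim: r f g => [|r IH] f g.
  by move=> cf cg x Ox; exact: (continuousM (cf x Ox) (cg x Ox)).
move=> cf1 cg1; move: (cf1) (cg1) => [df cf] [dg cg]; split=> [x Ox|i].
  by apply: differentiableM; [exact: df | exact: dg].
apply: Ck_ext (CkD (IH _ _ (cf i) (CkW cg1)) (IH _ _ (CkW cf1) (cg i))) => x Ox.
by rewrite pdM//; [exact: df | exact: dg].
Qed.

Lemma CkN r f : Ck r O f -> Ck r O (fun y => - f y).
Proof.
move=> cf; apply: Ck_ext (CkM (Ck_cst r (-1)) cf) => x _.
by rewrite mulN1r.
Qed.

Lemma Ck_sum r (I : Type) (s : seq I) (P : pred I) (F : I -> 'rV[R]_k -> R) :
  (forall a, P a -> Ck r O (F a)) ->
  Ck r O (fun y => \sum_(a <- s | P a) F a y).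
Proof.
move=> cF; elim: s => [|a s IH].
  by apply: Ck_ext (Ck_cst r 0) => x _; rewrite big_nil.
case Pa : (P a); last by apply: Ck_ext IH => x _; rewrite big_cons Pa.
by apply: Ck_ext (CkD (cF a Pa) IH) => x _; rewrite big_cons Pa.
Qed.

Lemma Ck_prod r (I : Type) (s : seq I) (P : pred I) (F : I -> 'rV[R]_k -> R) :
  (forall a, P a -> Ck r O (F a)) ->
  Ck r O (fun y => \prod_(a <- s | P a) F a y).
Proof.
move=> cF; elim: s => [|a s IH].
  by apply: Ck_ext (Ck_cst r 1) => x _; rewrite big_nil.
case Pa : (P a); last by apply: Ck_ext IH => x _; rewrite big_cons Pa.
by apply: Ck_ext (CkM (cF a Pa) IH) => x _; rewrite big_cons Pa.
Qed.

(** By the chain rule the partial derivatives of the composition are those of f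
    times dphi (f y): one order of regularity of phi (f y) costs one order less
    of dphi (f y). For inverses, roots and logarithms dphi is expressed by
    functions already known to be regular, so this bootstraps. *)
Lemma Ck_comp1 r (phi dphi : R -> R) f :
  (forall x, O x -> is_derive (f x) 1 phi (dphi (f x))) ->
  Ck r.+1 O f -> Ck r O (fun y => dphi (f y)) -> Ck r.+1 O (fun y => phi (f y)).
Proof.
move=> dp [df cf] cd; split=> [x Ox|i].
  have [j|k0] := pselect (exists i : 'I_k, True).
    by have [i _] := j; case: (diff_comp1 i (df x Ox) (dp x Ox)).
  have -> : (fun y => phi (f y)) = fun=> phi (f x).
    apply/funext => y; congr (phi (f _)); apply/rowP => i.
    by exfalso; apply: k0; exists i.
  exact: differentiable_cst.
apply: Ck_ext (CkM (cf i) cd) => x Ox.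
by have [_ ->] := diff_comp1 i (df x Ox) (dp x Ox).
Qed.

Lemma C0_comp1 (phi dphi : R -> R) f :
  (forall x, O x -> is_derive (f x) 1 phi (dphi (f x))) ->
  Ck 0 O f -> Ck 0 O (fun y => phi (f y)).
Proof.
move=> dp cf x Ox; apply: continuous_comp; first exact: cf.
apply: differentiable_continuous; apply/derivable1_diffP.
by have [] := dp x Ox.
Qed.

Lemma CkV r f : (forall x, O x -> f x != 0) -> Ck r O f ->
  Ck r O (fun y => (f y)^-1).
Proof.
move=> f0.
have dp x : O x -> is_derive (f x) 1 (@GRing.inv R) (- (f x)^-1 ^+ 2).
  move=> Ox; have ? := f0 x Ox.
  apply: DeriveDef; first exact: derivableV.
  rewrite (@deriveV _ _ id (f x) 1)//.
  by rewrite derive_id -exprVn /GRing.scale /= mulr1.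
elim: r f f0 dp => [|r IH] f f0 dp; first exact: (@C0_comp1 _ (fun t => - t^-1 ^+ 2)).
move=> cf; apply: (@Ck_comp1 _ _ (fun t => - t^-1 ^+ 2)) => //; apply: CkN.
by apply: CkM; apply: IH => //; exact: CkW.
Qed.

Lemma Ck_sqrt r f : (forall x, O x -> 0 < f x) -> Ck r O f ->
  Ck r O (fun y => Num.sqrt (f y)).
Proof.
move=> f0; have dp x : O x -> is_derive (f x) 1 Num.sqrt (2 * Num.sqrt (f x))^-1.
  by move=> Ox; apply: is_derive1_sqrt; exact: f0.
elim: r => [|r IH] cf; first exact: (@C0_comp1 _ (fun t => (2 * Num.sqrt t)^-1)).
apply: (@Ck_comp1 _ _ (fun t => (2 * Num.sqrt t)^-1)) => //; apply: CkV.
  by move=> x Ox; rewrite mulf_neq0// gt_eqF// sqrtr_gt0 f0.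
by apply: CkM; [exact: Ck_cst | apply: IH; exact: CkW].
Qed.

Lemma Ck_ln r f : (forall x, O x -> 0 < f x) -> Ck r O f ->
  Ck r O (fun y => ln (f y)).
Proof.
move=> f0; have dp x : O x -> is_derive (f x) 1 (@ln R) (f x)^-1.
  by move=> Ox; apply: is_derive1_ln; exact: f0.
case: r => [|r] cf; first exact: (@C0_comp1 _ (fun t => t^-1)).
apply: (@Ck_comp1 _ _ (fun t => t^-1)) => //; apply: CkV; last exact: CkW.
by move=> x Ox; rewrite gt_eqF// f0.
Qed.

Lemma Ck_det r n (A : 'rV[R]_k -> 'M[R]_n) :
  (forall i j, Ck r O (fun y => A y i j)) -> Ck r O (fun y => \det (A y)).
Proof.
move=> cA; apply: Ck_sum => s _; apply: CkM; first exact: Ck_cst.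
exact: Ck_prod.
Qed.

Lemma Ck_invmx r n (A : 'rV[R]_k -> 'M[R]_n) i j :
  (forall x, O x -> A x \in unitmx) ->
  (forall i j, Ck r O (fun y => A y i j)) -> Ck r O (fun y => invmx (A y) i j).
Proof.
move=> uA cA.
apply: (@Ck_ext _ (fun y => (\det (A y))^-1 * ((-1) ^+ (j + i) *
    \det (row' j (col' i (A y)))))) => [x Ox|].
  by rewrite /invmx uA// mxE mxE.
apply: CkM.
  by apply: CkV => [x Ox|]; [rewrite -unitfE -unitmxE uA | exact: Ck_det].
apply: CkM; first exact: Ck_cst.
by apply: Ck_det => a b; apply: Ck_ext (cA (lift j a) (lift i b)) => x _; rewrite !mxE.
Qed.

End ClassCk.

Section Schwarz.
Variables (R : realType) (k : nat).
Implicit Types (f : 'rV[R]_k -> R) (x v : 'rV[R]_k).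

Lemma line_derive f x v (t : R) : differentiable f (t *: v + x) ->
  is_derive t 1 (fun s => f (s *: v + x)) ('D_v f (t *: v + x)).
Proof.
move=> df.
have dl : is_diff t (fun s : R => s *: v + x) ( *:%R ^~ v).
  by apply: (is_diff_eq (is_diffD _ _)); rewrite addr0.
have dc : differentiable (f \o (fun s : R => s *: v + x)) t.
  by apply: differentiable_comp => //; exact: ex_diff.
apply: DeriveDef; first exact/derivable1_diffP.
rewrite deriveE// deriveE// -[X in 'd X _]/(f \o (fun s : R => s *: v + x)).
by rewrite diff_comp//= diff_val scale1r.
Qed.

Lemma dist_lt_half (a b c : R) :
  `|a - c| < `|a - b| / 2 -> `|b - c| < `|a - b| / 2 -> false.
Proof.
by move=> h1 h2; have := ler_distD c a b; rewrite (distrC c b); lra.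
Qed.

Let Q f x v w (t : R) :=
  f (t *: v + (t *: w + x)) - f (t *: v + x) - f (t *: w + x) + f x.

(** The mean value theorem, along v for the increment of f in the direction w,
    then along w for the derivative of f in the direction v. *)
Lemma second_difference f x v w (t : R) : 0 < t ->
  (forall s r, 0 <= s <= t -> 0 <= r <= t ->
     differentiable f (s *: v + (r *: w + x)) /\
     differentiable ('D_v f) (s *: v + (r *: w + x))) ->
  exists s r, [/\ 0 <= s <= t, 0 <= r <= t &
    Q f x v w t = t * t * 'D_w ('D_v f) (s *: v + (r *: w + x))].
Proof.
move=> t0 H.
have tt : 0 <= t <= t by rewrite lexx ltW.
have t00 : 0 <= (0 : R) <= t by rewrite lexx ltW.
have H0 s : 0 <= s <= t -> differentiable f (s *: v + x).
  by move=> ht; have [] := H s 0 ht t00; rewrite scale0r add0r.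
pose psi (s : R) := f (s *: v + (t *: w + x)) - f (s *: v + x).
pose dpsi (s : R) := 'D_v f (s *: v + (t *: w + x)) - 'D_v f (s *: v + x).
have dpsiP s : 0 <= s <= t -> is_derive s 1 psi (dpsi s).
  move=> hs; have [d1 _] := H s t hs tt.
  by apply: is_deriveB; apply: line_derive => //; exact: H0.
have [||s hs E1] := @MVT R psi dpsi 0 t t0.
- by move=> s /itvP hs; apply: dpsiP; rewrite !hs.
- apply: derivable_within_continuous => s /itvP hs.
  by apply: ex_derive; apply: dpsiP; rewrite !hs.
have hs' : 0 <= s <= t by rewrite !(itvP hs).
have comm (r : R) : s *: v + (r *: w + x) = r *: w + (s *: v + x).
  by rewrite addrCA.
pose dchi (r : R) := 'D_w ('D_v f) (r *: w + (s *: v + x)).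
have dchiP r : 0 <= r <= t ->
    is_derive r 1 (fun r : R => 'D_v f (r *: w + (s *: v + x))) (dchi r).
  by move=> hr; apply: line_derive; rewrite -comm; have [] := H s r hs' hr.
have [||r hr E2] := @MVT R (fun r : R => 'D_v f (r *: w + (s *: v + x))) dchi 0 t t0.
- by move=> r /itvP hr; apply: dchiP; rewrite !hr.
- apply: derivable_within_continuous => r /itvP hr.
  by apply: ex_derive; apply: dchiP; rewrite !hr.
exists s, r; split=> //; first by rewrite !(itvP hr).
rewrite comm -/(dchi r); have -> : Q f x v w t = psi t - psi 0.
  by rewrite /Q /psi scale0r !add0r; ring.
rewrite E1 subr0 /dpsi comm; move: E2; rewrite subr0 scale0r add0r => ->.
by ring.
Qed.

(** The second difference is symmetric in the two directions, so by
    [second_difference] the two mixed derivatives share values at points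
    arbitrarily close to x; by continuity they agree at x. *)
Lemma schwarz (O : set 'rV[R]_k) f i j x : open O -> Ck 2 O f -> O x ->
  pd i (pd j f) x = pd j (pd i f) x.
Proof.
move=> hO [df cf] Ox; apply/eqP; apply: contraT => ne.
set a := pd i (pd j f) x in ne *; set b := pd j (pd i f) x in ne *.
pose e := `|a - b| / 2; have e0 : 0 < e.
  by rewrite divr_gt0// normr_gt0 subr_eq0.
have ca : {for x, continuous (pd i (pd j f))} by have [_ /(_ i)] := cf j; apply.
have cb : {for x, continuous (pd j (pd i f))} by have [_ /(_ j)] := cf i; apply.
have na : \forall y \near x, `|a - pd i (pd j f) y| < e.
  by move/cvgrPdist_lt : ca => /(_ e e0).
have nb : \forall y \near x, `|b - pd j (pd i f) y| < e.
  by move/cvgrPdist_lt : cb => /(_ e e0).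
have nO := @open_near R k O hO O x (fun y Oy => Oy) Ox.
have H : nbhs x [set y | O y /\ (`|a - pd i (pd j f) y| < e /\
    `|b - pd j (pd i f) y| < e)] by exact: filterI nO (filterI na nb).
have [d /= d0 dP] := (nbhs_ballP x _).1 H.
pose vi : 'rV[R]_k := delta_mx 0 i; pose vj : 'rV[R]_k := delta_mx 0 j.
(* this t keeps the parallelogram on t vi and t vj inside the ball of radius d *)
pose t := d / (`|vi| + `|vj| + 1).
have N0 : 0 < `|vi| + `|vj| + 1 by rewrite ltr_wpDl// addr_ge0.
have t0 : 0 < t by rewrite divr_gt0.
have box s r (v w : 'rV[R]_k) : (`|v| + `|w| = `|vi| + `|vj|) ->
    0 <= s <= t -> 0 <= r <= t -> ball x d (s *: v + (r *: w + x)).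
  move=> vw /andP[s0 st] /andP[r0 rt]; rewrite -ball_normE /=.
  have -> : x - (s *: v + (r *: w + x)) = - (s *: v + r *: w).
    by rewrite addrA (opprD (_ + _)) addrCA subrr addr0.
  rewrite normrN (le_lt_trans (ler_normD _ _))// !normrZ !ger0_norm//.
  apply: (@le_lt_trans _ _ (t * (`|vi| + `|vj|))).
    by rewrite -vw mulrDr lerD// ler_wpM2r.
  by rewrite /t mulrAC ltr_pdivrMr// ltr_pM2l// ltrDl.
have ho s r (v w : 'rV[R]_k) : (`|v| + `|w| = `|vi| + `|vj|) ->
    0 <= s <= t -> 0 <= r <= t -> O (s *: v + (r *: w + x)).
  move=> vw hs hr.
  by have [] := dP _ (box s r v w vw hs hr).
have [|s [r [hs hr E1]]] := @second_difference f x vj vi t t0.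
  by move=> s r hs hr; split; [apply: df | apply: (cf j).1];
    apply: ho => //; rewrite addrC.
have [|s' [r' [hs' hr' E2]]] := @second_difference f x vi vj t t0.
  by move=> s' r' hs' hr'; split; [apply: df | apply: (cf i).1]; exact: ho.
have E : pd i (pd j f) (s *: vj + (r *: vi + x)) =
    pd j (pd i f) (s' *: vi + (r' *: vj + x)).
  have QC : Q f x vj vi t = Q f x vi vj t.
    by rewrite /Q (addrCA (t *: vj)) -!addrA (addrCA (- f (t *: vj + x))).
  have tt0 : t * t != 0 by rewrite mulf_neq0 ?gt_eqF.
  exact: (mulfI tt0 (etrans (esym E1) (etrans QC E2))).
have [_ [h1 _]] := dP _ (box s r vj vi (addrC _ _) hs hr).
have [_ [_ h2]] := dP _ (box s' r' vi vj erefl hs' hr').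
rewrite E in h1; move: (pd j (pd i f) _) h1 h2 => A h1 h2.
exact: dist_lt_half h1 h2.
Qed.

End Schwarz.

Section Smooth.
Variables (R : realType) (k : nat) (O : set 'rV[R]_k).
Hypothesis hO : open O.
Implicit Types (f g : 'rV[R]_k -> R) (x : 'rV[R]_k).

Lemma smooth_ext f g : (forall x, O x -> f x = g x) -> smooth O f -> smooth O g.
Proof. by move=> fg sf r; exact: Ck_ext (sf r). Qed.

Lemma smooth_cst (c : R) : smooth O (fun=> c).
Proof. by move=> r; exact: Ck_cst. Qed.

Lemma smoothD f g : smooth O f -> smooth O g -> smooth O (fun y => f y + g y).
Proof. by move=> sf sg r; exact: CkD. Qed.

Lemma smoothN f : smooth O f -> smooth O (fun y => - f y).
Proof. by move=> sf r; exact: CkN. Qed.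

Lemma smoothM f g : smooth O f -> smooth O g -> smooth O (fun y => f y * g y).
Proof. by move=> sf sg r; exact: CkM. Qed.

Lemma smooth_sum (I : Type) (s : seq I) (P : pred I) (F : I -> 'rV[R]_k -> R) :
  (forall a, P a -> smooth O (F a)) ->
  smooth O (fun y => \sum_(a <- s | P a) F a y).
Proof. by move=> sF r; apply: Ck_sum => // a Pa; exact: sF. Qed.

Lemma smoothV f : (forall x, O x -> f x != 0) -> smooth O f ->
  smooth O (fun y => (f y)^-1).
Proof. by move=> f0 sf r; exact: CkV. Qed.

Lemma smooth_sqrt f : (forall x, O x -> 0 < f x) -> smooth O f ->
  smooth O (fun y => Num.sqrt (f y)).
Proof. by move=> f0 sf r; exact: Ck_sqrt. Qed.

Lemma smooth_ln f : (forall x, O x -> 0 < f x) -> smooth O f ->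
  smooth O (fun y => ln (f y)).
Proof. by move=> f0 sf r; exact: Ck_ln. Qed.

Lemma smooth_invmx n (A : 'rV[R]_k -> 'M[R]_n) i j :
  (forall x, O x -> A x \in unitmx) ->
  (forall i j, smooth O (fun y => A y i j)) ->
  smooth O (fun y => invmx (A y) i j).
Proof. by move=> uA sA r; apply: Ck_invmx => // a b; exact: sA. Qed.

Lemma smooth_pd f i : smooth O f -> smooth O (pd i f).
Proof. by move=> sf r; have [_] := sf r.+1; apply. Qed.

Lemma smooth_differentiable f x : smooth O f -> O x -> differentiable f x.
Proof. by move=> sf; have [+ _] := sf 1%N; apply. Qed.

End Smooth.

Lemma smoothS (R : realType) (k : nat) (O O' : set 'rV[R]_k) f :
  O' `<=` O -> smooth O f -> smooth O' f.
Proof.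
move=> OO sf r; elim: r f sf => [|r IH] f sf.
  by move=> x /OO Ox; exact: (sf 0%N).
split=> [x /OO Ox|i]; first exact: smooth_differentiable Ox.
by apply: IH; exact: smooth_pd.
Qed.

(** * Covariant differentiation in coordinates *)

Section CovariantDerivative.
Variables (R : realType) (n : nat) (h : 'rV[R]_n -> 'M[R]_n).
Implicit Types (f : 'rV[R]_n -> R) (X Y W : 'rV[R]_n -> 'rV[R]_n).
Implicit Types (x v w : 'rV[R]_n) (i j : 'I_n).

Definition field_diff (k m : nat) (Y : 'rV[R]_k -> 'rV[R]_m) (x : 'rV[R]_k) :=
  forall l, differentiable (fun y => Y y 0 l) x.

Definition pdv (k m : nat) (i : 'I_k) (Y : 'rV[R]_k -> 'rV[R]_m)
  (x : 'rV[R]_k) : 'rV[R]_m :=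
  \row_l pd i (fun y => Y y 0 l) x.

Definition pdm (k m p : nat) (i : 'I_k) (A : 'rV[R]_k -> 'M[R]_(m, p))
  (x : 'rV[R]_k) :  'M[R]_(m, p) := \matrix_(a, b) pd i (fun y => A y a b) x.

Definition dird (v : 'rV[R]_n) f x : R := \sum_i v 0 i * pd i f x.

Definition conn i x : 'M[R]_n := \matrix_(j, l) christoffel h l i j x.

Definition ip x v w : R := (v *m h x *m w^T) 0 0.

Definition cov_basis j Y x : 'rV[R]_n := pdv j Y x + Y x *m conn j x.

Lemma ccovE v Y x : ccov h v Y x = \sum_i v 0 i *: cov_basis i Y x.
Proof.
apply/rowP => l; rewrite summxE mxE; apply: eq_bigr => i _.
rewrite !mxE; congr (_ * (_ + _)).
by apply: eq_bigr => j _; rewrite mxE mulrC.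
Qed.

Lemma dird_near v f g x : (\forall y \near x, f y = g y) ->
  dird v f x = dird v g x.
Proof. by move=> fg; apply: eq_bigr => i _; rewrite (pd_near _ fg). Qed.

Lemma dirdD (v v' : 'rV[R]_n) f x : dird (v + v') f x = dird v f x + dird v' f x.
Proof. by rewrite -big_split; apply: eq_bigr => i _; rewrite mxE mulrDl. Qed.

Lemma dirdZ (c : R) (v : 'rV[R]_n) f x : dird (c *: v) f x = c * dird v f x.
Proof. by rewrite mulr_sumr; apply: eq_bigr => i _; rewrite mxE mulrA. Qed.

Lemma dird_sumv (I : Type) (s : seq I) (P : pred I) (v : I -> 'rV[R]_n) f x :
  dird (\sum_(a <- s | P a) v a) f x = \sum_(a <- s | P a) dird (v a) f x.
Proof.
elim/big_rec2 : _ => [|a y1 y2 _ <-]; last by rewrite dirdD.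
by apply: big1 => i _; rewrite mxE mul0r.
Qed.

Lemma dirdM v f g x : differentiable f x -> differentiable g x ->
  dird v (fun y => f y * g y) x = dird v f x * g x + f x * dird v g x.
Proof.
move=> df dg; rewrite mulr_suml mulr_sumr -big_split; apply: eq_bigr => i _.
by rewrite pdM//= mulrDr mulrA mulrCA.
Qed.

Lemma dirdDf v f g x : differentiable f x -> differentiable g x ->
  dird v (fun y => f y + g y) x = dird v f x + dird v g x.
Proof.
move=> df dg; rewrite -big_split; apply: eq_bigr => i _.
by rewrite pdD//= mulrDr.
Qed.

Lemma dirdN v f x : differentiable f x ->
  dird v (fun y => - f y) x = - dird v f x.
Proof.
move=> df; rewrite -sumrN; apply: eq_bigr => i _.
by rewrite pdN// mulrN.
Qed.

Lemma dird_cst v (c : R) x : dird v (fun=> c) x = 0.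
Proof. by apply: big1 => i _; rewrite pd_cst mulr0. Qed.

Lemma dird_sum (I : Type) (s : seq I) (P : pred I) v (F : I -> 'rV[R]_n -> R) x :
  (forall a, differentiable (F a) x) ->
  dird v (fun y => \sum_(a <- s | P a) F a y) x = \sum_(a <- s | P a) dird v (F a) x.
Proof.
move=> dF; rewrite exchange_big; apply: eq_bigr => i _.
by rewrite (pd_sum _ _ _ dF).1 mulr_sumr.
Qed.

Lemma ipDl x u v w : ip x (u + v) w = ip x u w + ip x v w.
Proof. by rewrite /ip !mulmxDl mxE. Qed.

Lemma ipZl x c v w : ip x (c *: v) w = c * ip x v w.
Proof. by rewrite /ip -!scalemxAl mxE. Qed.

Lemma ip_suml x (I : Type) (s : seq I) (P : pred I) (v : I -> 'rV[R]_n) w :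
  ip x (\sum_(a <- s | P a) v a) w = \sum_(a <- s | P a) ip x (v a) w.
Proof. by rewrite /ip !mulmx_suml summxE. Qed.

Lemma ipBl x u v w : ip x (u - v) w = ip x u w - ip x v w.
Proof. by rewrite ipDl -scaleN1r ipZl mulN1r. Qed.

Lemma pd_mulmx (k m p r : nat) (A : 'rV[R]_k -> 'M[R]_(m, p))
  (B : 'rV[R]_k -> 'M[R]_(p, r)) (i : 'I_k) (a : 'I_m) (c : 'I_r) y :
  (forall a b, differentiable (fun z => A z a b) y) ->
  (forall a b, differentiable (fun z => B z a b) y) ->
  differentiable (fun z => (A z *m B z) a c) y /\
  pd i (fun z => (A z *m B z) a c) y = (pdm i A y *m B y + A y *m pdm i B y) a c.
Proof.
move=> dA dB.
have -> : (fun z => (A z *m B z) a c) = (fun z => \sum_q A z a q * B z q c).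
  by apply/funext => z; rewrite mxE.
have [|E d] := @pd_sum R k 'I_p (index_enum _) xpredT i
    (fun q z => A z a q * B z q c) y.
  by move=> q; apply: differentiableM; [exact: dA | exact: dB].
split=> //; rewrite E !mxE -big_split; apply: eq_bigr => q _.
by rewrite pdM// !mxE.
Qed.

Lemma pdm_mulmx (k m p r : nat) (A : 'rV[R]_k -> 'M[R]_(m, p))
  (B : 'rV[R]_k -> 'M[R]_(p, r)) (i : 'I_k) y :
  (forall a b, differentiable (fun z => A z a b) y) ->
  (forall a b, differentiable (fun z => B z a b) y) ->
  pdm i (fun z => A z *m B z) y = pdm i A y *m B y + A y *m pdm i B y.
Proof.
by move=> dA dB; apply/matrixP => a c; rewrite [LHS]mxE (pd_mulmx i a c dA dB).2.
Qed.

Lemma cov_basisZ i f Y x : differentiable f x -> field_diff Y x ->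
  cov_basis i (fun y => f y *: Y y) x =
  pd i f x *: Y x + f x *: cov_basis i Y x.
Proof.
move=> df dY; rewrite /cov_basis scalerDr addrA -scalemxAl; congr (_ + _).
apply/rowP => l; rewrite !mxE -(pdM i df (dY l)).
by congr (pd i _ x); apply/funext => y; rewrite mxE.
Qed.

Lemma ccovZ v f Y x : differentiable f x -> field_diff Y x ->
  ccov h v (fun y => f y *: Y y) x = dird v f x *: Y x + f x *: ccov h v Y x.
Proof.
move=> df dY; rewrite !ccovE scaler_suml scaler_sumr -big_split.
by apply: eq_bigr => i _; rewrite cov_basisZ// scalerDr !scalerA (mulrC (f x)).
Qed.

Lemma cov_basis_sum (I : Type) (s : seq I) (P : pred I) i
    (Y : I -> 'rV[R]_n -> 'rV[R]_n) x : (forall a, field_diff (Y a) x) ->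
  cov_basis i (fun y => \sum_(a <- s | P a) Y a y) x =
  \sum_(a <- s | P a) cov_basis i (Y a) x.
Proof.
move=> dY; rewrite /cov_basis big_split /= mulmx_suml; congr (_ + _).
apply/rowP => l; rewrite mxE summxE.
transitivity (pd i (fun y => \sum_(a <- s | P a) Y a y 0 l) x).
  by congr (pd i _ x); apply/funext => y; rewrite summxE.
by rewrite (pd_sum s P i (fun a => dY a l)).1; apply: eq_bigr => a _; rewrite mxE.
Qed.

Lemma ccov_sum (I : Type) (s : seq I) (P : pred I) v
    (Y : I -> 'rV[R]_n -> 'rV[R]_n) x : (forall a, field_diff (Y a) x) ->
  ccov h v (fun y => \sum_(a <- s | P a) Y a y) x =
  \sum_(a <- s | P a) ccov h v (Y a) x.
Proof.
move=> dY; rewrite ccovE; under eq_bigr do rewrite cov_basis_sum// scaler_sumr.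
by rewrite exchange_big; apply: eq_bigr => a _; rewrite ccovE.
Qed.

Lemma ccovDv (v w : 'rV[R]_n) Y x : ccov h (v + w) Y x = ccov h v Y x + ccov h w Y x.
Proof. by rewrite !ccovE -big_split; apply: eq_bigr => i _; rewrite mxE scalerDl. Qed.

Lemma ccovZv c (v : 'rV[R]_n) Y x : ccov h (c *: v) Y x = c *: ccov h v Y x.
Proof. by rewrite !ccovE scaler_sumr; apply: eq_bigr => i _; rewrite mxE scalerA. Qed.

Lemma ccov_sumv (I : Type) (s : seq I) (P : pred I) (v : I -> 'rV[R]_n) Y x :
  ccov h (\sum_(a <- s | P a) v a) Y x = \sum_(a <- s | P a) ccov h (v a) Y x.
Proof.
elim/big_rec2 : _ => [|a y1 y2 _ <-]; last by rewrite ccovDv.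
by rewrite ccovE; apply: big1 => i _; rewrite mxE scale0r.
Qed.

Lemma pdv_near (k m : nat) (i : 'I_k) (Y Y' : 'rV[R]_k -> 'rV[R]_m)
  (x : 'rV[R]_k) :
  (\forall y \near x, Y y = Y' y) -> pdv i Y x = pdv i Y' x.
Proof.
by move=> YY; apply/rowP => l; rewrite !mxE; apply: pd_near;
  apply: filterS YY => y ->.
Qed.

Lemma ccov_near v Y Y' x : (\forall y \near x, Y y = Y' y) ->
  ccov h v Y x = ccov h v Y' x.
Proof.
move=> YY; rewrite !ccovE; apply: eq_bigr => i _; congr (_ *: _).
by rewrite /cov_basis (pdv_near _ YY) (nbhs_singleton YY).
Qed.

(** Multiplying by the Gram matrix lowers the upper index of the Christoffel
    symbols, leaving only first derivatives of the metric. *)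
Lemma conn_lowered i x : (h x)^T = h x -> h x \in unitmx ->
  conn i x *m h x = \matrix_(j, b) (2^-1 * (pd i (fun y => h y j b) x +
    pd j (fun y => h y i b) x - pd b (fun y => h y i j) x)).
Proof.
move=> hs uh; pose L : 'M[R]_n := \matrix_(j, b) (2^-1 * (pd i (fun y => h y j b) x +
    pd j (fun y => h y i b) x - pd b (fun y => h y i j) x)).
have -> : conn i x = L *m invmx (h x).
  apply/matrixP => j l; rewrite mxE [RHS]mxE /christoffel mulr_sumr.
  apply: eq_bigr => b _.
  have E : invmx (h x) l b = invmx (h x) b l by rewrite -{1}hs -trmx_inv mxE.
  by rewrite mxE E; ring.
by rewrite -mulmxA mulVmx// mulmx1.
Qed.

End CovariantDerivative.

(** * The Levi-Civita connection and its curvature *)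

Section LeviCivita.
Variables (R : realType) (n : nat) (h : 'rV[R]_n -> 'M[R]_n).
Variable O : set 'rV[R]_n.
Hypotheses (hO : open O) (hsm : forall i j, smooth O (fun y => h y i j)).
Hypothesis hsym : forall x, O x -> (h x)^T = h x.
Hypothesis hunit : forall x, O x -> h x \in unitmx.
Implicit Types (f : 'rV[R]_n -> R) (X Y Z W : 'rV[R]_n -> 'rV[R]_n).
Implicit Types (x v w : 'rV[R]_n) (i j : 'I_n).

Definition sfield X := forall l, smooth O (fun y => X y 0 l).

Lemma sfield_diff X x : sfield X -> O x -> field_diff X x.
Proof. by move=> sX Ox l; exact: smooth_differentiable (sX l) Ox. Qed.

Lemma pdm_row (k m : nat) (i : 'I_k) (Y : 'rV[R]_k -> 'rV[R]_m) y :
  pdm i Y y = pdv i Y y.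
Proof. by apply/matrixP => a b; rewrite !mxE ord1. Qed.

Lemma pdm_tr (k m p : nat) (i : 'I_k) (A : 'rV[R]_k -> 'M[R]_(m, p)) y :
  pdm i (fun z => (A z)^T) y = (pdm i A y)^T.
Proof.
by apply/matrixP => a b; rewrite !mxE; congr (pd i _ y); apply/funext => z; rewrite mxE.
Qed.

Lemma pd_gram_sym i a b x : O x ->
  pd i (fun y => h y a b) x = pd i (fun y => h y b a) x.
Proof.
move=> Ox; apply: pd_near; apply: (open_near hO) Ox => y Oy.
by rewrite -{1}(hsym Oy) mxE.
Qed.

Lemma pdm_gram i x : O x -> pdm i h x = conn h i x *m h x + (conn h i x *m h x)^T.
Proof.
move=> Ox; rewrite (conn_lowered i (hsym Ox) (hunit Ox)).
apply/matrixP => a b; rewrite !mxE (pd_gram_sym i b a Ox) (pd_gram_sym a i b Ox).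
by rewrite (pd_gram_sym b i a Ox); field.
Qed.

Lemma gram_diff x a b : O x -> differentiable (fun y => h y a b) x.
Proof. exact: smooth_differentiable. Qed.

Lemma ipC x v w : O x -> ip h x v w = ip h x w v.
Proof.
move=> Ox; rewrite /ip.
have -> : w *m h x *m v^T = (v *m h x *m w^T)^T.
  by rewrite !trmx_mul trmxK hsym// mulmxA.
by rewrite [RHS]mxE.
Qed.

Lemma ipZr x c v w : ip h x v (c *: w) = c * ip h x v w.
Proof. by rewrite /ip linearZ /= -scalemxAr mxE. Qed.

Lemma ip_sumr x (I : Type) (s : seq I) (P : pred I) v (w : I -> 'rV[R]_n) :
  ip h x v (\sum_(a <- s | P a) w a) = \sum_(a <- s | P a) ip h x v (w a).
Proof. by rewrite /ip linear_sum mulmx_sumr summxE. Qed.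

(** Metric compatibility: by [pdm_gram] the derivative of the Gram matrix is the
    lowered connection matrix plus its transpose, so in the product rule for
    Y h Z^T each of the two completes a derivative of components to a covariant
    derivative. *)
Lemma ccov_metric v Y Z x : O x -> field_diff Y x -> field_diff Z x ->
  dird v (fun y => ip h y (Y y) (Z y)) x =
  ip h x (ccov h v Y x) (Z x) + ip h x (Y x) (ccov h v Z x).
Proof.
move=> Ox dY dZ; rewrite !ccovE ip_suml ip_sumr -big_split.
apply: eq_bigr => i _ /=; rewrite ipZl ipZr -mulrDr; congr (_ * _).
have mxD (A B : 'M[R]_1) : A 0 0 + B 0 0 = (A + B) 0 0 by rewrite mxE.
have dh a b : differentiable (fun y => h y a b) x by exact: gram_diff.
have dY' (a : 'I_1) b : differentiable (fun y => Y y a b) x by rewrite ord1.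
have dYh (a : 'I_1) b : differentiable (fun y => (Y y *m h y) a b) x.
  by have [] := pd_mulmx i a b dY' dh.
have dZt a (b : 'I_1) : differentiable (fun y => (Z y)^T a b) x.
  by rewrite (_ : (fun y => _) = (fun y => Z y b a)) ?ord1//; apply/funext => y; rewrite mxE.
rewrite (pd_mulmx i 0 0 dYh dZt).2 pdm_mulmx// pdm_tr !pdm_row pdm_gram//.
rewrite /ip /cov_basis [(pdv i Z x + _)^T]linearD /= !trmx_mul (hsym Ox).
rewrite !(mulmxDl, mulmxDr) !mulmxA; rewrite mxD; congr (fun_of_matrix _ 0 0).
by rewrite -!addrA; congr (_ + (_ + _)); rewrite addrC.
Qed.

Lemma christoffel_sym l i j x : O x -> christoffel h l i j x = christoffel h l j i x.
Proof.
move=> Ox; rewrite /christoffel; congr (_ * _); apply: eq_bigr => b _.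
by rewrite (pd_gram_sym b i j Ox) (addrC (pd i _ x)).
Qed.

Definition bracket X Y x : 'rV[R]_n :=
  \sum_i (X x 0 i *: pdv i Y x - Y x 0 i *: pdv i X x).

(** Torsion-freeness: the Christoffel symbols are symmetric in their two lower
    indices, so only derivatives of components survive. *)
Lemma ccov_torsion X Y x : O x ->
  ccov h (X x) Y x - ccov h (Y x) X x = bracket X Y x.
Proof.
move=> Ox; rewrite !ccovE -sumrB /bracket /cov_basis.
under eq_bigr do rewrite !scalerDr opprD addrACA.
rewrite big_split /= -[RHS]addr0; congr (_ + _); rewrite sumrB.
apply/eqP; rewrite subr_eq0; apply/eqP/rowP => l; rewrite !summxE.
transitivity (\sum_i \sum_j X x 0 i * Y x 0 j * christoffel h l i j x).
  apply: eq_bigr => i _; rewrite !mxE mulr_sumr; apply: eq_bigr => j _.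
  by rewrite mxE mulrA.
rewrite exchange_big; apply: eq_bigr => i _.
rewrite !mxE mulr_sumr; apply: eq_bigr => j _.
by rewrite mxE (christoffel_sym l j i Ox); ring.
Qed.

Lemma bracketE X Y x l :
  bracket X Y x 0 l = dird (X x) (fun y => Y y 0 l) x - dird (Y x) (fun y => X y 0 l) x.
Proof.
by rewrite summxE /dird -sumrB; apply: eq_bigr => i _; rewrite !mxE.
Qed.

Lemma dird_dird v Y f x : field_diff Y x ->
    (forall j, differentiable (pd j f) x) ->
  dird v (fun y => dird (Y y) f y) x =
  \sum_j (dird v (fun y => Y y 0 j) x * pd j f x + Y x 0 j * dird v (pd j f) x).
Proof.
move=> dY df; rewrite dird_sum; last by move=> j; exact: differentiableM.
by apply: eq_bigr => j _; rewrite dirdM.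
Qed.

Lemma dird_bracket X Y f x : O x -> field_diff X x -> field_diff Y x -> Ck 2 O f ->
  dird (X x) (fun y => dird (Y y) f y) x - dird (Y x) (fun y => dird (X y) f y) x
  = dird (bracket X Y x) f x.
Proof.
move=> Ox dX dY cf.
have df j : differentiable (pd j f) x by have [_ /(_ j)[+ _]] := cf; apply.
rewrite !dird_dird// !big_split /= opprD addrACA -sumrB.
rewrite -[RHS]addr0; congr (_ + _).
  by apply: eq_bigr => j _; rewrite bracketE mulrBl.
apply/eqP; rewrite subr_eq0; apply/eqP; rewrite /dird.
under eq_bigr do rewrite mulr_sumr.
rewrite exchange_big; apply: eq_bigr => i _; rewrite mulr_sumr; apply: eq_bigr => j _.
by rewrite (schwarz i j hO cf Ox); ring.
Qed.

Lemma conn_smooth i j l : smooth O (fun y => conn h i y j l).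
Proof.
have -> : (fun y => conn h i y j l) = (fun y => 2^-1 *
    \sum_b invmx (h y) l b * (pd i (fun z => h z j b) y +
      pd j (fun z => h z i b) y - pd b (fun z => h z i j) y)).
  by apply/funext => y; rewrite mxE.
apply: smoothM => //; first exact: smooth_cst.
apply: smooth_sum => // b _; apply: smoothM => //; first exact: smooth_invmx.
apply: smoothD => //; last by apply: smoothN => //; exact: smooth_pd.
by apply: smoothD => //; exact: smooth_pd.
Qed.

Lemma dird_smooth X f : sfield X -> smooth O f -> smooth O (fun y => dird (X y) f y).
Proof.
move=> sX sf; apply: smooth_sum => // i _; apply: smoothM => //.
exact: smooth_pd.
Qed.

Lemma cov_basis_smooth j W : sfield W -> sfield (cov_basis h j W).
Proof.
move=> sW l.
apply: (@smooth_ext _ _ _ hO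
  (fun y => pd j (fun z => W z 0 l) y + \sum_q W y 0 q * conn h j y q l)).
  by move=> y _; rewrite /cov_basis !mxE.
apply: smoothD => //; first exact: smooth_pd.
by apply: smooth_sum => // q _; apply: smoothM => //; exact: conn_smooth.
Qed.

Lemma ccov_smooth X W : sfield X -> sfield W -> sfield (fun y => ccov h (X y) W y).
Proof.
move=> sX sW l; apply: (@smooth_ext _ _ _ hO
  (fun y => \sum_i X y 0 i * cov_basis h i W y 0 l)).
  by move=> y _; rewrite ccovE summxE; apply: eq_bigr => i _; rewrite [RHS]mxE.
apply: smooth_sum => // i _; apply: smoothM => //.
exact: (cov_basis_smooth i sW l).
Qed.

Lemma ip_smooth X Y : sfield X -> sfield Y -> smooth O (fun y => ip h y (X y) (Y y)).
Proof.
move=> sX sY; apply: (@smooth_ext _ _ _ hO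
  (fun y => \sum_b (\sum_a X y 0 a * h y a b) * Y y 0 b)).
  by move=> y _; rewrite /ip !mxE; apply: eq_bigr => b _; rewrite !mxE.
apply: smooth_sum => // b _; apply: smoothM => //.
by apply: smooth_sum => // a _; exact: smoothM.
Qed.

Definition curv_mx i j x : 'M[R]_n := \matrix_(q, l) ccurv h l i j q x.

Lemma commutator_expand (A B C w : 'rV[R]_n) (M N M' N' : 'M[R]_n) :
  A + (B *m N + w *m N') + (C + w *m N) *m M
  - (A + (C *m M + w *m M') + (B + w *m M) *m N) =
  w *m (N' - M' + (N *m M - M *m N)).
Proof.
rewrite !mulmxDl !mulmxDr !mulmxN !mulmxA.
move: (w *m M *m N) (w *m N *m M) (w *m N') (w *m M') (B *m N) (C *m M).
by move=> a b c d e f; apply/rowP => l; rewrite !mxE; ring.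
Qed.

(** Second derivatives of the components cancel by [schwarz] and first
    derivatives cancel in pairs; what multiplies the components themselves is
    the curvature. *)
Lemma cov_basis_commute i j W x : O x -> sfield W ->
  cov_basis h i (cov_basis h j W) x - cov_basis h j (cov_basis h i W) x =
  W x *m curv_mx i j x.
Proof.
move=> Ox sW.
have E a b : cov_basis h a (cov_basis h b W) x =
    pdv a (pdv b W) x + (pdv a W x *m conn h b x + W x *m pdm a (conn h b) x)
    + (pdv b W x + W x *m conn h b x) *m conn h a x.
  rewrite {1}/cov_basis; congr (_ + _).
  have dW (c : 'I_1) d : differentiable (fun y => W y c d) x.
    by rewrite ord1; exact: sfield_diff.
  have dc c d : differentiable (fun y => conn h b y c d) x.
    exact: smooth_differentiable (conn_smooth b c d) Ox.
  apply/rowP => l; rewrite mxE.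
  transitivity (pd a (fun y => pdv b W y 0 l + (W y *m conn h b y) 0 l) x).
    by congr (pd a _ x); apply/funext => y; rewrite mxE.
  have [dm Em] := pd_mulmx a 0 l dW dc.
  rewrite pdD//; last first.
    rewrite (_ : (fun y => _) = pd b (fun z => W z 0 l)); last first.
      by apply/funext => y; rewrite mxE.
    by apply: smooth_differentiable Ox; exact: smooth_pd.
  by rewrite Em [RHS]mxE pdm_row [in RHS]mxE.
have S : pdv i (pdv j W) x = pdv j (pdv i W) x.
  have Q a l : (fun y => pdv a W y 0 l) = pd a (fun y => W y 0 l).
    by apply/funext => y; rewrite mxE.
  have c2 l : Ck 2 O (fun y => W y 0 l) by exact: sW.
  apply/rowP => l; rewrite [LHS]mxE [RHS]mxE.
  rewrite (Q j l).
  rewrite (Q i l).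
  exact: (schwarz i j hO (c2 l) Ox).
have -> : curv_mx i j x = pdm i (conn h j) x - pdm j (conn h i) x +
    (conn h j x *m conn h i x - conn h i x *m conn h j x).
  apply/matrixP => q l; rewrite !mxE /ccurv; congr (_ - _ + _).
  - by congr (pd i _ x); apply/funext => y; rewrite mxE.
  - by congr (pd j _ x); apply/funext => y; rewrite mxE.
  by rewrite -sumrB; apply: eq_bigr => b _; rewrite !mxE; ring.
rewrite (E i j) (E j i) S; exact: commutator_expand.
Qed.

(** The Ricci identity. The derivatives of the components of X and Y add up to
    the derivative along the bracket, which leaves the commutator in the
    coordinate directions. *)
Lemma ccov_commute X Y W x : O x -> sfield X -> sfield Y -> sfield W ->
  ccov h (X x) (fun y => ccov h (Y y) W y) x
  - ccov h (Y x) (fun y => ccov h (X y) W y) x - ccov h (bracket X Y x) W x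
  = \sum_i \sum_j (X x 0 i * Y x 0 j) *: (W x *m curv_mx i j x).
Proof.
move=> Ox sX sY sW.
have E X' Y' : sfield X' -> sfield Y' -> ccov h (X' x) (fun y => ccov h (Y' y) W y) x =
    \sum_j dird (X' x) (fun y => Y' y 0 j) x *: cov_basis h j W x +
    \sum_i \sum_j (X' x 0 i * Y' x 0 j) *: cov_basis h i (cov_basis h j W) x.
  move=> sX' sY'.
  have -> : (fun y => ccov h (Y' y) W y) =
      (fun y => \sum_j Y' y 0 j *: cov_basis h j W y).
    by apply/funext => y; rewrite ccovE.
  have dN j : field_diff (cov_basis h j W) x.
    by apply: sfield_diff => //; exact: cov_basis_smooth.
  rewrite ccov_sum; last first.
    move=> j l; rewrite (_ : (fun y => _) =
      (fun y => Y' y 0 j * cov_basis h j W y 0 l)); last first.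
      by apply/funext => y; rewrite mxE.
    by apply: differentiableM; [exact: sfield_diff | exact: dN].
  have E1 j : ccov h (X' x) (fun y => Y' y 0 j *: cov_basis h j W y) x =
      dird (X' x) (fun y => Y' y 0 j) x *: cov_basis h j W x +
      Y' x 0 j *: ccov h (X' x) (cov_basis h j W) x.
    by apply: ccovZ; [exact: sfield_diff | exact: dN].
  under eq_bigr do rewrite E1.
  rewrite big_split /=; congr (_ + _); rewrite exchange_big; apply: eq_bigr => j _.
  rewrite ccovE scaler_sumr; apply: eq_bigr => i _.
  by rewrite scalerA mulrC.
rewrite (E X Y sX sY) (E Y X sY sX).
have -> : ccov h (bracket X Y x) W x =
    \sum_j dird (X x) (fun y => Y y 0 j) x *: cov_basis h j W x -
    \sum_j dird (Y x) (fun y => X y 0 j) x *: cov_basis h j W x.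
  by rewrite ccovE -sumrB; apply: eq_bigr => i _; rewrite bracketE scalerBl.
rewrite opprD addrACA [X in X - _]addrC addrK.
rewrite [X in _ - X]exchange_big -sumrB; apply: eq_bigr => i _.
rewrite -sumrB; apply: eq_bigr => j _.
by rewrite -cov_basis_commute// scalerBr (mulrC (Y x 0 j)).
Qed.

(** Expresses the curvature, defined by components, through second covariant
    derivatives, which can be evaluated in a moving frame. *)
Lemma cRmE X Y W (V : 'rV[R]_n) x : O x -> sfield X -> sfield Y -> sfield W ->
  cRm h (X x) (Y x) V (W x) x =
  ip h x (ccov h (X x) (fun y => ccov h (Y y) W y) x
    - ccov h (Y x) (fun y => ccov h (X y) W y) x - ccov h (bracket X Y x) W x) V.
Proof.
move=> Ox sX sY sW; rewrite ccov_commute// ip_suml; apply: eq_bigr => i _.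
rewrite ip_suml; apply: eq_bigr => j _; rewrite ipZl.
have -> : ip h x (W x *m curv_mx i j x) V =
    \sum_q \sum_l \sum_b W x 0 q * ccurv h l i j q x * h x l b * V 0 b.
  rewrite /ip -mulmxA mxE.
  have T l : (W x *m curv_mx i j x) 0 l * (h x *m V^T) l 0 =
      \sum_q \sum_b W x 0 q * ccurv h l i j q x * h x l b * V 0 b.
    rewrite !mxE mulr_suml; apply: eq_bigr => q _.
    by rewrite mulr_sumr; apply: eq_bigr => b _; rewrite !mxE; ring.
  by under eq_bigr do rewrite T; rewrite exchange_big.
rewrite mulr_sumr; apply: eq_bigr => q _; rewrite mulr_sumr; apply: eq_bigr => l _.
by rewrite mulr_sumr; apply: eq_bigr => b _; ring.
Qed.

End LeviCivita.

(** * Orthonormal moving frames *)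

Lemma mulmx_trE (R : pzRingType) (a b c : nat) (A : 'M[R]_(a, b)) (B : 'M[R]_(c, b)) i j :
  (A *m B^T) i j = (row i A *m (row j B)^T) 0 0.
Proof. by rewrite !mxE; apply: eq_bigr => k _; rewrite !mxE. Qed.

Section MovingFrame.
Variables (R : realType) (n : nat) (h : 'rV[R]_n -> 'M[R]_n).
Variable O : set 'rV[R]_n.
Hypotheses (hO : open O) (hsm : forall i j, smooth O (fun y => h y i j)).
Hypothesis hsym : forall x, O x -> (h x)^T = h x.
Hypothesis hunit : forall x, O x -> h x \in unitmx.
Variable E : nat -> 'rV[R]_n -> 'rV[R]_n.
Hypothesis hE : forall q, sfield O (E q).
Hypothesis horth : forall x p q, O x -> (0 < p <= n)%N -> (0 < q <= n)%N ->
  ip h x (E p x) (E q x) = (p == q)%:R.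
Implicit Types (f : 'rV[R]_n -> R) (x v : 'rV[R]_n) (i j k p q m : nat).

Definition conn_coef i j k x : R := ip h x (ccov h (E i x) (E j) x) (E k x).
Definition frame_deriv i f x : R := dird (E i x) f x.
Local Notation cc := conn_coef.
Local Notation ed := frame_deriv.

Lemma frame_expand v x : O x ->
  v = \sum_(1 <= k < n.+1) ip h x v (E k x) *: E k x.
Proof.
move=> Ox; pose B : 'M[R]_n := \matrix_(i, j) E i.+1 x 0 j.
have rowB (i : 'I_n) : row i B = E i.+1 x.
  by apply/rowP => j; rewrite !mxE.
have B1 : B *m (h x *m B^T) = 1%:M.
  apply/matrixP => i j; rewrite [RHS]mxE.
  have -> : (B *m (h x *m B^T)) i j = ip h x (row i B) (row j B).
    by rewrite mulmxA mulmx_trE row_mul.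
  by rewrite !rowB horth// ?eqSS//= ltn_ord.
rewrite -{1}(mulmx1 v) -(mulmx1C B1) mulmxA mulmx_sum_row big_add1 /= big_mkord.
apply: eq_bigr => i _; rewrite rowB; congr (_ *: _).
by rewrite mulmxA mulmx_trE rowB /ip row_id.
Qed.

Lemma ip_expand v v' x : O x ->
  ip h x v v' = \sum_(1 <= k < n.+1) ip h x v (E k x) * ip h x v' (E k x).
Proof.
move=> Ox; rewrite {1}(frame_expand v Ox) ip_suml; apply: eq_bigr => k _.
by rewrite ipZl (ipC hsym _ v').
Qed.

Lemma conn_coef_smooth i j k : smooth O (cc i j k).
Proof. by apply: ip_smooth => //; exact: ccov_smooth. Qed.

Lemma conn_coef_skew i j k x : O x -> (0 < j <= n)%N -> (0 < k <= n)%N ->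
  cc i j k x = - cc i k j x.
Proof.
move=> Ox hj hk; apply/eqP; rewrite -subr_eq0 opprK; apply/eqP.
have dj := sfield_diff (hE j) Ox; have dk := sfield_diff (hE k) Ox.
have := ccov_metric hO hsm hsym hunit (E i x) Ox dj dk.
rewrite (ipC hsym (E j x)) // -/(cc i j k x) -/(cc i k j x) => <-.
have E0 : \forall y \near x, ip h y (E j y) (E k y) = (j == k)%:R.
  by apply: (open_near hO) Ox => y Oy; exact: horth.
by rewrite (dird_near _ E0) dird_cst.
Qed.

Lemma conn_coef_diag i j x : O x -> (0 < j <= n)%N -> cc i j j x = 0.
Proof.
by move=> Ox hj; have := conn_coef_skew i Ox hj hj; move: (cc _ _ _ _) => a; lra.
Qed.

Lemma frame_bracket i j x : O x -> bracket (E i) (E j) x =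
  \sum_(1 <= k < n.+1) (cc i j k x - cc j i k x) *: E k x.
Proof.
move=> Ox; rewrite -(ccov_torsion hO hsym)// {1}(frame_expand (_ - _) Ox).
by apply: eq_bigr => k _; rewrite ipBl.
Qed.

Lemma frame_deriv_commute i j f x : O x -> Ck 2 O f ->
  ed i (ed j f) x - ed j (ed i f) x =
  \sum_(1 <= k < n.+1) (cc i j k x - cc j i k x) * ed k f x.
Proof.
move=> Ox cf; have di := sfield_diff (hE i) Ox; have dj := sfield_diff (hE j) Ox.
rewrite /frame_deriv (dird_bracket hO Ox di dj cf) frame_bracket// dird_sumv.
by apply: eq_bigr => k _; rewrite dirdZ.
Qed.

(** Metric compatibility moves the outer derivative onto the coefficient
    <nabla_j E_l, E_k>; the correction is a sum of products of coefficients. *)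
Lemma ccov_frame2 i j l k x : O x -> (0 < k <= n)%N ->
  ip h x (ccov h (E i x) (fun y => ccov h (E j y) (E l) y) x) (E k x) =
  ed i (cc j l k) x + \sum_(1 <= b < n.+1) cc j l b x * cc i b k x.
Proof.
move=> Ox hk.
have dN : field_diff (fun y => ccov h (E j y) (E l) y) x.
  by apply: sfield_diff Ox => //; exact: ccov_smooth.
have dk := sfield_diff (hE k) Ox.
rewrite /frame_deriv; have -> := ccov_metric hO hsm hsym hunit (E i x) Ox dN dk.
rewrite (ip_expand _ (ccov h (E i x) (E k) x) Ox) -addrA -[LHS]addr0; congr (_ + _).
apply/esym/eqP; rewrite -big_split /= big_nat big1// => b /andP[b1 b2].
by rewrite -/(cc j l b x) -/(cc i k b x) (conn_coef_skew i Ox hk) ?b1//; ring.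
Qed.

(** The second covariant derivatives are given by [ccov_frame2] and the bracket
    by [frame_bracket]; so the connection coefficients and their first
    derivatives determine the curvature. *)
Lemma sectional_frame p q x : O x -> (0 < p <= n)%N ->
  cRm h (E p x) (E q x) (E p x) (E q x) x =
  ed p (cc q q p) x - ed q (cc p q p) x
  + \sum_(1 <= k < n.+1) (cc q q k x * cc p k p x - cc p q k x * cc q k p x
       - (cc p q k x - cc q p k x) * cc k q p x).
Proof.
move=> Ox hp; rewrite (cRmE hO hsm hunit _ Ox (hE p) (hE q) (hE q)).
rewrite !ipBl !ccov_frame2// frame_bracket// ccov_sumv ip_suml !sumrB.
have -> : \sum_(1 <= k < n.+1) ip h x (ccov h ((cc p q k x - cc q p k x) *: E k x)
    (E q) x) (E p x) = \sum_(1 <= k < n.+1) (cc p q k x - cc q p k x) * cc k q p x.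
  by apply: eq_bigr => k _; rewrite ccovZv ipZl.
ring.
Qed.

End MovingFrame.

(** * The slicing identity in an adapted frame *)

Lemma sum_nat_only (V : nmodType) a b k (F : nat -> V) : (a <= k < b)%N ->
  (forall i, (a <= i < b)%N -> i != k -> F i = 0) ->
  \sum_(a <= i < b) F i = F k.
Proof.
move=> hk F0; rewrite (bigD1_seq k) ?iota_uniq ?mem_index_iota//=.
rewrite big_seq_cond big1 ?addr0// => i /andP[]; rewrite mem_index_iota.
exact: F0.
Qed.

Lemma sum_nat_split (V : nmodType) a b k (F : nat -> V) : (a <= k < b)%N ->
  \sum_(a <= i < b) F i = \sum_(a <= i < k) F i + (F k + \sum_(k.+1 <= i < b) F i).
Proof.
move=> /andP[ak kb]; rewrite (big_cat_nat ak (ltnW kb))/=.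
by rewrite [X in _ + X = _]big_ltn.
Qed.

Lemma sum_antisym (R : realType) a b (F : nat -> nat -> R) :
  (forall i j, (a <= i < b)%N -> (a <= j < b)%N -> F i j = - F j i) ->
  \sum_(a <= i < b) \sum_(a <= j < b) F i j = 0.
Proof.
move=> FN; set S := (X in X = 0).
suff : S = - S by move: S => S; lra.
rewrite {1}/S exchange_big_nat /= -sumrN; apply: eq_big_nat => i hi.
by rewrite -sumrN; apply: eq_big_nat => j hj; exact: FN.
Qed.

Lemma sum_triangle (V : nmodType) s (G : nat -> nat -> V) :
  \sum_(1 <= k < s) \sum_(k.+1 <= p < s.+1) G k p =
  \sum_(1 <= p < s.+1) \sum_(1 <= k < p) G k p.
Proof.
elim: s => [|s IH]; first by rewrite !big_geq.
rewrite [RHS]big_nat_recr//= -IH.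
transitivity (\sum_(1 <= k < s.+1) (\sum_(k.+1 <= p < s.+1) G k p + G k s.+1)).
  by apply: eq_big_nat => k /andP[_ ks]; rewrite big_nat_recr.
rewrite big_split /=; congr (_ + _).
case: s {IH} => [|s]; first by rewrite !big_geq.
by rewrite big_nat_recr//= [X in _ + X]big_geq// addr0.
Qed.

(** In this section [E 1], ..., [E s] play the part of the normals nu_1, ...,
    nu_s; [u m], [phi m] and [f m] that of u_m, |nabla_{Sigma_m} u_m| and
    log |Z_m|. The last hypothesis says that Z_m is divergence free on Sigma_m:
    the derivative of log |Z_m| along nu_{m+1} is minus the mean curvature. *)
Section AdaptedFrame.
Variables (R : realType) (n : nat) (h : 'rV[R]_n -> 'M[R]_n).
Variable O : set 'rV[R]_n.
Hypotheses (hO : open O) (hsm : forall i j, smooth O (fun y => h y i j)).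
Hypothesis hsym : forall x, O x -> (h x)^T = h x.
Hypothesis hunit : forall x, O x -> h x \in unitmx.
Variable E : nat -> 'rV[R]_n -> 'rV[R]_n.
Hypothesis hE : forall q, sfield O (E q).
Hypothesis horth : forall x p q, O x -> (0 < p <= n)%N -> (0 < q <= n)%N ->
  ip h x (E p x) (E q x) = (p == q)%:R.
Variables (s : nat) (u f phi : nat -> 'rV[R]_n -> R).
Hypothesis hsn : (s < n)%N.
Hypothesis hu : forall m, (m < s)%N -> Ck 2 O (u m).
Hypothesis hf : forall m, (m <= s)%N -> smooth O (f m).
Hypothesis hphi : forall m, (m < s)%N -> smooth O (phi m).
Hypothesis hphi0 : forall m x, (m < s)%N -> O x -> 0 < phi m x.
Hypothesis hfphi : forall m x, (m < s)%N -> O x ->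
  f m x = f m.+1 x + ln (phi m x).
Local Notation cc := (conn_coef h E).
Local Notation ed := (frame_deriv E).
Hypothesis hu0 : forall m q x, (m < s)%N -> (m.+1 < q <= n)%N -> O x ->
  ed q (u m) x = 0.
Hypothesis huphi : forall m x, (m < s)%N -> O x -> ed m.+1 (u m) x = phi m x.
Hypothesis hdivf : forall m x, (m < s)%N -> O x ->
  ed m.+1 (f m) x = - \sum_(m.+2 <= j < n.+1) cc j m.+1 j x.

Let skew := conn_coef_skew hO hsm hsym hunit hE horth.
Let diag := conn_coef_diag hO hsm hsym hunit hE horth.

Lemma frame_deriv_near i g g' x : O x -> (forall y, O y -> g y = g' y) ->
  ed i g x = ed i g' x.
Proof. by move=> Ox gg; apply: dird_near; apply: (open_near hO) Ox. Qed.

(** The symmetry of the second fundamental form of Sigma_k. For i, l > k the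
    fields E_i and E_l annihilate u_{k-1}, hence so does their bracket. Its
    components before k vanish by induction, those after k are annihilated by
    u_{k-1}, and u_{k-1} increases along E_k; so the k-th component vanishes. *)
Lemma leaf_integrable i l k x : O x -> (0 < k <= s)%N -> (k < i <= n)%N ->
  (k < l <= n)%N -> cc i l k x = cc l i k x.
Proof.
elim/ltn_ind: k i l => -[//|k] IH i l Ox /= ks hi hl.
have := frame_deriv_commute hO hsym hE horth i l Ox (hu ks).
have E0 q : (k.+1 < q <= n)%N -> forall p, ed p (ed q (u k)) x = 0.
  move=> hq p; rewrite (@frame_deriv_near _ _ (fun=> 0))//; first exact: dird_cst.
  by move=> y Oy; exact: hu0.
rewrite !E0// subrr (@sum_nat_only _ _ _ k.+1).
- move/esym/eqP; rewrite huphi// mulf_eq0 (gt_eqF (hphi0 ks Ox)) orbF subr_eq0.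
  by move/eqP.
- by case/andP: hi => hi1 hi2; rewrite /= ltnS (leq_trans (ltnW hi1)).
move=> j /andP[j1 jn]; rewrite neq_ltn => /orP[jk|kj]; last first.
  by rewrite hu0 ?mulr0// kj.
have lt_trans q : (k.+1 < q <= n)%N -> (j < q <= n)%N.
  by case/andP=> h1 ->; rewrite (ltn_trans jk).
rewrite (IH j jk i l)// ?subrr ?mul0r ?lt_trans//.
by rewrite j1 (leq_trans _ ks)// ltnW.
Qed.

(** With N = E_{m+1}, the tangential part of nabla_N N is the gradient of
    log phi_m. Indeed E_q u_m = 0 and N u_m = phi_m, so the bracket of N and E_q
    takes u_m to - E_q phi_m, and by [leaf_integrable] only its component along
    N contributes to this derivative. *)
Lemma lapse m q x : O x -> (m < s)%N -> (m.+1 < q <= n)%N ->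
  cc m.+1 m.+1 q x = ed q (f m) x - ed q (f m.+1) x.
Proof.
move=> Ox ms hq; have hN : (0 < m.+1 <= n)%N by rewrite /= (leq_trans ms)// ltnW.
have hq0 : (0 < q <= n)%N by case/andP: hq => h1 ->; rewrite (leq_trans _ h1).
have := frame_deriv_commute hO hsym hE horth m.+1 q Ox (hu ms).
rewrite (@frame_deriv_near m.+1 _ (fun=> 0))//; last by move=> y Oy; exact: hu0.
rewrite [ed m.+1 _ x]dird_cst.
rewrite (@frame_deriv_near q (ed m.+1 (u m)) (phi m))//; last by move=> y Oy; exact: huphi.
rewrite (@sum_nat_only _ _ _ m.+1); last 2 first.
- by rewrite /= ltnS.
- move=> j /andP[j1 jn]; rewrite neq_ltn => /orP[jm|mj]; last first.
    by rewrite hu0 ?mulr0// mj.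
  rewrite (@leaf_integrable m.+1 q j)// ?subrr ?mul0r//.
  + by rewrite j1 (leq_trans (ltnW jm)).
  + by rewrite jm /=; case/andP: hN.
  + by case/andP: hq => h1 ->; rewrite (ltn_trans jm).
rewrite (diag q Ox hN) subr0 huphi// (skew m.+1 Ox hq0 hN) sub0r mulNr => /oppr_inj E1.
have p0 := hphi0 ms Ox.
have dphi := smooth_differentiable (hphi ms) Ox.
have df1 := smooth_differentiable (hf ms) Ox.
have dl := (diff_comp1 _ dphi (is_derive1_ln p0)).
have -> : ed q (f m) x = ed q (f m.+1) x + ed q (phi m) x / phi m x.
  rewrite (@frame_deriv_near q _ (fun y => f m.+1 y + ln (phi m y)))//; last first.
    by move=> y Oy; exact: hfphi.
  rewrite /frame_deriv dirdDf//; last exact: (dl (Ordinal (leq_ltn_trans (leq0n s) hsn))).1.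
  congr (_ + _); rewrite /dird mulr_suml; apply: eq_bigr => a _.
  by rewrite (dl a).2 mulrA.
by rewrite addrC addKr E1 mulfK// gt_eqF.
Qed.

(** The trace over E_{m+1}, ..., E_n of the covariant derivative of the
    projection of grad F to their span, that is, the Laplacian on Sigma_m; see
    [claplacian_leaf]. *)
Definition frame_laplacian m (F : 'rV[R]_n -> R) x :=
  \sum_(m.+1 <= j < n.+1) ed j (ed j F) x +
  \sum_(m.+1 <= j < n.+1) \sum_(m.+1 <= i < n.+1) ed i F x * cc j i j x.

(** The decomposition of the Laplacian along a hypersurface with unit normal
    N = E_{m+1}: second derivative along N, mean curvature times derivative
    along N, the acceleration nabla_N N, and the Laplacian of the
    hypersurface. *)
Lemma frame_laplacian_split m F x : O x -> (m < s)%N ->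
  frame_laplacian m F x = ed m.+1 (ed m.+1 F) x
    + ed m.+1 F x * \sum_(m.+2 <= j < n.+1) cc j m.+1 j x
    + \sum_(m.+2 <= i < n.+1) ed i F x * cc m.+1 i m.+1 x + frame_laplacian m.+1 F x.
Proof.
move=> Ox ms; have mn : (m.+1 < n.+1)%N by rewrite ltnS (leq_trans ms)// ltnW.
have hN : (0 < m.+1 <= n)%N by rewrite /= (leq_trans ms)// ltnW.
have inner j : \sum_(m.+1 <= i < n.+1) ed i F x * cc j i j x =
    ed m.+1 F x * cc j m.+1 j x + \sum_(m.+2 <= i < n.+1) ed i F x * cc j i j x.
  by rewrite big_ltn.
rewrite /frame_laplacian (eq_bigr _ (fun j _ => inner j)) big_split /= -mulr_sumr.
rewrite !(@big_ltn _ _ _ m.+1)// (diag _ Ox hN) add0r.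
by move: (ed m.+1 F x * _) => a; ring.
Qed.

(** On Sigma_{m+1} the derivatives of log |Z_m| and log |Z_{m+1}| differ, by
    [lapse], by the components of nabla_N N; so the two Laplacians differ by its
    divergence. *)
Lemma frame_laplacian_lapse m x : O x -> (m < s)%N ->
  frame_laplacian m.+1 (f m) x = frame_laplacian m.+1 (f m.+1) x
    + \sum_(m.+2 <= j < n.+1) ed j (cc m.+1 m.+1 j) x
    + \sum_(m.+2 <= j < n.+1) \sum_(m.+2 <= i < n.+1)
        cc m.+1 m.+1 i x * cc j i j x.
Proof.
move=> Ox ms.
have E1 j y : O y -> (m.+2 <= j < n.+1)%N ->
    ed j (f m) y = ed j (f m.+1) y + cc m.+1 m.+1 j y.
  by move=> Oy hj; rewrite lapse// addrC subrK.
have E2 j : (m.+2 <= j < n.+1)%N -> ed j (ed j (f m)) x =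
    ed j (ed j (f m.+1)) x + ed j (cc m.+1 m.+1 j) x.
  move=> hj; rewrite -dirdDf.
  - by apply: frame_deriv_near => // y Oy; exact: E1.
  - apply: smooth_differentiable Ox; apply: dird_smooth => //; exact: hf.
  - by apply: smooth_differentiable Ox; exact: conn_coef_smooth.
have E3 j : \sum_(m.+2 <= i < n.+1) ed i (f m) x * cc j i j x =
    \sum_(m.+2 <= i < n.+1) ed i (f m.+1) x * cc j i j x +
    \sum_(m.+2 <= i < n.+1) cc m.+1 m.+1 i x * cc j i j x.
  transitivity (\sum_(m.+2 <= i < n.+1)
      (ed i (f m.+1) x * cc j i j x + cc m.+1 m.+1 i x * cc j i j x)).
    by apply: eq_big_nat => i hi; rewrite E1// mulrDl.
  by rewrite big_split.
have E4 : \sum_(m.+2 <= j < n.+1) ed j (ed j (f m)) x =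
    \sum_(m.+2 <= j < n.+1) ed j (ed j (f m.+1)) x
    + \sum_(m.+2 <= j < n.+1) ed j (cc m.+1 m.+1 j) x.
  transitivity (\sum_(m.+2 <= j < n.+1)
      (ed j (ed j (f m.+1)) x + ed j (cc m.+1 m.+1 j) x)).
    by apply: eq_big_nat => j hj; exact: E2.
  by rewrite big_split.
have E5 : \sum_(m.+2 <= j < n.+1) \sum_(m.+2 <= i < n.+1) ed i (f m) x * cc j i j x =
    \sum_(m.+2 <= j < n.+1) \sum_(m.+2 <= i < n.+1) ed i (f m.+1) x * cc j i j x +
    \sum_(m.+2 <= j < n.+1) \sum_(m.+2 <= i < n.+1) cc m.+1 m.+1 i x * cc j i j x.
  by rewrite (eq_bigr _ (fun j _ => E3 j)) big_split.
apply: (etrans (congr2 +%R E4 E5)).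
by rewrite addrACA addrA.
Qed.

(** Riccati and Gauss equations at once, with N = E_{m+1}. The left-hand side is
    the sectional curvature in Sigma_m of the plane of N and E_q, the sum over k
    being the Gauss correction from M to Sigma_m. In the sum over k of
    [sectional_frame], the indices below N give exactly this correction, by
    [leaf_integrable]; N itself gives the square of nabla_N N; the indices above
    N give the square of the second fundamental form of Sigma_{m+1}, a part of
    the divergence of nabla_N N, and a term that is skew in q and k. *)
Lemma sectional_adapted m q x : O x -> (m < s)%N -> (m.+1 < q <= n)%N ->
  cRm h (E m.+1 x) (E q x) (E m.+1 x) (E q x) x
  + \sum_(1 <= k < m.+1) (cc m.+1 k m.+1 x * cc q k q x - cc m.+1 k q x ^+ 2) =
  - ed m.+1 (cc q m.+1 q) x + ed q (cc m.+1 m.+1 q) x - cc m.+1 m.+1 q x ^+ 2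
  + \sum_(m.+2 <= k < n.+1) cc m.+1 m.+1 k x * cc q k q x
  + \sum_(m.+2 <= k < n.+1) cc m.+1 q k x * (cc q m.+1 k x + cc k m.+1 q x)
  - \sum_(m.+2 <= k < n.+1) cc q m.+1 k x ^+ 2.
Proof.
move=> Ox ms hq; have hN : (0 < m.+1 <= n)%N by rewrite /= (leq_trans ms)// ltnW.
have hq0 : (0 < q <= n)%N by case/andP: hq => h1 ->; rewrite (leq_trans _ h1).
rewrite (sectional_frame hO hsm hsym hunit hE horth q Ox hN).
have dc a b c : differentiable (cc a b c) x.
  by apply: smooth_differentiable Ox; exact: conn_coef_smooth.
rewrite (@frame_deriv_near m.+1 (cc q q m.+1) (fun y => - cc q m.+1 q y))//; last first.
  by move=> y Oy; exact: skew.
rewrite (@frame_deriv_near q (cc m.+1 q m.+1) (fun y => - cc m.+1 m.+1 q y))//; last first.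
  by move=> y Oy; exact: skew.
rewrite /frame_deriv !dirdN// opprK -!addrA; congr (_ + (_ + _)); rewrite !addrA.
rewrite (@sum_nat_split _ 1 n.+1 m.+1)//.
have low : \sum_(1 <= k < m.+1) (cc q q k x * cc m.+1 k m.+1 x
    - cc m.+1 q k x * cc q k m.+1 x
    - (cc m.+1 q k x - cc q m.+1 k x) * cc k q m.+1 x) =
    - \sum_(1 <= k < m.+1) (cc m.+1 k m.+1 x * cc q k q x - cc m.+1 k q x ^+ 2).
  rewrite -sumrN; apply: eq_big_nat => k /andP[k1 km].
  have ks : (0 < k <= s)%N by rewrite k1 (leq_trans _ ms)// ltnW.
  have hk : (0 < k <= n)%N by case/andP: ks => -> h1; rewrite (leq_trans h1)// ltnW.
  have kN : (k < m.+1 <= n)%N by rewrite km; case/andP: hN.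
  have kq : (k < q <= n)%N by case/andP: hq => h1 ->; rewrite (ltn_trans km).
  have I1 := leaf_integrable Ox ks kN kq.
  have S1 := skew q Ox hq0 hk; have S2 := skew m.+1 Ox hq0 hk.
  have S3 := skew q Ox hN hk.
  rewrite I1 in S2 *.
  have I2 : cc m.+1 k q x = cc q k m.+1 x.
    by have := S2; rewrite S3 => /oppr_inj ->.
  by rewrite S1 I2 S3; ring.
have mid : cc q q m.+1 x * cc m.+1 m.+1 m.+1 x
    - cc m.+1 q m.+1 x * cc q m.+1 m.+1 x
    - (cc m.+1 q m.+1 x - cc q m.+1 m.+1 x) * cc m.+1 q m.+1 x =
    - cc m.+1 m.+1 q x ^+ 2.
  by rewrite !(diag _ Ox hN) (skew m.+1 Ox hq0 hN); ring.
have high : \sum_(m.+2 <= k < n.+1) (cc q q k x * cc m.+1 k m.+1 x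
    - cc m.+1 q k x * cc q k m.+1 x
    - (cc m.+1 q k x - cc q m.+1 k x) * cc k q m.+1 x) =
  \sum_(m.+2 <= k < n.+1) cc m.+1 m.+1 k x * cc q k q x
  + \sum_(m.+2 <= k < n.+1) cc m.+1 q k x * (cc q m.+1 k x + cc k m.+1 q x)
  - \sum_(m.+2 <= k < n.+1) cc q m.+1 k x ^+ 2.
  rewrite -big_split /= -sumrB; apply: eq_big_nat => k hk.
  have hk0 : (0 < k <= n)%N.
    by case/andP: hk => h1; rewrite ltnS => ->; rewrite (leq_trans _ h1).
  have I : cc q k m.+1 x = cc k q m.+1 x by exact: leaf_integrable.
  have S : cc k m.+1 q x = cc q m.+1 k x.
    by rewrite (skew k Ox hN hq0) -I (skew q Ox hk0 hN) opprK.
  rewrite -I S (skew q Ox hk0 hN) (skew q Ox hq0 hk0) (skew m.+1 Ox hk0 hN).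
  by ring.
rewrite low mid high addrCA !addrA; ring.
Qed.

(** The equation N log |Z_m| = - H holds on an open set, so that it may be
    differentiated along N. *)
Lemma frame_deriv_div m x : O x -> (m < s)%N -> ed m.+1 (ed m.+1 (f m)) x =
  - \sum_(m.+2 <= j < n.+1) ed m.+1 (cc j m.+1 j) x.
Proof.
move=> Ox ms; rewrite (@frame_deriv_near m.+1 (ed m.+1 (f m))
  (fun y => - \sum_(m.+2 <= j < n.+1) cc j m.+1 j y))//; last first.
  by move=> y Oy; exact: hdivf.
have dc a b c : differentiable (cc a b c) x.
  by apply: smooth_differentiable Ox; exact: conn_coef_smooth.
have ds : differentiable (fun y => \sum_(m.+2 <= j < n.+1) cc j m.+1 j y) x.
  (* a coordinate direction, which exists because n > 0 *)
  have i0 := Ordinal (leq_ltn_trans (leq0n s) hsn).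
  exact: (pd_sum _ _ i0 (fun j => dc j m.+1 j)).2.
by rewrite [LHS]dirdN// (dird_sum _ _ _ (fun j => dc j m.+1 j)).
Qed.

Opaque frame_deriv conn_coef cRm.

(** The identity for the single hypersurface Sigma_{m+1} of Sigma_m. In
    [frame_laplacian_split] the second derivative of log |Z_m| along N is minus
    the derivative of the mean curvature; the sum of [sectional_adapted] over q
    expresses the latter by curvature, and the divergence of nabla_N N that
    comes with it is the one of [frame_laplacian_lapse]. *)
Lemma slicing_step m x : O x -> (m < s)%N ->
  frame_laplacian m (f m) x - frame_laplacian m.+1 (f m.+1) x =
  \sum_(m.+2 <= p < n.+1) \sum_(m.+2 <= q < n.+1) cc p m.+1 q x ^+ 2
  - (\sum_(m.+2 <= p < n.+1) cc p m.+1 p x) ^+ 2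
  + \sum_(m.+2 <= q < n.+1) (cRm h (E m.+1 x) (E q x) (E m.+1 x) (E q x) x
     + \sum_(1 <= k < m.+1) (cc m.+1 k m.+1 x * cc q k q x - cc m.+1 k q x ^+ 2))
  - \sum_(m.+2 <= q < n.+1) (ed q (f m) x - ed q (f m.+1) x) * ed q (f m.+1) x.
Proof.
move=> Ox ms; have hN : (0 < m.+1 <= n)%N by rewrite /= (leq_trans ms)// ltnW.
have hq0 q : (m.+1 < q < n.+1)%N -> (0 < q <= n)%N.
  by case/andP=> h1; rewrite ltnS => ->; rewrite (leq_trans _ h1).
have S0 : \sum_(m.+2 <= q < n.+1) \sum_(m.+2 <= k < n.+1)
    cc m.+1 q k x * (cc q m.+1 k x + cc k m.+1 q x) = 0.
  apply: sum_antisym => q k hq hk.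
  by rewrite (skew m.+1 Ox (hq0 q hq) (hq0 k hk)) (addrC (cc q _ _ _)) mulNr.
have K := eq_big_nat _ _ (fun q (hq : (m.+2 <= q < n.+1)%N) =>
  sectional_adapted Ox ms hq).
rewrite {}K !big_split /= !sumrN S0.
have L : \sum_(m.+2 <= i < n.+1) ed i (f m) x * cc m.+1 i m.+1 x =
    - \sum_(m.+2 <= q < n.+1) (ed q (f m) x - ed q (f m.+1) x) * ed q (f m.+1) x
    - \sum_(m.+2 <= q < n.+1) cc m.+1 m.+1 q x ^+ 2.
  transitivity (\sum_(m.+2 <= q < n.+1)
      (- ((ed q (f m) x - ed q (f m.+1) x) * ed q (f m.+1) x)
       - cc m.+1 m.+1 q x ^+ 2)).
    apply: eq_big_nat => q hq.
    by rewrite (skew m.+1 Ox (hq0 q hq) hN) lapse//; ring.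
  by rewrite sumrB sumrN.
rewrite frame_laplacian_split// frame_laplacian_lapse// frame_deriv_div// L hdivf//.
by ring.
Qed.

(** The Laplacians telescope. The Gauss corrections, which each step produces
    for all earlier leaves, are regrouped by leaves with [sum_triangle]. *)
Lemma flag_identity x : O x ->
  frame_laplacian 0 (f 0%N) x - frame_laplacian s (f s) x =
  \sum_(0 <= m < s)
    (\sum_(m.+2 <= p < n.+1) \sum_(m.+2 <= q < n.+1) cc p m.+1 q x ^+ 2
     - (\sum_(m.+2 <= p < n.+1) cc p m.+1 p x) ^+ 2)
  + \sum_(1 <= p < s.+1) \sum_(p.+1 <= q < n.+1)
      cRm h (E p x) (E q x) (E p x) (E q x) x
  + \sum_(1 <= m < s) \sum_(m.+1 <= p < s.+1) \sum_(p.+1 <= q < n.+1)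
      (cc p m p x * cc q m q x - cc p m q x ^+ 2)
  - \sum_(0 <= m < s) \sum_(m.+2 <= q < n.+1)
      (ed q (f m) x - ed q (f m.+1) x) * ed q (f m.+1) x.
Proof.
move=> Ox.
have T : frame_laplacian 0 (f 0%N) x - frame_laplacian s (f s) x =
    \sum_(0 <= m < s) (frame_laplacian m (f m) x - frame_laplacian m.+1 (f m.+1) x).
  apply: oppr_inj; rewrite opprB -(telescope_sumr (fun m => frame_laplacian m (f m) x))//.
  by rewrite -sumrN; apply: eq_bigr => m _; rewrite opprB.
rewrite T sum_triangle !(big_add1 _ _ 0) /=.
apply: etrans; first by apply: eq_big_nat => m hm; exact: slicing_step.
rewrite !big_split /= !sumrN.
congr (_ - _); rewrite -[RHS]addrA; congr (_ + _).
transitivity (\sum_(0 <= m < s)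
    (\sum_(m.+2 <= q < n.+1) cRm h (E m.+1 x) (E q x) (E m.+1 x) (E q x) x +
     \sum_(1 <= k < m.+1) \sum_(m.+2 <= q < n.+1)
       (cc m.+1 k m.+1 x * cc q k q x - cc m.+1 k q x ^+ 2))).
  apply: eq_bigr => m _; rewrite big_split /=; congr (_ + _).
  by rewrite exchange_big_nat.
by rewrite big_split.
Qed.
Transparent frame_deriv conn_coef cRm.

End AdaptedFrame.

(** * Immersions and the induced connection *)

Lemma mulmx_row_eq (R : pzRingType) (a b c : nat) (A A' : 'M[R]_(a, b))
  (B : 'M[R]_(b, c)) i i' j : (forall p, A i p = A' i' p) ->
  (A *m B) i j = (A' *m B) i' j.
Proof. by move=> AA; rewrite !mxE; apply: eq_bigr => p _; rewrite AA. Qed.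

Section Immersion.
Variables (R : realType) (n k : nat) (h : 'rV[R]_n -> 'M[R]_n).
Variables (O : set 'rV[R]_n) (U : set 'rV[R]_k) (F : 'rV[R]_k -> 'rV[R]_n).
Hypotheses (hO : open O) (hU : open U).
Hypothesis hsm : forall i j, smooth O (fun y => h y i j).
Hypothesis hsym : forall x, O x -> (h x)^T = h x.
Hypothesis hunit : forall x, O x -> h x \in unitmx.
Hypothesis FU : forall v, U v -> O (F v).
Hypothesis hF : forall j, Ck 3 U (fun v => F v 0 j).

Definition pullback_metric (v : 'rV[R]_k) : 'M[R]_k :=
  jac F v *m h (F v) *m (jac F v)^T.
Local Notation g := pullback_metric.
Hypothesis gunit : forall v, U v -> g v \in unitmx.

Lemma Ck_comp r (f : 'rV[R]_n -> R) :
  (forall j, Ck r.+1 U (fun v => F v 0 j)) -> Ck r O f ->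
  Ck r U (fun v => f (F v)).
Proof.
elim: r f => [|r IH] f cF cf.
  move=> v Uv; apply: continuous_comp; last exact: cf (FU Uv).
  apply: differentiable_continuous; apply: differentiable_row => j.
  by have [+ _] := cF j; apply.
have dF v : U v -> forall j, differentiable (fun v => F v 0 j) v.
  by move=> Uv j; have [+ _] := cF j; apply.
have df v : U v -> differentiable f (F v).
  by move=> Uv; have [+ _] := cf; apply; exact: FU.
have [j0|n0] := pselect (exists i : 'I_k, True); last first.
  case: cf => _ _; split=> [v Uv|i]; last by exfalso; apply: n0; exists i.
  have -> : (fun v => f (F v)) = fun=> f (F v).
    apply/funext => w; congr (f (F _)); apply/rowP => i.
    by exfalso; apply: n0; exists i.
  exact: differentiable_cst.
split=> [v Uv|i].
  by have [i _] := j0; exact: (chain_rule i (dF v Uv) (df v Uv)).1.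
apply: (@Ck_ext _ _ _ hU _
  (fun v => \sum_j pd i (fun y => F y 0 j) v * pd j f (F v))) => [v Uv|].
  by rewrite (chain_rule i (dF v Uv) (df v Uv)).2.
apply: Ck_sum => // j _; apply: CkM => //.
  by have [_ +] := CkW (cF j); apply.
by apply: IH => [j'|]; [exact: CkW | have [_ +] := cf; apply].
Qed.

Lemma jac_Ck i j : Ck 2 U (fun v => jac F v i j).
Proof.
apply: (@Ck_ext _ _ _ hU _ (pd i (fun v => F v 0 j))) => [v _|].
  by rewrite mxE.
by have [_ +] := hF j; apply.
Qed.

Lemma gramF_Ck i j : Ck 1 U (fun v => h (F v) i j).
Proof.
by apply: (@Ck_comp 1 (fun y => h y i j)) => [a|]; [exact: CkW | exact: hsm].
Qed.

Lemma Ck_mulmx r (a b c : nat) (A : 'rV[R]_k -> 'M[R]_(a, b))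
  (B : 'rV[R]_k -> 'M[R]_(b, c)) :
  (forall i j, Ck r U (fun v => A v i j)) -> (forall i j, Ck r U (fun v => B v i j)) ->
  forall i j, Ck r U (fun v => (A v *m B v) i j).
Proof.
move=> cA cB i j.
apply: (@Ck_ext _ _ _ hU _ (fun v => \sum_l A v i l * B v l j)) => [v _|].
  by rewrite mxE.
by apply: Ck_sum => // l _; exact: CkM.
Qed.

Lemma Ck_tr r (a b : nat) (A : 'rV[R]_k -> 'M[R]_(a, b)) :
  (forall i j, Ck r U (fun v => A v i j)) ->
  forall i j, Ck r U (fun v => (A v)^T i j).
Proof. by move=> cA i j; apply: Ck_ext (cA j i) => // v _; rewrite mxE. Qed.

Lemma pullback_metric_Ck i j : Ck 1 U (fun v => g v i j).
Proof.
have cJ a b : Ck 1 U (fun v => jac F v a b) by exact/CkW/jac_Ck.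
apply: Ck_mulmx; last exact: Ck_tr.
exact: Ck_mulmx gramF_Ck.
Qed.

Lemma pullback_metric_sym v : U v -> (g v)^T = g v.
Proof. by move=> Uv; rewrite /g !trmx_mul trmxK hsym ?mulmxA//; exact: FU. Qed.

Section AtPoint.
Variable v : 'rV[R]_k.
Hypothesis Uv : U v.
Let J := jac F v.
Let H := h (F v).
Let T i := pdm i (jac F) v.
Let Ov := FU Uv.

Lemma diffF j : differentiable (fun v => F v 0 j) v.
Proof. by have [+ _] := hF j; apply. Qed.

Lemma diffJ i j : differentiable (fun v => jac F v i j) v.
Proof. by have [+ _] := jac_Ck i j; apply. Qed.

Lemma pd_pull f i : differentiable f (F v) ->
  differentiable (fun y => f (F y)) v /\
  pd i (fun y => f (F y)) v = \sum_r J i r * pd r f (F v).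
Proof.
move=> df; have [d ->] := chain_rule i diffF df; split=> //.
by apply: eq_bigr => r _; rewrite mxE.
Qed.

Lemma hess_sym i j p : T i j p = T j i p.
Proof.
rewrite /T [LHS]mxE [RHS]mxE.
have Q a : (fun y => jac F y a p) = pd a (fun y => F y 0 p).
  by apply/funext => y; rewrite mxE.
rewrite (Q j) (Q i).
by apply: (schwarz i j hU _ Uv); exact/CkW/hF.
Qed.

Lemma pdm_pullback i : pdm i g v = T i *m H *m J^T
  + J *m (\sum_r J i r *: pdm r h (F v)) *m J^T + J *m H *m (T i)^T.
Proof.
have dh a b : differentiable (fun y => h (F y) a b) v.
  exact: (pd_pull i (gram_diff hsm a b Ov)).1.
have dJ := diffJ.
have dJh a b : differentiable (fun y => (jac F y *m h (F y)) a b) v.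
  by have [] := pd_mulmx i a b dJ dh.
have dJt a b : differentiable (fun y => (jac F y)^T a b) v.
  by rewrite (_ : (fun y => _) = (fun y => jac F y b a))//; apply/funext => y; rewrite mxE.
rewrite /g pdm_mulmx// pdm_tr pdm_mulmx// mulmxDl; congr (_ + _ *m _ + _).
congr (_ *m _); apply/matrixP => a b; rewrite mxE summxE.
rewrite (pd_pull i (gram_diff hsm a b Ov)).2.
by apply: eq_bigr => r _; rewrite !mxE.
Qed.

Lemma trilinear (D : 'I_n -> 'M[R]_n) i j b :
  (J *m (\sum_r J i r *: D r) *m J^T) j b =
  \sum_r \sum_p \sum_q J i r * J j p * J b q * D r p q.
Proof.
rewrite mulmx_sumr mulmx_suml summxE; apply: eq_bigr => r _.
rewrite mxE exchange_big; apply: eq_bigr => q _.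
rewrite !mxE mulr_suml; apply: eq_bigr => p _.
by rewrite !mxE; ring.
Qed.

(** Koszul's formula for the metric J h J^T. Its derivatives contain second
    derivatives of F, which by their symmetry combine to the single term T i,
    and pulled back derivatives of h, which combine to the ambient symbols. *)
Lemma conn_pullback i : conn g i v *m g v =
  (T i + \sum_r J i r *: (J *m conn h r (F v))) *m H *m J^T.
Proof.
pose D r := pdm r h (F v).
pose X a b c := (T a *m H *m J^T) b c.
pose S a b c := (J *m (\sum_r J a r *: D r) *m J^T) b c.
have Xsym a b c : X a b c = X b a c.
  by apply: mulmx_row_eq => p; apply: mulmx_row_eq => q; exact: hess_sym.
have Xtr a b c : (J *m H *m (T a)^T) b c = X a c b.
  have -> : J *m H *m (T a)^T = (T a *m H *m J^T)^T.
    by rewrite !trmx_mul trmxK (hsym Ov : H^T = H) mulmxA.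
  by rewrite mxE.
have gE a b c : pd a (fun y => g y b c) v = X a b c + S a b c + X a c b.
  have mx3 (A B C : 'M[R]_k) : (A + B + C) b c = A b c + B b c + C b c.
    by rewrite !mxE.
  transitivity (pdm a g v b c); first by rewrite [RHS]mxE.
  by rewrite pdm_pullback mx3 Xtr.
rewrite (conn_lowered i (pullback_metric_sym Uv) (gunit Uv)).
have -> : (T i + \sum_r J i r *: (J *m conn h r (F v))) *m H *m J^T =
    T i *m H *m J^T + J *m (\sum_r J i r *: (conn h r (F v) *m H)) *m J^T.
  rewrite !mulmxDl; congr (_ + _ *m _); rewrite mulmx_suml mulmx_sumr.
  by apply: eq_bigr => r _; rewrite -scalemxAl -scalemxAr mulmxA.
apply/matrixP => j b; rewrite [LHS]mxE !gE [RHS]mxE trilinear -/(X i j b).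
have -> : \sum_r \sum_p \sum_q J i r * J j p * J b q * (conn h r (F v) *m H) p q =
    2^-1 * (S i j b + S j i b - S b i j).
  have E1 : S j i b = \sum_r \sum_p \sum_q J i r * J j p * J b q * D p r q.
    rewrite /S trilinear exchange_big; apply: eq_bigr => r _; apply: eq_bigr => p _.
    by apply: eq_bigr => q _; ring.
  have E2 : S b i j = \sum_r \sum_p \sum_q J i r * J j p * J b q * D q r p.
    rewrite /S trilinear exchange_big; apply: eq_bigr => r _.
    rewrite exchange_big; apply: eq_bigr => p _; apply: eq_bigr => q _; ring.
  have E3 : S i j b = \sum_r \sum_p \sum_q J i r * J j p * J b q * D r p q.
    by rewrite /S trilinear.
  rewrite {}E1 {}E2 {}E3 -big_split -sumrB mulr_sumr; apply: eq_bigr => r _ /=.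
  rewrite -big_split -sumrB mulr_sumr; apply: eq_bigr => p _ /=.
  rewrite -big_split -sumrB mulr_sumr; apply: eq_bigr => q _ /=.
  rewrite (conn_lowered r (hsym Ov) (hunit Ov)) /D !mxE; ring.
rewrite (Xsym b i j) (Xsym j i b) (Xsym b j i).
by field.
Qed.

(** Gauss formula. Multiplication by the induced Gram matrix is the pairing with
    tangent vectors; paired in this way, the second derivatives of F in
    [conn_pullback] are those that appear when Y J is differentiated. *)
Lemma ccov_pullback w (Y : 'rV[R]_k -> 'rV[R]_k) (Y' : 'rV[R]_n -> 'rV[R]_n) :
  field_diff Y v -> field_diff Y' (F v) ->
  (\forall y \near v, Y y *m jac F y = Y' (F y)) ->
  ccov g w Y v *m g v = ccov h (w *m J) Y' (F v) *m H *m J^T.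
Proof.
move=> dY dY' YY.
have basis i : cov_basis g i Y v *m g v =
    (\sum_r J i r *: cov_basis h r Y' (F v)) *m H *m J^T.
  have E : \sum_r J i r *: pdv r Y' (F v) = pdv i Y v *m J + Y v *m T i.
    have dY1 (a : 'I_1) b : differentiable (fun y => Y y a b) v by rewrite ord1.
    rewrite -!pdm_row -(pdm_mulmx i dY1 diffJ) pdm_row.
    rewrite (pdv_near i YY); apply/rowP => l.
    rewrite summxE [RHS]mxE (pd_pull i (dY' l)).2.
    by apply: eq_bigr => r _; rewrite !mxE.
  rewrite {1}/cov_basis mulmxDl -mulmxA conn_pullback.
  have -> : \sum_r J i r *: cov_basis h r Y' (F v) =
      pdv i Y v *m J + Y v *m (T i + \sum_r J i r *: (J *m conn h r (F v))).
    rewrite mulmxDr addrA -E mulmx_sumr -big_split; apply: eq_bigr => r _ /=.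
    by rewrite /cov_basis scalerDr -(nbhs_singleton YY) -scalemxAr mulmxA.
  by rewrite mulmxDl (mulmxDl _ _ J^T) /g -/J -/H !mulmxA.
rewrite ccovE mulmx_suml.
have -> : ccov h (w *m J) Y' (F v) =
    \sum_i w 0 i *: \sum_r J i r *: cov_basis h r Y' (F v).
  rewrite ccovE; under [RHS]eq_bigr do rewrite scaler_sumr.
  rewrite exchange_big; apply: eq_bigr => r _; rewrite mxE scaler_suml.
  by apply: eq_bigr => i _; rewrite scalerA.
rewrite !mulmx_suml; apply: eq_bigr => i _.
by rewrite -!scalemxAl basis.
Qed.

(** If B = C J has orthonormal rows then C^T C inverts the induced Gram matrix,
    and the trace of the covariant derivative of Y turns into a sum over the
    rows of B, to which [ccov_pullback] applies. *)
Lemma cdiv_pullback (Y : 'rV[R]_k -> 'rV[R]_k) (Y' : 'rV[R]_n -> 'rV[R]_n)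
    (B : 'M[R]_(k, n)) :
  field_diff Y v -> field_diff Y' (F v) ->
  (\forall y \near v, Y y *m jac F y = Y' (F y)) ->
  (B <= J)%MS -> B *m H *m B^T = 1%:M ->
  cdiv g Y v = \sum_j ip h (F v) (ccov h (row j B) Y' (F v)) (row j B).
Proof.
move=> dY dY' YY /submxP[C BC] B1.
pose A : 'M[R]_k := \matrix_i ccov g (delta_mx 0 i) Y v.
pose A' : 'M[R]_(k, n) := \matrix_i ccov h (row i J) Y' (F v).
have AA : A *m g v = A' *m H *m J^T.
  apply/row_matrixP => i; rewrite !row_mul !rowK (ccov_pullback _ dY dY' YY).
  by rewrite -rowE.
have gC : g v *m (C^T *m C) = 1%:M.
  rewrite mulmxA; apply: mulmx1C; rewrite mulmxA.
  by move: B1; rewrite BC trmx_mul /g -/J -/H !mulmxA.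
have -> : cdiv g Y v = \tr A.
  by rewrite /cdiv /mxtrace; apply: eq_bigr => i _; rewrite [RHS]mxE.
have -> : A = A' *m H *m (B^T *m C).
  by rewrite -[LHS]mulmx1 -gC mulmxA AA BC trmx_mul !mulmxA.
rewrite mulmxA mxtrace_mulC !mulmxA /mxtrace.
have CA j : row j (C *m A') = ccov h (row j B) Y' (F v).
  rewrite row_mul BC row_mul !mulmx_sum_row ccov_sumv; apply: eq_bigr => i _.
  by rewrite rowK ccovZv.
by apply: eq_bigr => j _; rewrite mulmx_trE row_mul CA.
Qed.

Lemma cgrad_pullback (f : 'rV[R]_n -> R) w : differentiable f (F v) ->
  ip h (F v) (cgrad g (fun y => f (F y)) v *m J) (w *m J) = dird (w *m J) f (F v).
Proof.
move=> df.
have -> : ip h (F v) (cgrad g (fun y => f (F y)) v *m J) (w *m J) =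
    (cgrad g (fun y => f (F y)) v *m g v *m w^T) 0 0.
  by rewrite /ip trmx_mul /g -/J -/H !mulmxA.
have gi : (invmx (g v))^T = invmx (g v).
  by rewrite trmx_inv pullback_metric_sym.
have -> : cgrad g (fun y => f (F y)) v =
    (\row_i pd i (fun y => f (F y)) v) *m invmx (g v).
  apply/rowP => i; rewrite !mxE; apply: eq_bigr => j _.
  by rewrite -{1}gi !mxE mulrC.
rewrite mulmxKV ?gunit// mxE /dird.
under eq_bigr do rewrite mxE (pd_pull _ df).2 mulr_suml.
rewrite exchange_big; apply: eq_bigr => r _; rewrite mxE mulr_suml.
by apply: eq_bigr => i _; rewrite [w^T i 0]mxE; ring.
Qed.

(** The components are recovered from the ambient field by
    Y = (Y J) h J^T g^-1, where every factor is differentiable. *)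
Lemma tangent_field_diff (Y : 'rV[R]_k -> 'rV[R]_k) (Y' : 'rV[R]_n -> 'rV[R]_n) :
  (forall j, differentiable (fun y => Y' y 0 j) (F v)) ->
  (\forall y \near v, Y y *m jac F y = Y' (F y)) -> field_diff Y v.
Proof.
move=> dY' YY l.
have dh a b : differentiable (fun y => h (F y) a b) v.
  exact: (pd_pull _ (gram_diff hsm a b Ov)).1.
have dJt a b : differentiable (fun y => (jac F y)^T a b) v.
  have dJ := diffJ.
  by rewrite (_ : (fun y => _) = (fun y => jac F y b a))//; apply/funext => y; rewrite mxE.
have dYF (a : 'I_1) b : differentiable (fun y => Y' (F y) a b) v.
  by rewrite ord1; exact: (pd_pull _ (dY' b)).1.
have d1 (a : 'I_1) b : differentiable (fun y => (Y' (F y) *m h (F y)) a b) v.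
  exact: (pd_mulmx l a b dYF dh).1.
have d2 (a : 'I_1) b : differentiable (fun y => (Y' (F y) *m h (F y) *m (jac F y)^T) a b) v.
  exact: (pd_mulmx l a b d1 dJt).1.
have d3 a b : differentiable (fun y => invmx (g y) a b) v.
  have [+ _] : Ck 1 U (fun y => invmx (g y) a b).
    by apply: Ck_invmx => // c d; exact: pullback_metric_Ck.
  exact.
apply: near_differentiable (pd_mulmx l 0 l d2 d3).1.
have nU : \forall y \near v, U y by apply: (open_near hU) Uv.
apply: filterS2 YY nU => y <- Uy.
have -> : Y y *m jac F y *m h (F y) *m (jac F y)^T = Y y *m g y.
  by rewrite /g !mulmxA.
by rewrite mulmxK ?gunit.
Qed.

End AtPoint.
End Immersion.

(** * Extension of orthonormal frames *)

Section GramSchmidt.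
Variables (R : realType) (n : nat) (h : 'rV[R]_n -> 'M[R]_n).
Implicit Types (O : set 'rV[R]_n) (E : nat -> 'rV[R]_n -> 'rV[R]_n).

Lemma open_positive O (f : 'rV[R]_n -> R) : open O -> smooth O f ->
  open [set y | O y /\ 0 < f y].
Proof.
move=> hO sf; rewrite openE => y [Oy fy] /=.
have cf : {for y, continuous f} by exact: (sf 0%N).
have nf : \forall z \near y, 0 < f z.
  by move/cvgrPdist_lt : cf => /(_ _ fy); apply: filterS => z;
    rewrite ltr_norml => /andP[_ ?]; lra.
exact: filterI (open_near hO (fun z Oz => Oz) Oy) nf.
Qed.

(** Gram-Schmidt, one field at a time: the next field is the normalized
    orthogonal part W of a constant field, on the neighbourhood of x where W does
    not vanish. *)
Lemma frame_extend s O E (e : nat -> 'rV[R]_n) x : (s <= n)%N ->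
  open O -> (forall i j, smooth O (fun y => h y i j)) ->
  (forall y, O y -> (h y)^T = h y) -> O x ->
  (forall q, (0 < q <= s)%N -> sfield O (E q)) ->
  (forall y p q, O y -> (0 < p <= s)%N -> (0 < q <= s)%N ->
     ip h y (E p y) (E q y) = (p == q)%:R) ->
  (forall p q, (0 < p <= n)%N -> (0 < q <= n)%N ->
     ip h x (e p) (e q) = (p == q)%:R) ->
  (forall q, (0 < q <= s)%N -> E q x = e q) ->
  exists O' E', [/\ open O' /\ O' x, O' `<=` O,
    (forall q, sfield O' (E' q)) /\
    (forall y p q, O' y -> (0 < p <= n)%N -> (0 < q <= n)%N ->
       ip h y (E' p y) (E' q y) = (p == q)%:R),
    forall q, (0 < q <= s)%N -> E' q = E q
    & forall q, (0 < q <= n)%N -> E' q x = e q].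
Proof.
move=> sn; have [d] := ubnP (n - s); elim: d s sn O E => // d IH s sn O E hd hO.
move=> hsm hsym Ox sE oE oe Ex.
have [ns|lt_sn] := leqP n s.
  have {sn ns} sE' : s = n by apply/eqP; rewrite eqn_leq sn ns.
  subst s.
  (* the indices outside 1, ..., n also need a smooth field *)
  pose E' q y := if (0 < q <= n)%N then E q y else 0.
  have EE q : (0 < q <= n)%N -> E' q = E q by move=> hq; apply/funext => y; rewrite /E' hq.
  exists O, E'; split=> //.
  - split=> [q|y p q Oy hp hq]; last by rewrite !EE// oE.
    have [hq|hq] := boolP (0 < q <= n)%N; first by rewrite EE//; exact: sE.
    rewrite (_ : E' q = fun=> 0); last by apply/funext => y; rewrite /E' (negPf hq).
    by move=> l; apply: (@smooth_ext _ _ _ hO (fun=> 0)) => [y _|];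
      [rewrite mxE | exact: smooth_cst].
  - by move=> q hq; rewrite EE// Ex.
pose W y : 'rV[R]_n := e s.+1 - \sum_(1 <= j < s.+1) ip h y (e s.+1) (E j y) *: E j y.
have rng j : (1 <= j < s.+1)%N -> (0 < j <= s)%N by [].
have rn j : (0 < j <= s)%N -> (0 < j <= n)%N.
  by case/andP=> -> hj; rewrite (leq_trans hj).
have hs1 : (0 < s.+1 <= n)%N by [].
have sc : sfield O (fun=> e s.+1) by move=> l; exact: smooth_cst.
have sW : sfield O W.
  move=> l; apply: (@smooth_ext _ _ _ hO (fun y => e s.+1 0 l +
      - \sum_(1 <= j < s.+1 | (1 <= j < s.+1)%N) ip h y (e s.+1) (E j y) * E j y 0 l)).
    move=> y _; rewrite /W !mxE summxE; congr (_ - _).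
    by rewrite -big_nat; apply: eq_bigr => j _; rewrite mxE.
  apply: (smoothD hO (sc l)).
  apply: smoothN => //; apply: smooth_sum => // j hj; apply: smoothM => //.
    by apply: ip_smooth => //; exact: sE.
  exact: sE.
have oW y j : O y -> (0 < j <= s)%N -> ip h y (W y) (E j y) = 0.
  move=> Oy hj; rewrite /W ipBl ip_suml (@sum_nat_only _ _ _ j)//.
    by rewrite ipZl oE// eqxx mulr1 subrr.
  by move=> i /rng hi ij; rewrite ipZl oE// (negPf ij) mulr0.
pose N y := ip h y (W y) (W y).
have sN : smooth O N by exact: ip_smooth.
have Wx : W x = e s.+1.
  rewrite /W big_nat big1 ?subr0// => j /rng hj.
  have sj : (s.+1 == j) = false.
    by apply/eqP => E0; case/andP: hj => _; rewrite -E0 ltnn.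
  by rewrite Ex// (oe _ _ hs1 (rn _ hj)) sj scale0r.
pose O1 := [set y | O y /\ 0 < N y].
have O1O : O1 `<=` O by move=> y [].
have hO1 : open O1 by exact: open_positive.
have O1x : O1 x by split=> //; rewrite /N Wx oe// eqxx.
pose E1 q y := if q == s.+1 then (Num.sqrt (N y))^-1 *: W y else E q y.
have E1s q : (0 < q <= s)%N -> E1 q = E q.
  move=> hq; apply/funext => y; rewrite /E1 (_ : (q == s.+1) = false)//.
  by apply/eqP => E0; case/andP: hq => _; rewrite E0 ltnn.
have E1S : E1 s.+1 = fun y => (Num.sqrt (N y))^-1 *: W y.
  by apply/funext => y; rewrite /E1 eqxx.
have sN1 : smooth O1 (fun y => (Num.sqrt (N y))^-1).
  apply: smoothV => //.
    by move=> y [_ Ny]; rewrite gt_eqF// sqrtr_gt0.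
  by apply: smooth_sqrt => //; [move=> y [] | exact: smoothS sN].
have cases q : (0 < q <= s.+1)%N -> (0 < q <= s)%N \/ q = s.+1.
  case/andP=> q0; rewrite leq_eqVlt => /orP[/eqP|]; first by right.
  by rewrite ltnS => qs; left; rewrite q0.
have [|||||||||O' [E' [hO' O'O sE' EE' Ex']]] := IH s.+1 _ O1 E1 _ hO1.
- by [].
- by rewrite ltnS in hd; apply: leq_trans hd; rewrite ltn_sub2l.
- by move=> i j; exact: smoothS (hsm i j).
- by move=> y /O1O; exact: hsym.
- exact: O1x.
- move=> q /cases[hq|->].
    by rewrite E1s// => l; apply: smoothS O1O _; exact: sE.
  rewrite E1S => l; apply: (@smooth_ext _ _ _ hO1
    (fun y => (Num.sqrt (N y))^-1 * W y 0 l)) => [y _|]; first by rewrite /= [RHS]mxE.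
  by apply: smoothM => //; exact: smoothS O1O (sW l).
- move=> y p q O1y; have Oy := O1O _ O1y.
  move=> /cases[hp|->] /cases[hq|->].
  + by rewrite (E1s _ hp) (E1s _ hq) oE.
  + rewrite (E1s _ hp) E1S ipZr (ipC hsym)// oW// mulr0.
    rewrite (_ : (p == s.+1) = false)//.
    by apply/eqP => E0; case/andP: hp => _; rewrite E0 ltnn.
  + rewrite (E1s _ hq) E1S ipZl oW// mulr0 (_ : (s.+1 == q) = false)//.
    by apply/eqP => E0; case/andP: hq => _; rewrite -E0 ltnn.
  + rewrite E1S ipZl ipZr -/(N y) eqxx.
    have Ny : 0 < N y by case: O1y.
    rewrite mulrA -invfM -expr2 sqr_sqrtr ?ltW// mulVf// gt_eqF//.
- exact: oe.
- move=> q /cases[hq|->]; first by rewrite E1s// Ex.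
  by rewrite E1S /N Wx oe// eqxx sqrtr1 invr1 scale1r.
exists O', E'; split=> //; first exact: subset_trans O1O.
move=> q hq; rewrite EE' ?E1s//; case/andP: hq => -> hq.
by rewrite (leq_trans hq).
Qed.

End GramSchmidt.

(** * Charts of the manifold and parametrizations of the leaves *)

Section NearMetric.
Variables (R : realType) (k : nat) (h h' : 'rV[R]_k -> 'M[R]_k).
Implicit Types (x v : 'rV[R]_k).

Lemma ccov_near_metric v Y x : (\forall y \near x, h y = h' y) ->
  ccov h v Y x = ccov h' v Y x.
Proof.
move=> hh; rewrite !ccovE; apply: eq_bigr => i _; congr (_ *: (_ + _ *m _)).
apply/matrixP => j l; rewrite [LHS]mxE [RHS]mxE /christoffel (nbhs_singleton hh).
congr (_ * _); apply: eq_bigr => b _; congr (_ * (_ + _ - _));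
  by apply: pd_near; apply: filterS hh => y ->.
Qed.

Lemma cdiv_near Y Y' x : (\forall y \near x, h y = h' y) ->
  (\forall y \near x, Y y = Y' y) -> cdiv h Y x = cdiv h' Y' x.
Proof.
move=> hh YY; apply: eq_bigr => i _; congr (fun_of_matrix _ 0 i).
by rewrite (ccov_near_metric _ _ hh) (ccov_near _ _ YY).
Qed.

Lemma cgrad_near (f f' : 'rV[R]_k -> R) x : h x = h' x ->
  (\forall y \near x, f y = f' y) -> cgrad h f x = cgrad h' f' x.
Proof.
move=> hh ff; apply/rowP => i; rewrite !mxE hh; apply: eq_bigr => j _.
by rewrite (pd_near _ ff).
Qed.

End NearMetric.

Section Chart.
Variables (R : realType) (n : nat) (M : manifold R n) (g : riemannian_metric M).
Variable a : chart_ix M.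
Local Notation O := (cimg a).
Local Notation h := (metric_coord g a).
Implicit Types (p : M) (y v w : 'rV[R]_n).

Lemma cinv_cdom y : O y -> cdom a (cinv a y).
Proof. by move=> [p pa <-]; rewrite coordK. Qed.

Lemma cinvK y : O y -> coord a (cinv a y) = y.
Proof. by move=> [p pa <-]; rewrite coordK. Qed.

Lemma coord_cimg p : cdom a p -> O (coord a p).
Proof. by move=> pa; exists p. Qed.

Lemma metric_sym y : O y -> (h y)^T = h y.
Proof. by move=> /cinv_cdom; exact: gram_sym. Qed.

Lemma metric_pos y v : O y -> v != 0 -> 0 < ip h y v v.
Proof. by move=> /cinv_cdom ya v0; exact: (gram_posdef g ya). Qed.

Lemma metric_unit y : O y -> h y \in unitmx.
Proof.
move=> Oy; rewrite -row_free_unit; apply: inj_row_free => v v0.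
apply: contraTeq isT => /(metric_pos Oy).
by rewrite /ip v0 mul0mx mxE ltxx.
Qed.

Lemma inner_ip p v w : cdom a p -> inner g a p v w = ip h (coord a p) v w.
Proof. by move=> pa; rewrite /inner /ip /metric_coord coordK. Qed.

Lemma inner_transition b p v w : cdom a p -> cdom b p ->
  inner g a p v w = inner g b p (v *m transition_jac a b p) (w *m transition_jac a b p).
Proof.
move=> pa pb; rewrite /inner (gram_transition g pa pb) trmx_mul.
by rewrite !mulmxA.
Qed.

Lemma lenE (Z : vfield M) p : smooth_vfield Z -> cdom a p ->
  len g Z p = norm_at g a p (Z a p).
Proof.
move=> [tZ _] pa; rewrite /len /norm_at (inner_transition _ _ pa (chart_atP p)).
by rewrite -tZ//; exact: chart_atP.
Qed.

End Chart.

Section LeafChart.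
Variables (R : realType) (n k : nat) (M : manifold R n) (g : riemannian_metric M).
Variables (S : set M) (p : M) (P : param M k) (hP : local_param S p P).

Definition leaf_dom (a : chart_ix M) : set 'rV[R]_k :=
  pdom P `&` pmap P @^-1` cdom a.
Definition leaf_map (a : chart_ix M) (v : 'rV[R]_k) := coord a (pmap P v).

Lemma leaf_dom_open a : open (leaf_dom a).
Proof.
have [[oP _] _ [cP _] _ _] := hP.
rewrite openE => v [Pv av] /=.
have n1 : \forall w \near v, pdom P w by exact: (open_near oP (fun z Oz => Oz) Pv).
have n2 : nbhs (pmap P v) (cdom a) by apply: open_nbhs_nbhs; split=> //; exact: cdom_open.
exact: filterI n1 (cP v Pv _ n2).
Qed.

Lemma leaf_ppt a : cdom a p -> leaf_dom a (ppt P).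
Proof. by have [[_ [Pp Pe]] _ _ _ _] := hP; move=> pa; split=> //=; rewrite Pe. Qed.

Lemma leaf_near a Q : cdom a p -> (forall v, leaf_dom a v -> Q v) ->
  \forall v \near ppt P, Q v.
Proof.
by move=> pa aQ; exact: (@open_near _ _ _ (@leaf_dom_open a) Q _ aQ (leaf_ppt pa)).
Qed.

Lemma leaf_map_cimg a v : leaf_dom a v -> cimg a (leaf_map a v).
Proof. by case=> _ av; exact: coord_cimg. Qed.

Lemma leaf_map_Ck a j : Ck 3 (leaf_dom a) (fun v => leaf_map a v 0 j).
Proof. by have [_ _ _ cP _] := hP; exact: cP. Qed.

Lemma leaf_map_ppt a : leaf_map a (ppt P) = coord a p.
Proof. by have [[_ [_ Pe]] _ _ _ _] := hP; rewrite /leaf_map Pe. Qed.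

Lemma pjac_free a v : leaf_dom a v -> row_free (pjac P a v).
Proof. by have [_ _ _ _ fP] := hP; case=> Pv av; exact: fP. Qed.

Lemma induced_pullback a v : leaf_dom a v ->
  induced g P a v = pullback_metric (metric_coord g a) (leaf_map a) v.
Proof. by case=> _ av; rewrite /pullback_metric /metric_coord coordK. Qed.

Lemma pullback_unit a v : leaf_dom a v ->
  pullback_metric (metric_coord g a) (leaf_map a) v \in unitmx.
Proof.
move=> Uv; rewrite -row_free_unit; apply: inj_row_free => w w0.
have Ov := leaf_map_cimg Uv.
have wJ : w *m pjac P a v = 0.
  apply: contraTeq isT => /(metric_pos g Ov).
  rewrite /ip trmx_mul !mulmxA -(mulmxA w) -(mulmxA w).
  by rewrite [w *m _]w0 mul0mx mxE ltxx.
by apply: (row_free_inj (pjac_free Uv)); rewrite mul0mx.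
Qed.

Lemma pull_vecK a v w : leaf_dom a v -> pull_vec P a v (w *m pjac P a v) = w.
Proof. by move=> Uv; rewrite /pull_vec mulmxKp// pjac_free. Qed.

Lemma pull_vecKV a v X : (X <= pjac P a v)%MS ->
  pull_vec P a v X *m pjac P a v = X.
Proof. exact: mulmxKpV. Qed.

Lemma pjac_transition a b v : leaf_dom a v -> leaf_dom b v ->
  pjac P b v = pjac P a v *m transition_jac a b (pmap P v).
Proof.
move=> [Pv av] [_ bv].
have dF j : differentiable (fun w => leaf_map a w 0 j) v.
  by have [+ _] := leaf_map_Ck a j; apply.
apply/matrixP => i j; rewrite [LHS]mxE [RHS]mxE.
have dG : differentiable (fun y => coord b (cinv a y) 0 j) (leaf_map a v).
  by have [+ _] := transition_smooth a b j 1%N; apply; exists (pmap P v).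
transitivity (pd i (fun w => coord b (cinv a (leaf_map a w)) 0 j) v).
  apply: pd_near; have [[oP _] _ _ _ _] := hP.
  apply: (open_near (@leaf_dom_open a) _ (conj Pv av)) => w [_ aw].
  by rewrite /leaf_map coordK.
rewrite (chain_rule i dF dG).2; apply: eq_bigr => r _.
by rewrite [pjac _ _ _ _ _]mxE [transition_jac _ _ _ _ _]mxE.
Qed.

Lemma induced_chart a b v : leaf_dom a v -> leaf_dom b v ->
  induced g P a v = induced g P b v.
Proof.
move=> av bv; rewrite /induced (pjac_transition av bv).
rewrite (gram_transition g av.2 bv.2).
by rewrite !trmx_mul !mulmxA.
Qed.

(** With [induced_chart], this moves a divergence taken in the chart selected at
    a nearby point to a fixed chart around x. *)
Lemma pull_field_chart a b (V : vfield M) v : leaf_dom a v -> leaf_dom b v ->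
  V b (pmap P v) = V a (pmap P v) *m transition_jac a b (pmap P v) ->
  (V a (pmap P v) <= pjac P a v)%MS -> pull_field P a V v = pull_field P b V v.
Proof.
move=> av bv Vab /submxP[w Vw].
rewrite /pull_field Vab Vw pull_vecK// -mulmxA -(pjac_transition av bv).
by rewrite pull_vecK.
Qed.

End LeafChart.

(** * The flag of leaves *)

Lemma dird_pull (R : realType) (n k : nat) (F : 'rV[R]_k -> 'rV[R]_n)
    (f : 'rV[R]_n -> R) (v w : 'rV[R]_k) :
  (forall j, differentiable (fun y => F y 0 j) v) -> differentiable f (F v) ->
  dird (w *m jac F v) f (F v) = \sum_i w 0 i * pd i (fun y => f (F y)) v.
Proof.
move=> dF df; rewrite /dird.
under eq_bigr do rewrite mxE mulr_suml.
rewrite exchange_big; apply: eq_bigr => i _.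
rewrite (chain_rule i dF df).2 mulr_sumr; apply: eq_bigr => r _.
by rewrite [jac _ _ _ _]mxE mulrA.
Qed.

Section TangentSpaces.
Variables (R : realType) (n s : nat) (M : manifold R n) (g : riemannian_metric M).
Variables (u : nat -> M -> R) (L : level_params M) (Z : nat -> vfield M).
Hypothesis sn : (s < n)%N.
Hypothesis hu : forall i, (i < s)%N -> Ck_fun 3 (u i).
Hypothesis hL : level_paramsP s u L.
Hypothesis hZ : forall m, (m <= s)%N -> smooth_vfield (Z m).
Hypothesis hZ0 : forall m a x, (m <= s)%N -> cdom a x -> Z m a x != 0.
Hypothesis hZu : forall m a x, (m < s)%N -> cdom a x ->
  (len g (Z m.+1) x)^-1 *: Z m a x = grad_leaf g L m (u m) a x.
Hypothesis hdiv : forall m x, (m < s)%N -> div_leaf g L m (Z m) x = 0.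

Lemma norm_atZ b p c v : 0 <= c -> norm_at g b p (c *: v) = c * norm_at g b p v.
Proof.
move=> c0; rewrite /norm_at /inner linearZ /= -!scalemxAl -scalemxAr mxE mxE.
by rewrite mulrA -expr2 sqrtrM ?sqr_ge0// sqrtr_sqr ger0_norm.
Qed.

Lemma norm_grad_leaf m b p : (m < s)%N -> cdom b p ->
  norm_at g b p (grad_leaf g L m (u m) b p) = len g (Z m) p / len g (Z m.+1) p.
Proof.
move=> ms pb; rewrite -hZu// norm_atZ ?invr_ge0 ?sqrtr_ge0// mulrC.
by rewrite -lenE//; apply: hZ; exact: ltnW.
Qed.

Variable a : chart_ix M.
Local Notation O := (cimg a).
Local Notation h := (metric_coord g a).

Definition Zc m (y : 'rV[R]_n) : 'rV[R]_n := Z m a (cinv a y).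
(** Lengths are measured in the chart selected at each point; [ZlenE] computes
    this one in the chart a. *)
Definition Zlen m (y : 'rV[R]_n) : R := len g (Z m) (cinv a y).
Definition uc m (y : 'rV[R]_n) : R := u m (cinv a y).
Definition leaf_tangent m p : 'M[R]_(n - m, n) := pjac (L m p) a (ppt (L m p)).

Let hO : open O := @cimg_open _ _ M a.
Let hsm := gram_smooth g a.

Lemma Zc_smooth m : (m <= s)%N -> sfield O (Zc m).
Proof. by move=> ms l; have [_ sZ] := hZ ms; exact: sZ. Qed.

Lemma ZlenE m y : (m <= s)%N -> O y ->
  Zlen m y = Num.sqrt (ip h y (Zc m y) (Zc m y)).
Proof.
move=> ms Oy; have ya := cinv_cdom Oy.
by rewrite /Zlen (lenE g (hZ ms) ya) /norm_at inner_ip// cinvK.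
Qed.

Lemma ip_Zc_gt0 m y : (m <= s)%N -> O y -> 0 < ip h y (Zc m y) (Zc m y).
Proof. by move=> ms Oy; apply: metric_pos => //; apply: hZ0 => //; exact: cinv_cdom. Qed.

Lemma Zlen_gt0 m y : (m <= s)%N -> O y -> 0 < Zlen m y.
Proof. by move=> ms Oy; rewrite ZlenE// sqrtr_gt0 ip_Zc_gt0. Qed.

Lemma sqr_Zlen m y : (m <= s)%N -> O y -> Zlen m y ^+ 2 = ip h y (Zc m y) (Zc m y).
Proof. by move=> ms Oy; rewrite ZlenE// sqr_sqrtr// ltW// ip_Zc_gt0. Qed.

Lemma Zlen_smooth m : (m <= s)%N -> smooth O (Zlen m).
Proof.
move=> ms; apply: (@smooth_ext _ _ _ hO
  (fun y => Num.sqrt (ip h y (Zc m y) (Zc m y)))) => [y Oy|]; first by rewrite ZlenE.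
apply: smooth_sqrt => // [y Oy|]; first exact: ip_Zc_gt0.
by apply: ip_smooth => //; exact: Zc_smooth.
Qed.

Lemma uc_Ck m : (m < s)%N -> Ck 3 O (uc m).
Proof. by move=> ms; exact: hu. Qed.

Section Leaf.
Variables (m : nat) (p : M).
Hypothesis ms : (m <= s)%N.
Local Notation P := (L m p).
Let hP := hL p ms.
Local Notation F := (leaf_map P a).
Local Notation U := (leaf_dom P a).

Lemma leafF_diff v j : U v -> differentiable (fun y => F y 0 j) v.
Proof. by move=> Uv; have [+ _] := leaf_map_Ck hP a j; apply. Qed.

Lemma leaf_level j v : (j < m)%N -> pdom P v -> u j (pmap P v) = u j p.
Proof.
move=> jm Pv; have [[oP _] _ [_ imP] _ _] := hP.
have [W _ WE] := imP _ oP (fun x Px => Px).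
have : (W `&` level_set u m p) (pmap P v) by rewrite -WE; exists v.
by case=> _; apply.
Qed.

(** The functions u_0, ..., u_{m-1} are constant on the leaf. *)
Lemma leaf_du j v w : (j < m)%N -> U v -> dird (w *m pjac P a v) (uc j) (F v) = 0.
Proof.
move=> jm Uv; have js : (j < s)%N by exact: leq_trans jm ms.
have df : differentiable (uc j) (F v).
  by have [+ _] := uc_Ck js; apply; exact: leaf_map_cimg.
rewrite /pjac (dird_pull _ (fun i => leafF_diff i Uv) df) big1// => i _.
have E : \forall y \near v, uc j (F y) = u j p.
  apply: (@open_near _ _ _ (leaf_dom_open hP (a := a)) (fun y => uc j (F y) = u j p) _ _ Uv).
  by move=> y [Py ay]; rewrite /uc /leaf_map coordK// leaf_level.
by rewrite (pd_near _ E) pd_cst mulr0.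
Qed.

(** Stated at all points v of the parametrization, not only at the base point,
    because the Laplacian of the leaf differentiates the gradient. *)
Lemma cgrad_leaf_ip (f : M -> R) v X : U v ->
  differentiable (fun y => f (cinv a y)) (F v) -> (X <= pjac P a v)%MS ->
  ip h (F v) (cgrad (induced g P a) (fun v => f (pmap P v)) v *m pjac P a v) X =
  dird X (fun y => f (cinv a y)) (F v).
Proof.
move=> Uv df /submxP[w ->].
have hF := leaf_map_Ck hP a.
rewrite -[RHS](cgrad_pullback (@metric_sym _ _ _ g a)
  (@leaf_map_cimg _ _ _ _ P a) hF (pullback_unit g hP (a := a)) Uv w df).
have -> : cgrad (induced g P a) (fun v => f (pmap P v)) v =
    cgrad (pullback_metric h F) (fun v => f (cinv a (F v))) v.
  apply: cgrad_near; first exact: induced_pullback.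
  apply: (@open_near _ _ _ (leaf_dom_open hP (a := a))
    (fun v => f (pmap P v) = f (cinv a (F v))) _ _ Uv) => w' [Pw aw].
  by rewrite /leaf_map coordK.
by [].
Qed.

Hypothesis pa : cdom a p.

Lemma leaf_tangent_rank : \rank (leaf_tangent m p) = (n - m)%N.
Proof. by apply/eqP; exact: (pjac_free hP (leaf_ppt hP pa)). Qed.

Lemma grad_leaf_tangent (f : M -> R) : (grad_leaf g L m f a p <= leaf_tangent m p)%MS.
Proof. exact: submxMl. Qed.

Lemma grad_leaf_ip (f : M -> R) X :
  differentiable (fun y => f (cinv a y)) (coord a p) -> (X <= leaf_tangent m p)%MS ->
  ip h (coord a p) (grad_leaf g L m f a p) X =
  dird X (fun y => f (cinv a y)) (coord a p).
Proof.
have Ep := leaf_map_ppt hP a.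
rewrite -Ep => df hX; exact: cgrad_leaf_ip (leaf_ppt hP pa) df hX.
Qed.

End Leaf.

Lemma Zc_grad m p : (m < s)%N -> cdom a p ->
  (Zlen m.+1 (coord a p))^-1 *: Zc m (coord a p) = grad_leaf g L m (u m) a p.
Proof. by move=> ms pa; rewrite /Zlen /Zc coordK// hZu. Qed.

Lemma Zc_tangent m p : (m < s)%N -> cdom a p -> (Zc m (coord a p) <= leaf_tangent m p)%MS.
Proof.
move=> ms pa; have r0 := Zlen_gt0 ms (coord_cimg pa).
have -> : Zc m (coord a p) = Zlen m.+1 (coord a p) *: grad_leaf g L m (u m) a p.
  by rewrite -Zc_grad// scalerA mulfV ?scale1r// gt_eqF.
by apply: scalemx_sub; exact: grad_leaf_tangent.
Qed.

Lemma uc_diff m y : (m < s)%N -> O y -> differentiable (uc m) y.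
Proof. by move=> ms Oy; have [+ _] := uc_Ck ms; apply. Qed.

(** On the tangent space of Sigma_m, du_m is the pairing with the gradient of
    u_m on Sigma_m, which is Z_m / |Z_{m+1}|. *)
Lemma du_tangent m p X : (m < s)%N -> cdom a p -> (X <= leaf_tangent m p)%MS ->
  dird X (uc m) (coord a p) =
  (Zlen m.+1 (coord a p))^-1 * ip h (coord a p) (Zc m (coord a p)) X.
Proof.
move=> ms pa hX; rewrite -ipZl Zc_grad// grad_leaf_ip//; first exact: ltnW.
exact: uc_diff (coord_cimg pa).
Qed.

Lemma du_Zc m p : (m < s)%N -> cdom a p ->
  dird (Zc m (coord a p)) (uc m) (coord a p) != 0.
Proof.
move=> ms pa; have Op := coord_cimg pa.
rewrite du_tangent// ?Zc_tangent// mulf_neq0// ?invr_eq0 gt_eqF//; first exact: Zlen_gt0.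
by apply: ip_Zc_gt0 => //; exact: ltnW.
Qed.

(** By induction on m. T_{m+1} is contained in the common kernel of du_0, ...,
    du_m, and by [du_Zc] this kernel misses Z_m, which lies in T_m. Since T_{m+1}
    has one dimension less than T_m, it is the whole kernel. *)
Lemma leaf_tangent_kernel m p X : (m <= s)%N -> cdom a p ->
  (X <= leaf_tangent m p)%MS <-> forall j, (j < m)%N -> dird X (uc j) (coord a p) = 0.
Proof.
move=> + pa; elim: m X => [|m IH] X ms.
  split=> // _; apply: submx_full.
  by rewrite /row_full leaf_tangent_rank// subn0.
have Op := coord_cimg pa; have hP := hL p ms.
have Up := leaf_ppt hP pa.
have tan_du Y j : (j < m.+1)%N -> (Y <= leaf_tangent m.+1 p)%MS ->
    dird Y (uc j) (coord a p) = 0.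
  by move=> jm /submxP[w ->]; rewrite -(leaf_map_ppt hP a) leaf_du.
split=> [hX j jm|hX]; first exact: tan_du.
have ms' : (m <= s)%N by exact: ltnW.
have sub1 : (leaf_tangent m.+1 p + Zc m (coord a p) <= leaf_tangent m p)%MS.
  rewrite addsmx_sub Zc_tangent// andbT; apply/row_subP => i.
  apply/(IH _ ms') => j jm; apply: tan_du; first exact: leqW.
  exact: row_sub.
have lt1 : (leaf_tangent m.+1 p < leaf_tangent m.+1 p + Zc m (coord a p))%MS.
  rewrite /ltmx addsmxSl /=; apply/negP => /(submx_trans (addsmxSr _ _)) hz.
  by have := du_Zc ms pa; rewrite tan_du// eqxx.
(* T_m = T_{m+1} + R Z_m, by dimension *)
have sub2 : (leaf_tangent m p <= leaf_tangent m.+1 p + Zc m (coord a p))%MS.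
  have := mxrank_leqif_sup sub1; case=> _ <-.
  rewrite eqn_leq mxrankS//= (leaf_tangent_rank ms' pa) -(subnSK (leq_ltn_trans ms' sn)).
  by have := rank_ltmx lt1; rewrite leaf_tangent_rank.
have hXm : (X <= leaf_tangent m p)%MS by apply/(IH _ ms') => j jm; apply: hX; exact: leqW.
have /sub_addsmxP[[A c] /= XE] := submx_trans hXm sub2.
have c0 : c = 0.
  apply/rowP => i; rewrite ord1 mxE; apply/eqP.
  have := hX m (ltnSn m); rewrite XE dirdD tan_du ?submxMl// add0r.
  have -> : c *m Zc m (coord a p) = c 0 0 *: Zc m (coord a p).
    by rewrite [c]mx11_scalar mul_scalar_mx mxE eqxx.
  by rewrite dirdZ => /eqP; rewrite mulf_eq0 (negPf (du_Zc ms pa)) orbF.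
by rewrite XE c0 mul0mx addr0 submxMl.
Qed.

(** On the common kernel of du_0, ..., du_{j-1} the form du_j and the pairing
    with Z_j are proportional ([du_tangent]), so both families cut out the same
    subspace. *)
Lemma leaf_tangent_orthogonal m p X : (m <= s)%N -> cdom a p ->
  (X <= leaf_tangent m p)%MS <->
  forall j, (j < m)%N -> ip h (coord a p) (Zc j (coord a p)) X = 0.
Proof.
move=> ms pa; have Op := coord_cimg pa; rewrite leaf_tangent_kernel//.
have key j : (j < m)%N -> (forall i, (i < j)%N -> dird X (uc i) (coord a p) = 0) ->
    (dird X (uc j) (coord a p) == 0) =
    (ip h (coord a p) (Zc j (coord a p)) X == 0).
  move=> jm hX; have js : (j < s)%N by exact: leq_trans jm ms.
  rewrite du_tangent//; last by apply/leaf_tangent_kernel => //; exact: ltnW.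
  by rewrite mulf_eq0 invr_eq0 (gt_eqF (Zlen_gt0 js Op)).
split=> hX j jm.
  by apply/eqP; rewrite -key ?hX// => i ij; apply: hX; exact: ltn_trans jm.
elim/ltn_ind: j jm => j IH jm; apply/eqP; rewrite key ?hX// => i ij.
by apply: IH => //; exact: ltn_trans jm.
Qed.

Lemma Zc_orthogonal i j y : (i < j)%N -> (j < s)%N -> O y ->
  ip h y (Zc i y) (Zc j y) = 0.
Proof.
move=> ij js Oy; have ya := cinv_cdom Oy; rewrite -(cinvK Oy).
by have /(leaf_tangent_orthogonal (Zc j _) (ltnW js) ya) := Zc_tangent js ya; apply.
Qed.

(** A point q of the leaf through p has the same leaf, parametrized anew around
    q; its tangent space contains the rows of the Jacobian at v, and both have
    dimension n - m. *)
Lemma pjac_orthogonal m p v X : (m <= s)%N -> leaf_dom (L m p) a v ->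
  (X <= pjac (L m p) a v)%MS <->
  forall j, (j < m)%N ->
    ip h (leaf_map (L m p) a v) (Zc j (leaf_map (L m p) a v)) X = 0.
Proof.
move=> ms Uv; have qa := Uv.2; set q := pmap (L m p) v in qa *.
have hP := hL p ms.
have sub : (pjac (L m p) a v <= leaf_tangent m q)%MS.
  apply/row_subP => i; apply/(leaf_tangent_kernel _ ms qa) => j jm.
  by rewrite rowE; exact: leaf_du.
rewrite -[leaf_map _ _ _]/(coord a q) -leaf_tangent_orthogonal//.
have [_ E] := mxrank_leqif_sup sub.
have sub' : (leaf_tangent m q <= pjac (L m p) a v)%MS.
  by rewrite -E (leaf_tangent_rank ms qa) (eqP (pjac_free hP Uv)).
by split=> hX; apply: submx_trans hX _.
Qed.

Lemma nu_Zc m p : (m < s)%N -> cdom a p ->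
  nu g u L m.+1 a p = (Zlen m (coord a p))^-1 *: Zc m (coord a p).
Proof.
move=> ms pa; have Op := coord_cimg pa.
rewrite /nu /= norm_grad_leaf// -Zc_grad// scalerA /Zlen coordK//.
have := Zlen_gt0 ms Op; have := Zlen_gt0 (ltnW ms) Op; rewrite /Zlen coordK// => r0 r1.
by congr (_ *: _); field; rewrite !gt_eqF.
Qed.

(** * The frame adapted to the flag *)

Section Frame.
Variables (O' : set 'rV[R]_n) (E : nat -> 'rV[R]_n -> 'rV[R]_n).
Local Notation cc := (conn_coef h E).
Local Notation ed := (frame_deriv E).
Local Notation flap := (frame_laplacian h E).
Hypotheses (hO' : open O') (O'O : O' `<=` O).
Hypothesis sE : forall q, sfield O' (E q).
Hypothesis oE : forall y p q, O' y -> (0 < p <= n)%N -> (0 < q <= n)%N ->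
  ip h y (E p y) (E q y) = (p == q)%:R.
Hypothesis EN : forall q y, (0 < q <= s)%N -> E q y = (Zlen q.-1 y)^-1 *: Zc q.-1 y.

Let hsm' i j : smooth O' (fun y => h y i j).
Proof. exact: smoothS O'O (hsm i j). Qed.
Let hsym' y : O' y -> (h y)^T = h y.
Proof. by move=> /O'O; exact: metric_sym. Qed.
Let hunit' y : O' y -> h y \in unitmx.
Proof. by move=> /O'O; exact: metric_unit. Qed.
Let expand := frame_expand oE.

Lemma ip_Zc_eq0 j y X : (j < s)%N -> O' y ->
  (ip h y (Zc j y) X = 0) <-> (ip h y X (E j.+1 y) = 0).
Proof.
move=> js O'y; have r0 := Zlen_gt0 (ltnW js) (O'O O'y).
rewrite EN// ipZr (ipC hsym' X _ O'y) /=; split=> [->|/eqP]; first by rewrite mulr0.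
by rewrite mulf_eq0 invr_eq0 gt_eqF//= => /eqP.
Qed.

Lemma tangent_expand m p v X : (m <= s)%N -> leaf_dom (L m p) a v ->
  O' (leaf_map (L m p) a v) -> (X <= pjac (L m p) a v)%MS ->
  X = \sum_(m.+1 <= k < n.+1) ip h (leaf_map (L m p) a v) X
        (E k (leaf_map (L m p) a v)) *: E k (leaf_map (L m p) a v).
Proof.
move=> ms Uv O'v /(pjac_orthogonal _ ms Uv) hX.
have mn : (m.+1 <= n.+1)%N by rewrite ltnS ltnW// (leq_ltn_trans ms).
rewrite {1}(expand X O'v) (big_cat_nat (ltn0Sn m) mn) /=.
rewrite [X in X + _]big_nat big1 ?add0r// => k /andP[k1 km].
have km' : (k.-1 < m)%N by case: (k) k1 km.
have ks : (k.-1 < s)%N by exact: leq_trans km' ms.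
have /(ip_Zc_eq0 _ ks O'v) := hX _ km'.
by rewrite prednK// => ->; rewrite scale0r.
Qed.

Lemma E_tangent m p v k : (m <= s)%N -> leaf_dom (L m p) a v ->
  O' (leaf_map (L m p) a v) -> (m < k <= n)%N ->
  (E k (leaf_map (L m p) a v) <= pjac (L m p) a v)%MS.
Proof.
move=> ms Uv O'v /andP[mk kn]; apply/(pjac_orthogonal _ ms Uv) => j jm.
have js : (j < s)%N by exact: leq_trans jm ms.
apply/(ip_Zc_eq0 _ js O'v); rewrite oE//.
- by rewrite (_ : (k == j.+1) = false)// gtn_eqF// (leq_ltn_trans jm).
- by rewrite kn (leq_trans _ mk).
- by rewrite /= (leq_trans js)// ltnW.
Qed.

Lemma E_leaf_tangent m p k : (m <= s)%N -> cdom a p -> O' (coord a p) -> (m < k <= n)%N ->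
  (E k (coord a p) <= leaf_tangent m p)%MS.
Proof.
move=> ms pa O'p mk; have Ep := leaf_map_ppt (hL p ms) a.
have Up := leaf_ppt (hL p ms) pa.
by rewrite -Ep in O'p *; exact: E_tangent ms Up O'p mk.
Qed.

Lemma frame_deriv_u_eq0 m q y : (m < s)%N -> (m.+1 < q <= n)%N -> O' y -> ed q (uc m) y = 0.
Proof.
move=> ms mq O'y; have Oy := O'O O'y; have ya := cinv_cdom Oy.
have := @E_leaf_tangent m.+1 (cinv a y) q ms ya; rewrite cinvK// => /(_ O'y mq) hX.
have := (leaf_tangent_kernel (E q y) ms ya).1 hX m (ltnSn m).
by rewrite cinvK.
Qed.

Lemma frame_deriv_u m y : (m < s)%N -> O' y -> ed m.+1 (uc m) y = Zlen m y / Zlen m.+1 y.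
Proof.
move=> ms O'y; have Oy := O'O O'y; have ya := cinv_cdom Oy.
have r0 := Zlen_gt0 (ltnW ms) Oy; have r1 := Zlen_gt0 ms Oy.
rewrite /frame_deriv EN//= dirdZ.
have := du_tangent ms ya (Zc_tangent ms ya); rewrite cinvK// => ->.
rewrite -sqr_Zlen//; last exact: ltnW.
by field; rewrite !gt_eqF.
Qed.

Lemma sum_shift (V : nmodType) m (G : nat -> V) :
  \sum_(m.+1 <= k < n.+1) G k = \sum_(j < n - m) G (m.+1 + j)%N.
Proof.
rewrite -(add0n m.+1) big_addn subSS big_mkord.
by apply: eq_bigr => j _; rewrite add0n addnC.
Qed.

Section LeafCalculus.
Variables (m : nat) (p : M).
Hypotheses (ms : (m <= s)%N) (pa : cdom a p) (O'p : O' (coord a p)).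
Local Notation P := (L m p).
Local Notation F := (leaf_map P a).
Local Notation U := (leaf_dom P a).
Let hP := hL p ms.
Let Ep : F (ppt P) = coord a p := leaf_map_ppt hP a.
Let Up : U (ppt P) := leaf_ppt hP pa.
Let hU : open U := leaf_dom_open hP (a := a).

Definition frame_mx : 'M[R]_(n - m, n) :=
  \matrix_(j < n - m) E (m.+1 + j)%N (coord a p).

Lemma frame_mx_range (j : 'I_(n - m)) : (m < m.+1 + j <= n)%N.
Proof.
rewrite ltnS leq_addr /= addSn -ltn_subRL; exact: ltn_ord.
Qed.

Lemma frame_mx_tangent : (frame_mx <= leaf_tangent m p)%MS.
Proof.
by apply/row_subP => j; rewrite rowK; apply: E_leaf_tangent => //; exact: frame_mx_range.
Qed.

Lemma frame_mx_orth : frame_mx *m h (coord a p) *m frame_mx^T = 1%:M.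
Proof.
apply/matrixP => i j; rewrite mulmx_trE row_mul !rowK [RHS]mxE.
have rng (l : 'I_(n - m)) : (0 < m.+1 + l <= n)%N.
  by have /andP[_ ->] := frame_mx_range l.
by rewrite [LHS](oE O'p (rng i) (rng j)) eqn_add2l.
Qed.

Lemma leaf_near_frame Q : (forall v, U v -> O' (F v) -> Q v) ->
  \forall v \near ppt P, Q v.
Proof.
move=> UQ; have nU := leaf_near hP pa (fun v (Uv : U v) => Uv).
have nO : nbhs (F (ppt P)) O' by rewrite Ep; exact: open_nbhs_nbhs.
have cF : {for ppt P, continuous F}.
  by apply: differentiable_continuous; apply: differentiable_row => j; exact: leafF_diff.
by apply: filterS2 nU (cF _ nO) => v; exact: UQ.
Qed.

Lemma cdiv_leaf (Y : 'rV[R]_(n - m) -> 'rV[R]_(n - m)) (Y' : 'rV[R]_n -> 'rV[R]_n) :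
  field_diff Y' (coord a p) ->
  (\forall v \near ppt P, Y v *m pjac P a v = Y' (F v)) ->
  cdiv (induced g P a) Y (ppt P) =
  \sum_(m.+1 <= k < n.+1)
    ip h (coord a p) (ccov h (E k (coord a p)) Y' (coord a p)) (E k (coord a p)).
Proof.
rewrite -{1}Ep => dY' YY.
have hF := leaf_map_Ck hP a.
have dY := tangent_field_diff hU hsm (@leaf_map_cimg _ _ _ _ P a) hF
  (pullback_unit g hP (a := a)) Up dY' YY.
have gnear : \forall v \near ppt P, induced g P a v = pullback_metric h F v.
  by apply: (leaf_near hP pa) => v Uv; exact: induced_pullback.
have -> : cdiv (induced g P a) Y (ppt P) = cdiv (pullback_metric h F) Y (ppt P).
  exact: (cdiv_near gnear (filterS (fun v _ => erefl (Y v)) gnear)).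
have B1 := frame_mx_orth; have Bt := frame_mx_tangent.
rewrite -Ep in B1.
rewrite (cdiv_pullback hU hsm (@metric_sym _ _ _ g a) (@metric_unit _ _ _ g a)
  (@leaf_map_cimg _ _ _ _ P a) hF (pullback_unit g hP (a := a)) Up dY dY' YY Bt B1).
rewrite sum_shift Ep; apply: eq_bigr => j _.
by rewrite rowK.
Qed.

Lemma ccov_leaf (V : vfield M) (Y' : 'rV[R]_n -> 'rV[R]_n) X W :
  field_diff Y' (coord a p) ->
  (forall v, U v -> O' (F v) -> V a (pmap P v) = Y' (F v)
     /\ (Y' (F v) <= pjac P a v)%MS) ->
  (X <= leaf_tangent m p)%MS -> (W <= leaf_tangent m p)%MS ->
  ip h (coord a p) (ccov (induced g P a) (pull_vec P a (ppt P) X)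
    (pull_field P a V) (ppt P) *m pjac P a (ppt P)) W =
  ip h (coord a p) (ccov h X Y' (coord a p)) W.
Proof.
move=> dY' VY hX /submxP[w ->].
rewrite -{1}Ep in dY'.
have hF := leaf_map_Ck hP a.
have YY : \forall v \near ppt P, pull_field P a V v *m pjac P a v = Y' (F v).
  apply: leaf_near_frame => v Uv O'v; have [VE Yt] := VY v Uv O'v.
  by rewrite /pull_field VE pull_vecKV.
have dY := tangent_field_diff hU hsm (@leaf_map_cimg _ _ _ _ P a) hF
  (pullback_unit g hP (a := a)) Up dY' YY.
have gnear : \forall v \near ppt P, induced g P a v = pullback_metric h F v.
  by apply: (leaf_near hP pa) => v Uv; exact: induced_pullback.
rewrite (ccov_near_metric _ _ gnear).
have := ccov_pullback hU hsm (@metric_sym _ _ _ g a) (@metric_unit _ _ _ g a)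
  (@leaf_map_cimg _ _ _ _ P a) hF (pullback_unit g hP (a := a)) Up
  (pull_vec P a (ppt P) X) dY dY' YY.
rewrite (pull_vecKV hX : _ *m jac F (ppt P) = X) -Ep => EQ.
rewrite /ip trmx_mul !mulmxA; congr ((_ *m _) 0 0).
by rewrite -EQ {3}/pullback_metric !mulmxA.
Qed.

End LeafCalculus.

Definition logZlen m y : R := ln (Zlen m y).

Lemma logZlen_smooth m : (m <= s)%N -> smooth O (logZlen m).
Proof.
by move=> ms; apply: smooth_ln => // [y Oy|]; [exact: Zlen_gt0 | exact: Zlen_smooth].
Qed.

Lemma Z_pjac m p v : (m < s)%N -> leaf_dom (L m p) a v ->
  (Z m a (pmap (L m p) v) <= pjac (L m p) a v)%MS.
Proof.
move=> ms Uv; have -> : Z m a (pmap (L m p) v) = Zc m (leaf_map (L m p) a v).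
  by rewrite /Zc /leaf_map coordK//; exact: Uv.2.
apply/(pjac_orthogonal _ (ltnW ms) Uv) => j jm.
exact: Zc_orthogonal jm ms (leaf_map_cimg Uv).
Qed.

Lemma Zc_frame m y : (m < s)%N -> O' y -> Zc m y = Zlen m y *: E m.+1 y.
Proof.
move=> ms O'y; rewrite EN//= scalerA mulfV ?scale1r// gt_eqF//.
by apply: Zlen_gt0; [exact: ltnW | exact: O'O].
Qed.

(** The divergence on Sigma_m of Z_m = |Z_m| E_{m+1} is E_{m+1} |Z_m| plus |Z_m|
    times the mean curvature. It vanishes at p in the chart selected at p, and
    hence in the chart a. *)
Lemma frame_deriv_logZlen m y : (m < s)%N -> O' y ->
  ed m.+1 (logZlen m) y = - \sum_(m.+2 <= j < n.+1) cc j m.+1 j y.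
Proof.
move=> ms O'y; have Oy := O'O O'y; have pa := cinv_cdom Oy.
have ms' : (m <= s)%N by exact: ltnW.
set p := cinv a y in pa *; pose P := L m p; have hP : local_param _ p P := hL p ms'.
have Ep : coord a p = y by rewrite /p cinvK.
have pb := chart_atP p.
have D1 : cdiv (induced g P a) (pull_field P a (Z m)) (ppt P) = 0.
  rewrite -(hdiv p ms) /div_leaf -/P.
  have na := leaf_near hP pa (fun v (Uv : leaf_dom P a v) => Uv).
  have nb := leaf_near hP pb (fun v (Uv : leaf_dom P (chart_at p) v) => Uv).
  apply: cdiv_near; apply: filterS2 na nb => v av bv.
    exact: (induced_chart g hP av bv).
  apply: (pull_field_chart hP av bv); last exact: Z_pjac.
  by have [tZ _] := hZ ms'; exact: tZ av.2 bv.2.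
have YY : \forall v \near ppt P,
    pull_field P a (Z m) v *m pjac P a v = Zc m (leaf_map P a v).
  apply: (leaf_near hP pa) => v Uv.
  rewrite /pull_field pull_vecKV; last exact: Z_pjac.
  by rewrite /Zc /leaf_map coordK//; exact: Uv.2.
have O'p : O' (coord a p) by rewrite Ep.
have := cdiv_leaf ms' pa O'p _ YY; rewrite -/P {}D1 Ep.
move=> /(_ (sfield_diff (Zc_smooth ms') Oy)).
have dr := smooth_differentiable (Zlen_smooth ms') Oy.
have T k : (m.+1 <= k < n.+1)%N ->
    ip h y (ccov h (E k y) (Zc m) y) (E k y) =
    ed k (Zlen m) y * (m.+1 == k)%:R + Zlen m y * cc k m.+1 k y.
  move=> /andP[mk kn].
  have nz : \forall z \near y, Zc m z = Zlen m z *: E m.+1 z.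
    by apply: (open_near hO') O'y => z; exact: Zc_frame.
  rewrite (ccov_near _ _ nz) (ccovZ _ _ dr (sfield_diff (sE m.+1) O'y)).
  rewrite ipDl !ipZl oE//; last by rewrite (leq_trans (ltn0Sn m) mk).
  by rewrite /= (leq_trans ms)// ltnW.
have hN : (0 < m.+1 <= n)%N by rewrite /= (leq_trans ms)// ltnW.
move=> S0; have {S0} : 0 = \sum_(m.+1 <= k < n.+1)
    (ed k (Zlen m) y * (m.+1 == k)%:R + Zlen m y * cc k m.+1 k y).
  by rewrite {1}S0; apply: eq_big_nat.
rewrite big_ltn; last by rewrite ltnS; case/andP: hN.
have diagN := conn_coef_diag hO' hsm' hsym' hunit' sE oE m.+1 O'y hN.
rewrite eqxx mulr1 diagN mulr0 addr0.
have -> : \sum_(m.+2 <= k < n.+1)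
    (ed k (Zlen m) y * (m.+1 == k)%:R + Zlen m y * cc k m.+1 k y) =
    Zlen m y * \sum_(m.+2 <= k < n.+1) cc k m.+1 k y.
  rewrite mulr_sumr; apply: eq_big_nat => k /andP[mk _].
  by rewrite (_ : (m.+1 == k) = false) ?mulr0 ?add0r// ltn_eqF.
move=> S0; have r0 := Zlen_gt0 ms' Oy.
have -> : ed m.+1 (logZlen m) y = ed m.+1 (Zlen m) y / Zlen m y.
  rewrite /frame_deriv /dird mulr_suml; apply: eq_bigr => i _.
  by rewrite (diff_comp1 i dr (is_derive1_ln r0)).2 mulrA.
have -> : ed m.+1 (Zlen m) y = - (Zlen m y * \sum_(m.+2 <= k < n.+1) cc k m.+1 k y).
  by apply/eqP; rewrite -addr_eq0 -S0.
by rewrite mulrC mulrN mulKf// gt_eqF.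
Qed.

(** Orthonormality keeps only the diagonal second derivatives; the derivatives
    of the frame contribute the connection coefficients. *)
Lemma frame_laplacian_trace m f y : smooth O' f -> O' y ->
  \sum_(m.+1 <= k < n.+1) ip h y (ccov h (E k y)
    (fun z => \sum_(m.+1 <= i < n.+1) ed i f z *: E i z) y) (E k y) =
  flap m f y.
Proof.
move=> sf O'y.
have sed i : smooth O' (ed i f) by exact: dird_smooth.
have df i : field_diff (fun z => ed i f z *: E i z) y.
  move=> l; rewrite (_ : (fun z => _) = (fun z => ed i f z * E i z 0 l)).
    by apply: differentiableM; [exact: smooth_differentiable (sed i) O'y | exact: sfield_diff].
  by apply/funext => z; rewrite mxE.
rewrite /flap -big_split /=; apply: eq_big_nat => k /andP[mk kn].
have hk : (0 < k <= n)%N by rewrite (leq_trans (ltn0Sn m) mk).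
rewrite ccov_sum// ip_suml.
transitivity (\sum_(m.+1 <= i < n.+1)
    ((if i == k then ed k (ed k f) y else 0) + ed i f y * cc k i k y)).
  apply: eq_big_nat => i /andP[mi ni].
  rewrite ccovZ; last 2 first.
  - exact: smooth_differentiable (sed i) O'y.
  - exact: sfield_diff (sE i) O'y.
  rewrite ipDl !ipZl oE//; last by rewrite (leq_trans (ltn0Sn m) mi).
  by case: eqVneq => [->|_]; rewrite ?mulr1 ?mulr0.
rewrite big_split /=; congr (_ + _).
rewrite (@sum_nat_only _ _ _ k) ?eqxx//; first by rewrite mk.
by move=> i _ /negPf ->.
Qed.

(** Near p on the leaf, the gradient of the restriction is the projection of the
    ambient gradient, to which [cdiv_leaf] applies. *)
Lemma claplacian_leaf m p (f : M -> R) : (m <= s)%N -> cdom a p -> O' (coord a p) ->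
  smooth O (fun y => f (cinv a y)) ->
  claplacian (induced g (L m p) a) (fun v => f (pmap (L m p) v)) (ppt (L m p)) =
  flap m (fun y => f (cinv a y)) (coord a p).
Proof.
move=> ms pa O'p sf; have sf' := smoothS O'O sf.
rewrite -(frame_laplacian_trace _ sf' O'p); apply: cdiv_leaf => //.
  move=> l; apply: smooth_differentiable O'p => //.
  apply: (@smooth_ext _ _ _ hO' (fun y =>
    \sum_(m.+1 <= i < n.+1) ed i (fun y => f (cinv a y)) y * E i y 0 l)).
    by move=> y _; rewrite summxE; apply: eq_bigr => i _; rewrite mxE.
  apply: smooth_sum => // i _; apply: smoothM => //; last exact: sE.
  by apply: dird_smooth.
apply: (leaf_near_frame ms pa O'p) => v Uv O'v.
rewrite {1}(tangent_expand ms Uv O'v (submxMl _ _)).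
apply: eq_big_nat => k /andP[mk kn]; congr (_ *: _).
rewrite cgrad_leaf_ip//.
- exact: smooth_differentiable sf (O'O O'v).
- by apply: E_tangent => //; rewrite mk.
Qed.

Lemma cgrad_frame f y : smooth O f -> O' y ->
  cgrad h f y = \sum_(1 <= i < n.+1) ed i f y *: E i y.
Proof.
move=> sf O'y; rewrite {1}(expand (cgrad h f y) O'y).
apply: eq_bigr => k _; congr (_ *: _).
have hi : (invmx (h y))^T = invmx (h y) by rewrite trmx_inv hsym'.
have -> : cgrad h f y = (\row_i pd i f y) *m invmx (h y).
  apply/rowP => i; rewrite !mxE; apply: eq_bigr => j _.
  by rewrite -{1}hi !mxE mulrC.
rewrite /ip mulmxKV ?hunit'// mxE; apply: eq_bigr => i _.
by rewrite !mxE mulrC.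
Qed.

Lemma claplacian_frame f y : smooth O f -> O' y -> claplacian h f y = flap 0 f y.
Proof.
move=> sf O'y; rewrite -(frame_laplacian_trace _ (smoothS O'O sf) O'y) /claplacian.
pose B : 'M[R]_n := \matrix_(j < n) E j.+1 y.
have B1 : B *m h y *m B^T = 1%:M.
  apply/matrixP => i j; rewrite mulmx_trE row_mul !rowK [RHS]mxE.
  by rewrite [LHS](oE O'y) ?eqSS//= ltn_ord.
have hB : h y *m (B^T *m B) = 1%:M.
  by rewrite mulmxA; apply: mulmx1C; rewrite mulmxA.
have ng : \forall z \near y, cgrad h f z = \sum_(1 <= i < n.+1) ed i f z *: E i z.
  by apply: (open_near hO') O'y => z; exact: cgrad_frame.
set Y := cgrad h f in ng *.
pose A : 'M[R]_n := \matrix_i ccov h (delta_mx 0 i) Y y.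
have -> : cdiv h Y y = \tr A.
  by rewrite /cdiv /mxtrace; apply: eq_bigr => i _; rewrite [RHS]mxE.
rewrite -[A]mulmx1 -hB !mulmxA mxtrace_mulC !mulmxA /mxtrace big_add1 big_mkord.
apply: eq_bigr => j _; rewrite mulmx_trE !row_mul rowK /= -(ccov_near _ _ ng).
have -> : E j.+1 y *m A = ccov h (E j.+1 y) Y y.
  rewrite mulmx_sum_row [in RHS](row_sum_delta (E j.+1 y)) ccov_sumv.
  by apply: eq_bigr => i _; rewrite rowK ccovZv.
by [].
Qed.

(** * Second fundamental forms and the theorem *)

Lemma ccov_nu m p X W : (m < s)%N -> cdom a p -> O' (coord a p) ->
  (X <= leaf_tangent m p)%MS -> (W <= leaf_tangent m p)%MS ->
  ip h (coord a p) (ccov (induced g (L m p) a) (pull_vec (L m p) a (ppt (L m p)) X)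
    (pull_field (L m p) a (nu g u L m.+1)) (ppt (L m p))
      *m pjac (L m p) a (ppt (L m p))) W =
  ip h (coord a p) (ccov h X (E m.+1) (coord a p)) W.
Proof.
move=> ms pa O'p hX hW; apply: (ccov_leaf (ltnW ms)) => //.
  exact: sfield_diff (sE m.+1) O'p.
move=> v Uv O'v; split; first by rewrite nu_Zc ?EN//; exact: Uv.2.
by apply: E_tangent => //; [exact: ltnW | rewrite ltnSn (leq_trans ms)// ltnW].
Qed.

Lemma ip_tangent m p X Y : (m <= s)%N -> cdom a p -> O' (coord a p) ->
  (X <= leaf_tangent m p)%MS ->
  ip h (coord a p) X Y = \sum_(m.+1 <= k < n.+1)
    ip h (coord a p) X (E k (coord a p)) * ip h (coord a p) Y (E k (coord a p)).
Proof.
move=> ms pa O'p hX; have Ep := leaf_map_ppt (hL p ms) a.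
have Up := leaf_ppt (hL p ms) pa; rewrite -Ep in O'p *.
rewrite {1}(tangent_expand ms Up O'p hX) ip_suml; apply: eq_bigr => k _.
by rewrite ipZl (ipC hsym' _ Y).
Qed.

Lemma leaf_tangentS m p : (m < s)%N -> cdom a p ->
  (leaf_tangent m.+1 p <= leaf_tangent m p)%MS.
Proof.
move=> ms pa; apply/row_subP => i; apply/(leaf_tangent_kernel _ (ltnW ms) pa) => j jm.
by apply: (leaf_tangent_kernel _ ms pa).1; [exact: row_sub | exact: leqW].
Qed.

Section Point.
Variable x : M.
Hypotheses (ax : chart_at x = a) (O'x : O' (coord a x)).
Local Notation y := (coord a x).
Let xa : cdom a x. Proof. by rewrite -ax; exact: chart_atP. Qed.

Lemma sffE m X W : (m < s)%N -> (X <= leaf_tangent m x)%MS -> (W <= leaf_tangent m x)%MS ->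
  sff g u L m.+1 x X W = ip h y (ccov h X (E m.+1) y) W.
Proof. by move=> ms hX hW; rewrite /sff /cov_leaf ax inner_ip// ccov_nu. Qed.

Lemma sff_frame m p q : (m < s)%N -> (m < p <= n)%N -> (m < q <= n)%N ->
  sff g u L m.+1 x (E p y) (E q y) = cc p m.+1 q y.
Proof.
by move=> ms hp hq; rewrite sffE//; apply: E_leaf_tangent => //; exact: ltnW.
Qed.

(** The rows of C are the coordinates of E_{m+2}, ..., E_n in the coordinate
    frame of Sigma_{m+1}. By orthonormality C^T C is the inverse of the induced
    Gram matrix, so traces for the induced metric become sums over the E_q. *)
Lemma leaf_frame_coords m : (m < s)%N -> exists C : 'M[R]_(n - m.+1),
  invmx (gram_leaf g L m.+1 x) = C^T *m C /\
  forall i j, (C *m sff_mx g u L m.+1 x *m C^T) i j =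
    cc (m.+2 + i) m.+1 (m.+2 + j) y.
Proof.
move=> ms; have /submxP[C BC] := frame_mx_tangent ms xa O'x.
have B1 := frame_mx_orth m.+1 O'x.
set B := frame_mx m.+1 x in BC B1; set J := leaf_tangent m.+1 x in BC.
have GE : gram_leaf g L m.+1 x = J *m h y *m J^T.
  have Pe : pmap (L m.+1 x) (ppt (L m.+1 x)) = x by have [[_ []]] := hL x ms.
  by rewrite /gram_leaf ax /induced Pe /metric_coord coordK.
have GC : gram_leaf g L m.+1 x *m (C^T *m C) = 1%:M.
  rewrite mulmxA; apply: mulmx1C; rewrite mulmxA GE.
  by move: B1; rewrite BC trmx_mul !mulmxA.
exists C; split.
  have [uG _] := mulmx1_unit GC.
  by rewrite -[LHS]mulmx1 -GC mulmxA mulVmx// mul1mx.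
move=> i j.
pose D : 'M[R]_(n - m.+1, n) := \matrix_i ccov h (row i J) (E m.+1) y.
have SE : sff_mx g u L m.+1 x = D *m h y *m J^T.
  apply/matrixP => k l; rewrite mulmx_trE row_mul rowK mxE ax sffE//.
  - by apply: submx_trans (row_sub _ _) _; exact: leaf_tangentS.
  - by apply: submx_trans (row_sub _ _) _; exact: leaf_tangentS.
have -> : C *m sff_mx g u L m.+1 x *m C^T = (C *m D) *m h y *m B^T.
  by rewrite SE BC trmx_mul !mulmxA.
rewrite mulmx_trE row_mul rowK.
have -> : row i (C *m D) = ccov h (row i B) (E m.+1) y.
  rewrite row_mul BC row_mul !mulmx_sum_row ccov_sumv; apply: eq_bigr => k _.
  by rewrite rowK ccovZv.
by rewrite rowK.
Qed.

Lemma mean_curvE m : (m < s)%N ->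
  mean_curv g u L m.+1 x = \sum_(m.+2 <= p < n.+1) cc p m.+1 p y.
Proof.
move=> ms; have [C [GE SE]] := leaf_frame_coords ms.
rewrite /mean_curv GE -mulmxA mxtrace_mulC sum_shift.
by apply: eq_bigr => i _; exact: SE.
Qed.

Lemma sff_norm2E m : (m < s)%N -> sff_norm2 g u L m.+1 x =
  \sum_(m.+2 <= p < n.+1) \sum_(m.+2 <= q < n.+1) cc p m.+1 q y ^+ 2.
Proof.
move=> ms; have [C [GE SE]] := leaf_frame_coords ms.
rewrite /sff_norm2 GE; set S := sff_mx g u L m.+1 x in SE *.
have -> : \tr (C^T *m C *m S *m (C^T *m C) *m S^T) =
    \tr ((C *m S *m C^T) *m (C *m S *m C^T)^T).
  rewrite -!mulmxA mxtrace_mulC !trmx_mul trmxK.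
  by rewrite !mulmxA.
rewrite sum_shift; apply: eq_bigr => i _; rewrite mxE sum_shift.
by apply: eq_bigr => j _; rewrite [_^T j i]mxE -expr2 SE.
Qed.

Lemma inner_grad_leaf m (F G : M -> R) : (m <= s)%N ->
  smooth O (fun z => F (cinv a z)) -> smooth O (fun z => G (cinv a z)) ->
  inner g a x (grad_leaf g L m F a x) (grad_leaf g L m G a x) =
  \sum_(m.+1 <= q < n.+1)
    ed q (fun z => F (cinv a z)) y * ed q (fun z => G (cinv a z)) y.
Proof.
move=> ms sF sG; have Oy := O'O O'x.
rewrite inner_ip// (ip_tangent _ ms xa O'x); last exact: grad_leaf_tangent.
apply: eq_big_nat => k hk; have Ek := E_leaf_tangent ms xa O'x hk.
by rewrite !grad_leaf_ip//; exact: smooth_differentiable Oy.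
Qed.

Lemma len_grad_leaf m p : (m < s)%N ->
  ln (len g (grad_leaf g L m (u m)) p) = ln (len g (Z m) p) - ln (len g (Z m.+1) p).
Proof.
move=> ms; have pb := chart_atP p; rewrite {1}/len norm_grad_leaf//.
have pos j : (j <= s)%N -> 0 < len g (Z j) p.
  move=> js; rewrite sqrtr_gt0 inner_ip//; apply: metric_pos; first exact: coord_cimg.
  exact: hZ0.
by rewrite ln_div// posrE pos// ltnW.
Qed.

Lemma main_identity (e : nat -> 'rV[R]_n) :
  (forall q, (0 < q <= n)%N -> E q y = e q) ->
  laplacian g (fun y => ln (len g (Z 0%N) y)) x
  - laplacian_leaf g L s (fun y => ln (len g (Z s) y)) x
  = \sum_(0 <= m < s) (sff_norm2 g u L m.+1 x - mean_curv g u L m.+1 x ^+ 2)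
    + intermediate_curv g s x e
    + \sum_(1 <= m < s) \sum_(m.+1 <= p < s.+1) \sum_(p.+1 <= q < n.+1)
        (sff g u L m x (e p) (e p) * sff g u L m x (e q) (e q)
         - sff g u L m x (e p) (e q) ^+ 2)
    + \sum_(0 <= m < s)
        ((len g (Z m) x)^-1
           * deriv_leaf L m (nu g u L m.+1 (chart_at x) x)
               (div_leaf g L m (Z m)) x
         - inner g (chart_at x) x
             (grad_leaf g L m.+1
                (fun y => ln (len g (grad_leaf g L m (u m)) y))
                (chart_at x) x)
             (grad_leaf g L m.+1 (fun y => ln (len g (Z m.+1) y))
                (chart_at x) x)).
Proof.
move=> Ee; have Oy := O'O O'x.
have -> : laplacian g (fun p => ln (len g (Z 0%N) p)) x = flap 0 (logZlen 0) y.
  rewrite /laplacian ax.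
  exact: (claplacian_frame (logZlen_smooth (leq0n s)) O'x).
have -> : laplacian_leaf g L s (fun p => ln (len g (Z s) p)) x = flap s (logZlen s) y.
  rewrite /laplacian_leaf ax.
  exact: (claplacian_leaf (f := fun p => ln (len g (Z s) p)) (leqnn s) xa O'x
    (logZlen_smooth (leqnn s))).
have phi0 m z : (m < s)%N -> O' z -> 0 < Zlen m z / Zlen m.+1 z.
  by move=> ms /O'O Oz; rewrite divr_gt0// Zlen_gt0// ltnW.
have Cu m : (m < s)%N -> Ck 2 O' (uc m).
  move=> ms; have := CkW (uc_Ck ms).
  have CkS : forall r f, Ck r O f -> Ck r O' f.
    elim=> [|r IH] f; first by move=> cf z /O'O; exact: cf.
    by case=> df cf; split=> [z /O'O|i]; [exact: df | apply: IH; exact: cf].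
  exact: CkS.
have slf m : (m <= s)%N -> smooth O' (logZlen m).
  by move=> ms; apply: smoothS O'O _; exact: logZlen_smooth.
have sphi m : (m < s)%N -> smooth O' (fun z => Zlen m z / Zlen m.+1 z).
  move=> ms; apply: smoothM => //.
    by apply: smoothS O'O _; apply: Zlen_smooth; exact: ltnW.
  apply: smoothV => // [z /O'O Oz|]; first by rewrite gt_eqF// Zlen_gt0.
  by apply: smoothS O'O _; exact: Zlen_smooth.
have lfphi m z : (m < s)%N -> O' z ->
    logZlen m z = logZlen m.+1 z + ln (Zlen m z / Zlen m.+1 z).
  move=> ms /O'O Oz; rewrite /logZlen ln_div ?posrE ?Zlen_gt0//; last exact: ltnW.
  by rewrite addrC subrK.
rewrite (flag_identity hO' hsm' hsym' hunit' sE oE sn Cu slf sphi phi0 lfphi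
  frame_deriv_u_eq0 frame_deriv_u frame_deriv_logZlen O'x).
congr (_ + _ + _ + _).
- by apply: eq_big_nat => m /andP[_ ms]; rewrite sff_norm2E// mean_curvE.
- apply: eq_big_nat => p /andP[p1 ps]; apply: eq_big_nat => q /andP[pq qn].
  have hp : (0 < p <= n)%N by rewrite p1 (leq_trans (_ : p <= s)%N)// ltnW.
  have hq : (0 < q <= n)%N by rewrite (leq_trans p1 (ltnW pq)).
  by rewrite /Rm ax -!Ee.
- apply: eq_big_nat => m /andP[m1 ms].
  apply: eq_big_nat => p /andP[mp ps]; apply: eq_big_nat => q /andP[pq qn].
  case: m m1 ms mp => // m _ ms mp; have ms' : (m < s)%N by exact: ltnW.
  have hp : (m < p <= n)%N.
    by rewrite (ltn_trans _ mp)//= (leq_trans (_ : p <= s)%N)// ltnW.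
  have hq : (m < q <= n)%N by rewrite (ltn_trans _ pq)//; case/andP: hp.
  rewrite -!Ee ?sff_frame//.
  + by case/andP: hq => mq ->; rewrite (leq_trans _ mq).
  + by case/andP: hp => mp' ->; rewrite (leq_trans _ mp').
rewrite -sumrN; apply: eq_big_nat => m /andP[_ ms].
have -> : deriv_leaf L m (nu g u L m.+1 (chart_at x) x) (div_leaf g L m (Z m)) x = 0.
  rewrite /deriv_leaf (_ : (fun v => _) = fun=> 0); first exact: derive_cst.
  by apply/funext => v; exact: hdiv.
have lg : (fun z => ln (len g (grad_leaf g L m (u m)) (cinv a z))) =
    (fun z => logZlen m z - logZlen m.+1 z).
  by apply/funext => z; exact: len_grad_leaf.
rewrite mulr0 sub0r ax inner_grad_leaf//; last 2 first.
- rewrite lg; apply: smoothD => //; first by apply: logZlen_smooth; exact: ltnW.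
  by apply: smoothN => //; exact: logZlen_smooth.
- exact: logZlen_smooth.
congr (- _); rewrite lg; apply: eq_big_nat => q _; congr (_ * _).
have d0 := smooth_differentiable (slf m (ltnW ms)) O'x.
have d1 := smooth_differentiable (slf m.+1 ms) O'x.
by rewrite /frame_deriv dirdDf ?dirdN//; exact: differentiableN.
Qed.

End Point.
End Frame.
End TangentSpaces.

Theorem theorem3p4 (R : realType) (n s : nat) (hs : (1 <= s <= n - 1)%N)
  (M : manifold R n) (g : riemannian_metric M)
  (u : nat -> M -> R)
  (hu : forall i, (i < s)%N -> Ck_fun 3 (u i))
  (hdu : forall x : M, exists v : 'I_s -> 'rV[R]_n, wedge_du u x v != 0)
  (L : level_params M) (hL : level_paramsP s u L)
  (Z : nat -> vfield M)
  (hZ : forall m, (m <= s)%N -> smooth_vfield (Z m))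
  (hZ0 : forall m a x, (m <= s)%N -> cdom a x -> Z m a x != 0)
  (hZu : forall m a x, (m < s)%N -> cdom a x ->
     (len g (Z m.+1) x)^-1 *: Z m a x = grad_leaf g L m (u m) a x)
  (hdiv : forall m x, (m < s)%N -> div_leaf g L m (Z m) x = 0)
  (x : M) (e : nat -> 'rV[R]_n) (he : adapted_frame g u L s x e) :
  laplacian g (fun y => ln (len g (Z 0%N) y)) x
  - laplacian_leaf g L s (fun y => ln (len g (Z s) y)) x
  = \sum_(0 <= m < s) (sff_norm2 g u L m.+1 x - mean_curv g u L m.+1 x ^+ 2)
    + intermediate_curv g s x e
    + \sum_(1 <= m < s) \sum_(m.+1 <= p < s.+1) \sum_(p.+1 <= q < n.+1)
        (sff g u L m x (e p) (e p) * sff g u L m x (e q) (e q)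
         - sff g u L m x (e p) (e q) ^+ 2)
    + \sum_(0 <= m < s)
        ((len g (Z m) x)^-1
           * deriv_leaf L m (nu g u L m.+1 (chart_at x) x)
               (div_leaf g L m (Z m)) x
         - inner g (chart_at x) x
             (grad_leaf g L m.+1
                (fun y => ln (len g (grad_leaf g L m (u m)) y))
                (chart_at x) x)
             (grad_leaf g L m.+1 (fun y => ln (len g (Z m.+1) y))
                (chart_at x) x)).
Proof.
have sn : (s < n)%N.
  by case/andP: hs => s1; case: (n) => [|n'] /=; [case: (s) s1 | rewrite subn1].
have [oe eN _] := he.
pose a := chart_at x; have xa : cdom a x := chart_atP x.
have Oy := coord_cimg xa.
(* the normals nu_q = Z_{q-1} / |Z_{q-1}| *)
pose E0 q y := (Zlen g Z a q.-1 y)^-1 *: Zc Z a q.-1 y.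
have pred_s q : (0 < q <= s)%N -> (q.-1 < s)%N by case: q.
have [||||O' [E [[hO' O'x] O'O [sE oE] EE Ex]]] :=
    @frame_extend R n (metric_coord g a) s (cimg a) E0 e (coord a x) (ltnW sn)
      (cimg_open (a := a)) (gram_smooth g a) (@metric_sym _ _ _ g a) Oy.
- move=> q /pred_s qs l.
  apply: (@smooth_ext _ _ _ (cimg_open (a := a)) (fun y =>
    (Zlen g Z a q.-1 y)^-1 * Zc Z a q.-1 y 0 l)) => [y _|]; first by rewrite [RHS]mxE.
  apply: smoothM; first exact: cimg_open.
    apply: smoothV; first exact: cimg_open.
      by move=> y O_y; rewrite gt_eqF// (Zlen_gt0 g hZ hZ0)// ltnW.
    by apply: (Zlen_smooth g hZ hZ0); exact: ltnW.
  by apply: (Zc_smooth hZ); exact: ltnW.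
- move=> y p q Oy' hp hq; have ps := pred_s _ hp; have qs := pred_s _ hq.
  rewrite ipZl ipZr; have [<-|pq] := eqVneq p q.
    have r0 := Zlen_gt0 g hZ hZ0 (ltnW ps) Oy'.
    rewrite -(sqr_Zlen g hZ hZ0 (ltnW ps) Oy').
    by rewrite mulrA -expr2 -exprMn mulVf ?expr1n// gt_eqF.
  have orth i j : (i < j)%N -> (j < s)%N ->
      ip (metric_coord g a) y (Zc Z a i y) (Zc Z a j y) = 0.
    by move=> ij js; exact: (Zc_orthogonal sn hu hL hZ hZ0 hZu ij js Oy').
  have : p.-1 != q.-1 by case: (p) (q) hp hq pq => [|p'] [|q'].
  rewrite neq_ltn => /orP[pq'|qp']; first by rewrite orth// !mulr0.
  by rewrite (ipC (@metric_sym _ _ _ g a))// orth// !mulr0.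
- by move=> p q hp hq; rewrite -inner_ip//; exact: oe.
- move=> q hq; have qs := pred_s _ hq; rewrite /E0 eN//.
  rewrite -(nu_Zc hZ hZ0 hZu qs xa) prednK//.
  by case/andP: hq.
apply: (main_identity sn hu hL hZ hZ0 hZu hdiv hO' O'O sE oE _ erefl O'x Ex).
by move=> q y hq; rewrite EE.
Qed.
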